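(* Let $3/2<\beta\le\beta^*$. The dynamical systems $(\Omega\times S_\beta,\mathcal A\times\mathcal S,\nu_\beta,K_\beta)$ and $(\Upsilon,\mathcal B,\mathbb P,\sigma')$ are isomorphic, where $\nu_\beta(A)=\mathbb P(\varphi(Z\cap A))$ for $A\in\mathcal A\times\mathcal S$. Moreover, $\nu_\beta$ is the unique $K_\beta$-invariant measure of maximal entropy.
   Context: $\beta^*\approx1.5437$ is the real root of $x^3-2x^2+2x=2$. $\vec q_0=(0,0)$, $\vec q_1=(1,0)$, $\vec q_2=(0,1)$, $f_i(\vec z)=(\vec z+\vec q_i)/\beta$, $S_\beta$ the attractor of this IFS with Borel $\sigma$-algebra $\mathcal S$. $H=\{(x,y):x<\frac1\beta,\ y<\frac1\beta,\ x+y>\frac{1}{\beta(\beta-1)}\}$; $\tilde E_0=([0,\frac1\beta)\times[0,\frac1\beta))\setminus H$; $\tilde E_1=\{0\le y<\frac1\beta,\ \frac{1}{\beta(\beta-1)}<x+y\le\frac1{\beta-1}\}\setminus H$; $\tilde E_2=\{0\le x<\frac1\beta,\ \frac{1}{\beta(\beta-1)}<x+y\le\frac1{\beta-1}\}\setminus H$; $\tilde C_{01}=\{x\ge\frac1\beta,\ y\ge0,\ x+y\le\frac{1}{\beta(\beta-1)}\}$; $\tilde C_{12}=\{x\ge\frac1\beta,\ y\ge\frac1\beta,\ x+y\le\frac1{\beta-1}\}$; $\tilde C_{02}=\{x\ge0,\ y\ge\frac1\beta,\ x+y\le\frac{1}{\beta(\beta-1)}\}$. For $\{i,j,k\}=\{0,1,2\}$,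 $E_i=\bigl(\tilde E_i\cup\bigcup_{n\ge1}f_jf_i^n(H)\cup\bigcup_{n\ge1}f_kf_i^n(H)\bigr)\setminus\bigcup_{n\ge0}f_i^n(H)$; for $ij\in\{01,12,02\}$, $C_{ij}=\tilde C_{ij}\setminus\bigl(\bigcup_{n\ge1}f_if_j^n(H)\cup\bigcup_{n\ge1}f_jf_i^n(H)\bigr)$; $C=C_{01}\cup C_{12}\cup C_{02}$. $\Omega=\{0,1\}^{\mathbb N}$, $\Upsilon=\{0,1,2\}^{\mathbb N}$ with product $\sigma$-algebras $\mathcal A,\mathcal B$, left shifts $\sigma,\sigma'$; $\mathbb P$ is the uniform product measure on $\Upsilon$. $K_\beta:\Omega\times S_\beta\to\Omega\times S_\beta$: $K_\beta(\omega,\vec z)=(\omega,\beta\vec z-\vec q_i)$ if $\vec z\in E_i$; $(\sigma\omega,\beta\vec z-\vec q_i)$ if $\omega_1=0$, $\vec z\in C_{ij}$; $(\sigma\omega,\beta\vec z-\vec q_j)$ if $\omega_1=1$, $\vec z\in C_{ij}$. The digit $d_1(\omega,\vec z)$ is the vector subtracted, $d_n=d_1\circ K_\beta^{n-1}$. $\varphi:\Omega\times S_\beta\to\Upsilon$, $\varphi(\omega,\vec z)=(b_1,b_2,\ldots)$ where $d_n(\omega,\vec z)=\vec q_{b_n}$. $Z=\{(\omega,\vec z):K_\beta^n(\omega,\vec z)\in\Omega\times C\text{ for infinitely many }n\}$. *)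

(* Defs.v *)
From HB Require Import structures.
From mathcomp Require Import all_boot all_order all_algebra.
From mathcomp Require Import all_classical all_reals all_analysis.

Set Implicit Arguments.
Unset Strict Implicit.
Unset Printing Implicit Defensive.

Import Order.TTheory GRing.Theory Num.Theory.
Import numFieldNormedType.Exports.
Local Open Scope classical_set_scope.
Local Open Scope ring_scope.

Section Generic.
Context {R : realType}.

Definition prob_measure {T : Type} (D : set T) (M : set (set T))
    (mu : set T -> \bar R) : Prop :=
  [/\ mu set0 = 0%E,
      (forall A, M A -> (0 <= mu A)%E),
      (forall F : nat -> set T, (forall n, M (F n)) -> trivIset setT F ->
          mu (\bigcup_n F n) = (\sum_(n <oo) mu (F n))%E) &
      mu D = 1%E].

Definition meas_map {T U : Type} (D : set T) (M : set (set T))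
    (D' : set U) (M' : set (set U)) (f : T -> U) : Prop :=
  (forall x, D x -> D' (f x)) /\ (forall B, M' B -> M (D `&` f @^-1` B)).

Definition invariant_prob {T : Type} (D : set T) (M : set (set T))
    (mu : set T -> \bar R) (Tm : T -> T) : Prop :=
  prob_measure D M mu /\ forall B, M B -> mu (D `&` Tm @^-1` B) = mu B.

Definition mps {T : Type} (D : set T) (M : set (set T))
    (mu : set T -> \bar R) (Tm : T -> T) : Prop :=
  meas_map D M D M Tm /\ invariant_prob D M mu Tm.

Definition isomorphic {T U : Type}
    (D1 : set T) (M1 : set (set T)) (mu1 : set T -> \bar R) (T1 : T -> T)
    (D2 : set U) (M2 : set (set U)) (mu2 : set U -> \bar R) (T2 : U -> U) :
    Prop :=
  mps D1 M1 mu1 T1 /\ mps D2 M2 mu2 T2 /\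
  exists (X : set T) (Y : set U) (psi : T -> U) (psiinv : U -> T),
    [/\ M1 X /\ X `<=` D1 /\ mu1 X = 1%E /\ (forall x, X x -> X (T1 x)),
        M2 Y /\ Y `<=` D2 /\ mu2 Y = 1%E /\ (forall y, Y y -> Y (T2 y)),
        (forall x, X x -> Y (psi x) /\ psiinv (psi x) = x) /\
        (forall y, Y y -> X (psiinv y) /\ psi (psiinv y) = y),
        (forall B, M2 B -> M1 (X `&` psi @^-1` B)) /\
        (forall A, M1 A -> M2 (Y `&` psiinv @^-1` A)) &
        (forall B, M2 B -> mu1 (X `&` psi @^-1` B) = mu2 B) /\
        (forall x, X x -> psi (T1 x) = T2 (psi x))].

Definition fin_partition {T : Type} (D : set T) (M : set (set T))
    (s : seq (set T)) : Prop :=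
  [/\ (forall i, (i < size s)%N -> M (nth set0 s i)),
      (forall i j, (i < size s)%N -> (j < size s)%N -> i <> j ->
          nth set0 s i `&` nth set0 s j = set0) &
      \big[setU/set0]_(A <- s) A = D].

Definition eta (t : R) : R := if t == 0 then 0 else - (t * ln t).

Definition part_entropy {T : Type} (mu : set T -> \bar R) (s : seq (set T)) : R :=
  \sum_(A <- s) eta (fine (mu A)).

Definition part_join {T : Type} (s t : seq (set T)) : seq (set T) :=
  [seq A `&` B | A <- s, B <- t].

Definition part_pre {T : Type} (D : set T) (f : T -> T) (s : seq (set T)) :=
  [seq D `&` f @^-1` A | A <- s].

Fixpoint refine {T : Type} (D : set T) (Tm : T -> T) (s : seq (set T)) (n : nat)
    : seq (set T) :=
  match n with
  | 0 => [:: D]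
  | n'.+1 => part_join (refine D Tm s n') (part_pre D (iter n' Tm) s)
  end.

Definition entropy_part {T : Type} (D : set T) (mu : set T -> \bar R)
    (Tm : T -> T) (s : seq (set T)) : R :=
  limn ((fun n : nat => part_entropy mu (refine D Tm s n.+1) / n.+1%:R) : R^o ^nat).

Definition ks_entropy {T : Type} (D : set T) (M : set (set T))
    (mu : set T -> \bar R) (Tm : T -> T) : \bar R :=
  ereal_sup [set (entropy_part D mu Tm s)%:E | s in fin_partition D M].

Definition unique_max_entropy {T : Type} (D : set T) (M : set (set T))
    (nu : set T -> \bar R) (Tm : T -> T) : Prop :=
  [/\ invariant_prob D M nu Tm,
      (forall mu, invariant_prob D M mu Tm ->
          (ks_entropy D M mu Tm <= ks_entropy D M nu Tm)%E) &
      (forall mu, invariant_prob D M mu Tm ->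
          ks_entropy D M mu Tm = ks_entropy D M nu Tm ->
          forall A, M A -> mu A = nu A)].

End Generic.

(* Omega = {0,1}^N, with 0 encoded as false and 1 as true;
   Upsilon = {0,1,2}^N; sequences are indexed from 0 (omega_1 = w 0). *)
Definition Omega := nat -> bool.
Definition Upsilon := nat -> 'I_3.

Definition shiftO (w : Omega) : Omega := fun n => w n.+1.
Definition shiftU (u : Upsilon) : Upsilon := fun n => u n.+1.

Definition o0 : 'I_3 := @Ordinal 3 0 isT.
Definition o1 : 'I_3 := @Ordinal 3 1 isT.
Definition o2 : 'I_3 := @Ordinal 3 2 isT.

Definition sigO : set (set Omega) :=
  <<s [set [set w : Omega | w n = b] | n in [set: nat] & b in [set: bool]] >>.
Definition sigU : set (set Upsilon) :=
  <<s [set [set u : Upsilon | u n = k] | n in [set: nat] & k in [set: 'I_3]] >>.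

Section Concrete.
Variable R : realType.

Definition pt := (R * R)%type.

Definition q (i : 'I_3) : pt :=
  if val i == 1%N then (1, 0) else if val i == 2%N then (0, 1) else (0, 0).

Definition fmap (beta : R) (i : 'I_3) (z : pt) : pt :=
  ((z.1 + (q i).1) / beta, (z.2 + (q i).2) / beta).

Definition Tmap (beta : R) (i : 'I_3) (z : pt) : pt :=
  (beta * z.1 - (q i).1, beta * z.2 - (q i).2).

(* the attractor of the IFS {f_0,f_1,f_2}: the (unique) nonempty compact
   set K with K = f_0(K) u f_1(K) u f_2(K); written as the intersection of
   all such sets *)
Definition S_beta (beta : R) : set pt :=
  [set z | forall K : set pt, K !=set0 -> compact K ->
       K = \bigcup_(i in [set: 'I_3]) (fmap beta i @` K) -> K z].

Definition borel2 : set (set pt) := <<s [set U : set pt | open U] >>.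

Definition Hset (b : R) : set pt :=
  [set z | z.1 < b^-1 /\ z.2 < b^-1 /\ z.1 + z.2 > (b * (b - 1))^-1].

Definition Et (b : R) (i : 'I_3) : set pt :=
  (if val i == 0%N then
     [set z | 0 <= z.1 < b^-1 /\ 0 <= z.2 < b^-1]
   else if val i == 1%N then
     [set z | 0 <= z.2 < b^-1 /\
              (b * (b - 1))^-1 < z.1 + z.2 <= (b - 1)^-1]
   else
     [set z | 0 <= z.1 < b^-1 /\
              (b * (b - 1))^-1 < z.1 + z.2 <= (b - 1)^-1]) `\` Hset b.

Definition C01t (b : R) : set pt :=
  [set z | b^-1 <= z.1 /\ 0 <= z.2 /\ z.1 + z.2 <= (b * (b - 1))^-1].
Definition C12t (b : R) : set pt :=
  [set z | b^-1 <= z.1 /\ b^-1 <= z.2 /\ z.1 + z.2 <= (b - 1)^-1].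
Definition C02t (b : R) : set pt :=
  [set z | 0 <= z.1 /\ b^-1 <= z.2 /\ z.1 + z.2 <= (b * (b - 1))^-1].

Definition fH (b : R) (j i : 'I_3) (n : nat) : set pt :=
  fmap b j @` (iter n (fun A => fmap b i @` A) (Hset b)).
Definition fnH (b : R) (i : 'I_3) (n : nat) : set pt :=
  iter n (fun A => fmap b i @` A) (Hset b).

Definition Eset (b : R) (i : 'I_3) : set pt :=
  (Et b i `|` \bigcup_(j in [set j : 'I_3 | j != i])
                 \bigcup_(n in [set n : nat | (1 <= n)%N]) fH b j i n)
  `\` \bigcup_(n in [set: nat]) fnH b i n.

Definition Cset (b : R) (i j : 'I_3) (Ct : set pt) : set pt :=
  Ct `\` (\bigcup_(n in [set n : nat | (1 <= n)%N]) fH b i j n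
          `|` \bigcup_(n in [set n : nat | (1 <= n)%N]) fH b j i n).
Definition C01 (b : R) := Cset b o0 o1 (C01t b).
Definition C12 (b : R) := Cset b o1 o2 (C12t b).
Definition C02 (b : R) := Cset b o0 o2 (C02t b).
Definition Cunion (b : R) := C01 b `|` C12 b `|` C02 b.

Definition state := (Omega * pt)%type.

(* the index b_1 of the digit d_1 = q_{b_1} *)
Definition digit (b : R) (x : state) : 'I_3 :=
  let: (w, z) := x in
  if z \in Eset b o0 then o0
  else if z \in Eset b o1 then o1
  else if z \in Eset b o2 then o2
  else if z \in C01 b then (if w 0%N then o1 else o0)
  else if z \in C12 b then (if w 0%N then o2 else o1)
  else if z \in C02 b then (if w 0%N then o2 else o0)
  else o0.

Definition Kmap (b : R) (x : state) : state :=
  let: (w, z) := x in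
  (if (z \notin Eset b o0) && (z \notin Eset b o1) && (z \notin Eset b o2)
      && (z \in Cunion b)
   then shiftO w else w,
   Tmap b (digit b x) z).

Definition phi (b : R) (x : state) : Upsilon :=
  fun n => digit b (iter n (Kmap b) x).

Definition Zset (b : R) : set state :=
  [set x | forall m, exists n, (m <= n)%N /\ Cunion b (iter n (Kmap b) x).2].

Definition Dom (b : R) : set state := [set x | S_beta b x.2].
Definition prodsig (b : R) : set (set state) :=
  <<s Dom b, [set C `*` (B `&` S_beta b) | C in sigO & B in borel2] >>.

Definition uniform_product (P : set Upsilon -> \bar R) : Prop :=
  prob_measure setT sigU P /\
  forall (n : nat) (w : Upsilon),
    P [set u | forall k, (k < n)%N -> u k = w k] = ((3%:R : R) ^- n)%:E.

Definition nu (b : R) (P : set Upsilon -> \bar R) : set state -> \bar R :=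
  fun A => P (phi b @` (Zset b `&` A)).

End Concrete.

(* Main.v *)
(* For these beta, S_beta is the triangle minus the radial holes f_i^n(H), so a
   point of S_beta has one or two possible first digits: one on the E_i, two on
   the C_ij. Hence phi maps Omega x S_beta onto Upsilon, and it is injective on Z,
   where the coins can be read off the digits. The interior of C is not empty, so
   some word forces a visit to C; it occurs infinitely often P-almost surely, and
   phi(Z) has full measure.

   Let mu be any invariant measure. A finite partition is approximated by the
   first L digits and L coins. Along an orbit of length n the coins seen are those
   revealed by the digits at the visits to C, plus L further bits, and the times of
   these visits are a function of the digit sequence; so the entropy of the
   partition is at most H(first k digits) / k for every k, hence at most ln 3. If
   the entropy of mu is ln 3, all digit cylinders of length k have mass 3^-k, so phi
   maps mu to P; then mu(Z) = 1 and mu = nu. *)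

(* The obstacle is that the coins might carry entropy of their own. Up to a small error a finite
   partition sees only [L] coins, and the [L] coins in hand at time [n], together with those
   revealed before, determine the [L] coins in hand at every earlier time: a switch drops just one
   coin, and that coin is revealed. So the unrevealed coins cost one window of [L] bits for the
   whole orbit instead of some bits per step. The partition, and also the revealed coins, depend on
   finitely many digits and coins only approximately; both errors are conditional entropies of at
   most [e] per step, controlled by Fano's inequality. Bounding the entropy by each single H(first k
   digits) / k, and not by their limit, makes the equality case elementary: each k separately is
   extremal, and the uniform law on words follows without any generator theorem. In the geometry, a
   digit whose triangle contains the point can fail only because of a hole. This hole lies in a
   second triangle, three triangles never meet, and the holes that would make both digits fail are
   disjoint; so some digit always works. *)
From HB Require Import structures.
From mathcomp Require Import all_boot all_order all_algebra.
From mathcomp Require Import all_classical all_reals all_analysis.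
From mathcomp Require Import ring lra.
Require Import Defs.

Set Implicit Arguments.
Unset Strict Implicit.
Unset Printing Implicit Defensive.

Import Order.TTheory GRing.Theory Num.Theory.
Import numFieldNormedType.Exports.
Local Open Scope classical_set_scope.
Local Open Scope ring_scope.

(** * Geometry of the attractor *)

Section Geometry.
Variables (R : realType) (b : R).

(** The cubic is increasing, so the second inequality says [b <= beta^*] without naming the root. *)
Definition good_base := 3 / 2 < b /\ b ^+ 3 - 2 * b ^+ 2 + 2 * b <= 2.
Hypothesis hb : good_base.

Lemma base_bounds : 3 / 2 < b /\ b < 193 / 125.
Proof.
have [h1 h2] := hb; split=> //; rewrite ltNge; apply/negP => h.
(* With p(x) = x^3 - 2 x^2 + 2 x, this product is p(b) - p(193/125), and p(193/125) is slightly
   above 2. *)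
have h3 : 0 <= (b - 193 / 125) * (b ^+ 2 - 57 / 125 * b + 20249 / 15625).
  by apply: mulr_ge0; nra.
lra.
Qed.

Definition bT : R := (b - 1)^-1.

Lemma base_gt0 : 0 < b. Proof. have [] := base_bounds; lra. Qed.

Lemma base_gt1 : 1 < b. Proof. have [] := base_bounds; lra. Qed.

Lemma bTE : b * bT = bT + 1.
Proof. have [h1 h2] := base_bounds; rewrite /bT; field; lra. Qed.

Lemma bT_bounds : 9 / 5 < bT /\ bT < 2.
Proof.
have [h1 h2] := base_bounds; have hT := bTE.
split; nra.
Qed.

(* The first inequality is where [b <= beta^*] is needed in full: it says that
   the hole [f_j f_i H] is covered by [f_i]; [193 / 125 = 1.544] suffices elsewhere. *)
Lemma bT_poly : [/\ 2 <= (bT - 1) * b ^+ 2, 1 < b * (bT - 1),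
  b ^+ 2 * (bT - 1) < 2 * bT - 1 & 3 < b ^+ 3 * (bT - 1)].
Proof.
have [h1 h2] := base_bounds; have [_ h0] := hb; have hT := bTE.
have [h3 h4] := bT_bounds.
have E : (bT - 1) * (b - 1) = 2 - b by lra.
have pos : 0 < b - 1 by lra.
split; rewrite -subr_ge0 || rewrite -subr_gt0;
  rewrite -(pmulr_rge0 _ pos) || rewrite -(pmulr_rgt0 _ pos).
(* By [E] the right-hand side is 2 - 2 b + 2 b^2 - b^3, so its nonnegativity is the cubic condition
   itself. *)
- have -> : (b - 1) * ((bT - 1) * b ^+ 2 - 2) = ((bT - 1) * (b - 1)) * b ^+ 2 - 2 * (b - 1) by ring.
  rewrite E; nra.
- have -> : (b - 1) * (b * (bT - 1) - 1) = b * ((bT - 1) * (b - 1)) - (b - 1) by ring.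
  rewrite E; nra.
- have -> : (b - 1) * (2 * bT - 1 - b ^+ 2 * (bT - 1)) =
     2 * ((bT - 1) * (b - 1)) + (b - 1) - b ^+ 2 * ((bT - 1) * (b - 1)) by ring.
  rewrite E; nra.
- have -> : (b - 1) * (b ^+ 3 * (bT - 1) - 3) = b ^+ 3 * ((bT - 1) * (b - 1)) - 3 * (b - 1) by ring.
  rewrite E; nra.
Qed.


(* Barycentric coordinates, of sum [bT]: [f_i] divides all of them by [b] after
   adding 1 to the [i]-th one, and [H] is the set where all are below [1 / b]. *)
Definition bary (z : pt R) (k : 'I_3) : R :=
  if val k == 1%N then z.1 else if val k == 2%N then z.2 else bT - z.1 - z.2.

Lemma ord3P (P : 'I_3 -> Prop) : P o0 -> P o1 -> P o2 -> forall i, P i.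
Proof.
move=> P0 P1 P2 [[|[|[|//]]] h].
- by rewrite (_ : Ordinal h = o0) //; apply: val_inj.
- by rewrite (_ : Ordinal h = o1) //; apply: val_inj.
- by rewrite (_ : Ordinal h = o2) //; apply: val_inj.
Qed.

Lemma ord3_third (i j : 'I_3) : i != j ->
  exists k, [/\ k != i, k != j & forall l, [\/ l = i, l = j | l = k]].
Proof.
by move: i j; apply: ord3P; apply: ord3P => // _;
  (exists o0 + exists o1 + exists o2); split=> //; apply: ord3P;
  (constructor 1; reflexivity) || (constructor 2; reflexivity) ||
  (constructor 3; reflexivity).
Qed.

Lemma bary_sum z i j k : i != j -> k != i -> k != j ->
  bary z i + bary z j + bary z k = bT.
Proof.
by move: i j k; do 3![apply: ord3P] => //; rewrite /bary /= => _ _ _; ring.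
Qed.

Lemma bary_Tmap i z k : bary (Tmap b i z) k = b * bary z k - (k == i)%:R.
Proof.
have hT := bTE.
by move: i k; do 2![apply: ord3P]; rewrite /bary /Tmap /q /=; lra.
Qed.

Lemma bary_Tmap_eq i z : bary (Tmap b i z) i = b * bary z i - 1.
Proof. by rewrite bary_Tmap eqxx. Qed.

Lemma bary_Tmap_neq i k z : k != i -> bary (Tmap b i z) k = b * bary z k.
Proof. by move=> /negbTE ki; rewrite bary_Tmap ki subr0. Qed.

Lemma TmapK i : cancel (Tmap b i) (fmap b i).
Proof.
have h := base_gt0.
by case=> x y; rewrite /Tmap /fmap /=; congr pair; field; lra.
Qed.

Lemma fmapK i : cancel (fmap b i) (Tmap b i).
Proof.
have h := base_gt0.
by case=> x y; rewrite /Tmap /fmap /=; congr pair; field; lra.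
Qed.

Lemma image_fmapE i (A : set (pt R)) z : (fmap b i @` A) z <-> A (Tmap b i z).
Proof.
split=> [[y Ay <-]|Az]; first by rewrite fmapK.
by exists (Tmap b i z) => //; rewrite TmapK.
Qed.

(* The radial hole [f_i^n H] (lemma [fnHE]). *)
Definition hole i n z := (forall k, k != i -> b ^+ n.+1 * bary z k < 1) /\
  bT < b ^+ n.+1 * (bT - bary z i).

Lemma Hset_bary z : Hset b z <-> forall k, b * bary z k < 1.
Proof.
have h := base_gt0; have h1 := base_gt1; have hT := bTE.
have hb1 : b != 0 by lra.
have e1 x : (x < b^-1) = (b * x < 1) by rewrite -[b^-1]mul1r ltr_pdivlMr // mulrC.
have e2 : (b * (b - 1))^-1 = bT / b by rewrite /bT; field; lra.
have e3 x : (bT / b < x) = (bT < b * x) by rewrite ltr_pdivrMr // mulrC.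
rewrite /Hset /= e2 !e1 e3; split.
  move=> [H1 [H2 H3]]; apply: ord3P; rewrite /bary //=; lra.
by move=> H; move: (H o0) (H o1) (H o2); rewrite /bary /= => *; lra.
Qed.

(** Since [b * bT = bT + 1], the last clause of [hole] at level 0 is the missing bound on the
    coordinate [i]; so level 0 is [H] for every direction [i]. *)
Lemma hole0 i z : hole i 0 z <-> forall k, b * bary z k < 1.
Proof.
have hT := bTE.
rewrite /hole expr1; split=> [[H1 H2] k|H].
  by have [->|/H1//] := eqVneq k i; lra.
by split=> [k _|]; [exact: H|have := H i; lra].
Qed.

Lemma holeS i n z : hole i n.+1 z <-> hole i n (Tmap b i z).
Proof.
have hT := bTE.
rewrite /hole; rewrite bary_Tmap eqxx.
have -> : b ^+ n.+1 * (bT - (b * bary z i - 1%:R)) = b ^+ n.+2 * (bT - bary z i).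
  rewrite [b ^+ n.+2]exprSr -mulrA; congr (_ * _); lra.
split=> -[H1 H2]; split=> // k ki; move: (H1 k ki);
  by rewrite bary_Tmap (negbTE ki) subr0 mulrA -exprSr.
Qed.

Lemma fnHE i n z : fnH b i n z <-> hole i n z.
Proof.
elim: n z => [|n IH] z; first by rewrite hole0 -Hset_bary.
by rewrite /fnH iterS image_fmapE holeS -IH.
Qed.

Lemma fHE j i n z : fH b j i n z <-> hole i n (Tmap b j z).
Proof. by rewrite /fH image_fmapE -fnHE. Qed.

End Geometry.

(** * Self-similarity of the triangle minus its radial holes *)

Section Attractor.
Variables (R : realType) (b : R).
Hypothesis hb : good_base b.
Implicit Types (z : pt R) (i j k : 'I_3) (n m : nat).

Lemma pow_ge n m : (n <= m)%N -> b ^+ n <= b ^+ m.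
Proof. by move=> nm; rewrite ler_weXn2l //; have := base_gt1 hb; lra. Qed.

(** With [t = b ^+ n.+2], the number [t * (bT b - b * bary b z i)] is a sum of two terms below 1,
    and [2 <= (bT b - 1) * b ^+ 2] turns this into the bound on the coordinate [i]. Thus a hole of
    copy [j] pointing to the vertex [i] lies inside the triangle of copy [i], which may fill it. *)
Lemma hole_Tmap_bary i j n z : i != j -> hole b i n.+1 (Tmap b j z) ->
  1 <= b * bary b z i /\ 1 <= b * bary b z j.
Proof.
move=> ij; have [k [ki kj _]] := ord3_third ij.
have hT := bTE hb; have [h3 h4] := bT_bounds hb.
have [p1 p2 p3 p4] := bT_poly hb; have b1 := base_gt1 hb.
have sm := bary_sum b z ij ki kj.
case=> H1; rewrite bary_Tmap_neq // => H2.
move: (H1 _ ki); rewrite bary_Tmap_neq // => Hk.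
have := H1 j; rewrite bary_Tmap_eq // eq_sym ij => /(_ isT) Hj.
have tb : b ^+ 2 <= b ^+ n.+2 by apply: pow_ge.
set t := b ^+ n.+2 in H2 Hk Hj tb.
have b2 : 0 < b ^+ 2 by rewrite exprn_gt0 //; lra.
have e : bT b - b * bary b z i = (b * bary b z j - 1) + b * bary b z k.
  have : b * (bary b z i + bary b z j + bary b z k) = b * bT b by rewrite sm.
  rewrite hT; lra.
have t0 : 0 < t by lra.
split.
  have tT : (bT b - 1) * b ^+ 2 <= (bT b - 1) * t by apply: ler_wpM2l; lra.
  rewrite -subr_ge0 -(pmulr_rge0 _ t0).
  have : t * (bT b - b * bary b z i) < 2 by rewrite e mulrDr; lra.
  lra.
rewrite -subr_ge0 -(pmulr_rge0 _ t0).
move: H2; rewrite e mulrDr; lra.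
Qed.

(** The three products add up to [b * bT b = bT b + 1], which is below 3 because [3 / 2 < b] means
    [bT b < 2]. *)
Lemma no_triple_overlap z : ~ forall k, 1 <= b * bary b z k.
Proof.
move=> H; have hT := bTE hb; have [h3 h4] := bT_bounds hb.
have := bary_sum b z (i:=o0) (j:=o1) (k:=o2) isT isT isT.
move: (H o0) (H o1) (H o2) => H0 H1 H2 sm.
have : b * (bary b z o0 + bary b z o1 + bary b z o2) = b * bT b by rewrite sm.
lra.
Qed.

(** A hole at scale [t] forces the third coordinate [g] to satisfy [bT b - 1 < t * g < 1]. As
    [1 < b * (bT b - 1)], this excludes different levels. At equal levels [x - 1], [y - 1] and [g]
    are below [1 / t] and add up to [bT b - 1], which is impossible from [t = b ^+ 3] on; for
    [t = b ^+ 2] the outer inequalities of the two holes have to be added. *)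
Lemma hole_Tmap_disjoint i j n m z : i != j ->
  hole b i n.+1 (Tmap b j z) -> hole b j m.+1 (Tmap b i z) -> False.
Proof.
wlog nm : i j n m / (m <= n)%N.
  move=> W ij H1 H2; case: (leqP m n) => [mn|/ltnW nm]; first exact: (W i j n m).
  by apply: (W j i m n) => //; rewrite eq_sym.
move=> ij; have [k [ki kj _]] := ord3_third ij.
have hT := bTE hb; have [h3 h4] := bT_bounds hb.
have [p1 p2 p3 p4] := bT_poly hb; have b1 := base_gt1 hb.
have sm := bary_sum b z ij ki kj.
have ji : j != i by rewrite eq_sym.
case=> H1; rewrite bary_Tmap_neq // => H2.
move: (H1 _ ki); rewrite bary_Tmap_neq // => Hk.
have := H1 j ji; rewrite bary_Tmap_eq // => Hj.
case=> G1; rewrite bary_Tmap_neq // => G2.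
move: (G1 _ kj); rewrite bary_Tmap_neq // => Gk.
have := G1 i ij; rewrite bary_Tmap_eq // => Gi.
have bsm : b * bary b z i + b * bary b z j + b * bary b z k = bT b + 1.
  by rewrite -!mulrDr sm hT.
move: H2 Hk Hj G2 Gk Gi.
set g := b * bary b z k in bsm *; set x := b * bary b z i in bsm *.
set y := b * bary b z j in bsm *.
have b2 : 0 < b ^+ 2 by rewrite exprn_gt0 //; lra.
have -> : bT b - x = (y - 1) + g by lra.
have -> : bT b - y = (x - 1) + g by lra.
have tn : b ^+ 2 <= b ^+ n.+2 by apply: pow_ge.
have tm : b ^+ 2 <= b ^+ m.+2 by apply: pow_ge.
rewrite !mulrDr; move: nm; rewrite leq_eqVlt => /orP[/eqP->|mn].
  have : (n == 0)%N \/ b ^+ 3 <= b ^+ n.+2.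
    by case: n tn {H1 G1} => [|n] tn; [left|right; apply: pow_ge].
  move=> [/eqP ->|]; first last.
    move: (b ^+ n.+2) => t t3 *.
    have : (bT b - 1) * b ^+ 3 <= (bT b - 1) * t by apply: ler_wpM2l; lra.
    have : t * (x - 1) + t * (y - 1) + t * g = t * (bT b - 1).
      by rewrite -!mulrDr; congr (_ * _); lra.
    lra.
  move: (b ^+ 2) p1 p3 => t p1 p3 *.
  have : t * (x - 1) + t * (y - 1) + t * g = t * (bT b - 1).
    by rewrite -!mulrDr; congr (_ * _); lra.
  lra.
have ts : b * b ^+ m.+2 <= b ^+ n.+2 by rewrite -exprS; apply: pow_ge.
move: tn tm ts; set t := b ^+ n.+2; set r := b ^+ m.+2 => *.
have g1 : bT b - 1 < r * g by lra.
have g0 : 0 < g by rewrite -(pmulr_rgt0 _ (_ : 0 < r)); lra.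
have : b * r * g <= t * g by rewrite ler_pM2r.
have : b * (bT b - 1) < b * (r * g) by rewrite ltr_pM2l //; lra.
rewrite mulrA; lra.
Qed.

Definition Sstar : set (pt R) :=
  [set z | (forall k, 0 <= bary b z k) /\ forall i n, ~ hole b i n z].

Lemma Sstar_Tmap_bary i z : Sstar (Tmap b i z) -> 1 <= b * bary b z i.
Proof. by case=> /(_ i); rewrite bary_Tmap_eq // subr_ge0. Qed.

(** A hole pointing to [k != i] requires the coordinate [i] to be below [1 / b], whereas points of
    copy [i] have it at least [1 / b]. A hole pointing to [i] is either the central one, excluded
    likewise, or comes from a hole of [Tmap b i z]. *)
Lemma Sstar_Tmap i z : Sstar (Tmap b i z) -> Sstar z.
Proof.
move=> Hz; have ci := Sstar_Tmap_bary Hz; have b1 := base_gt1 hb.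
have b0 : 0 < b by lra.
have cpos k : 0 <= bary b z k.
  have [->|ki] := eqVneq k i; first by rewrite -(pmulr_rge0 _ b0); lra.
  by case: Hz => /(_ k) + _; rewrite bary_Tmap_neq // pmulr_rge0.
split=> // k n Hk.
have [e|ki] := eqVneq k i.
  move: Hk; rewrite {}e; case: n => [|n] Hk.
    by have := (hole0 hb _ _).1 Hk i; lra.
  by case: Hz => _ /(_ i n); apply; apply/(holeS hb).
have := Hk.1 i; rewrite eq_sym ki => /(_ isT).
have : b <= b ^+ n.+1 by rewrite -{1}[b]expr1; apply: pow_ge.
move=> /(ler_wpM2r (cpos i)); lra.
Qed.

(** A hole at [Tmap b i z] that points to [i] is a hole at [z] one level further, and the central
    hole counts as pointing to [i]. Only holes of positive level in another direction are left. *)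
Lemma notSstar_Tmap i z : Sstar z -> 1 <= b * bary b z i ->
  ~ Sstar (Tmap b i z) -> exists k n, k != i /\ hole b k n.+1 (Tmap b i z).
Proof.
move=> Sz ci nS; have b1 := base_gt1 hb.
have cpos k : 0 <= bary b (Tmap b i z) k.
  have [->|ki] := eqVneq k i; first by rewrite bary_Tmap_eq // subr_ge0.
  by rewrite bary_Tmap_neq // mulr_ge0 //; [lra|case: Sz].
apply: contrapT => H; apply: nS; split=> // k n Hk; apply: H.
have [e|ki] := eqVneq k i.
  by case: Sz => _ /(_ i n.+1) []; apply/(holeS hb); rewrite -{1}e.
case: n Hk => [|n] Hk; last by exists k, n.
case: Sz => _ /(_ i 1%N) []; apply/(holeS hb)/(hole0 hb).
exact: (hole0 hb _ _).1 Hk.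
Qed.

(** If copy [i] fails, a hole pointing to some [k] puts [z] in triangle [k]. If copy [k] fails as
    well, its hole must point back to [i], since three triangles never meet; but those two holes are
    disjoint. *)
Lemma Sstar_cover z : Sstar z -> exists i, Sstar (Tmap b i z).
Proof.
move=> Sz; have [i ci] : exists i, 1 <= b * bary b z i.
  apply: contrapT => H; case: Sz => _ /(_ o0 0%N); apply.
  apply/(hole0 hb) => k; rewrite ltNge; apply/negP => ck; apply: H.
  by exists k.
apply: contrapT => H.
have nS k : ~ Sstar (Tmap b k z) by move=> ?; apply: H; exists k.
have [k [n [ki Hk]]] := notSstar_Tmap Sz ci (nS i).
have [ck _] := hole_Tmap_bary ki Hk.
have [l [m [lk Hl]]] := notSstar_Tmap Sz ck (nS k).
have [cl _] := hole_Tmap_bary lk Hl.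
have li : l = i.
  apply/eqP/negPn/negP => li; apply: (@no_triple_overlap z) => r.
  have [p [pk pl /(_ r)]] := ord3_third lk.
  have -> : p = i.
    move: (ki) lk li pk pl; clear.
    by move: k l p i; do 4!apply: ord3P.
  by case=> ->.
rewrite li in Hl; exact: (hole_Tmap_disjoint ki Hk Hl).
Qed.

End Attractor.

(** * Identification with the attractor *)

Section AttractorEq.
Variables (R : realType) (b : R).
Hypothesis hb : good_base b.
Implicit Types (z : pt R) (i j k : 'I_3) (n m : nat).

Lemma continuous_bary k : continuous (fun z : pt R => bary b z k).
Proof.
move: k; apply: ord3P => z; rewrite /bary /=.
- by apply: cvgB; [apply: cvgB; [exact: cvg_cst|exact: cvg_fst]|exact: cvg_snd].
- exact: cvg_fst.
- exact: cvg_snd.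
Qed.

Lemma continuous_Tmap i : continuous (Tmap b i).
Proof.
move=> z.
apply: (@cvg_pair _ _ _ (nbhs z) (nbhs (b * z.1 - (q R i).1))
  (nbhs (b * z.2 - (q R i).2)) _ _ _ (fun w : pt R => b * w.1 - (q R i).1)
  (fun w : pt R => b * w.2 - (q R i).2));
  (apply: cvgB; [apply: cvgM; [exact: cvg_cst|]|exact: cvg_cst]).
- exact: cvg_fst.
- exact: cvg_snd.
Qed.

(** Each hole is a finite intersection of open half-planes, so avoiding all of them is a closed
    condition. *)
Lemma closed_Sstar : closed (Sstar b).
Proof.
have -> : Sstar b = (\bigcap_(k in setT) [set z | 0 <= bary b z k]) `&`
  \bigcap_(i in setT) \bigcap_(n in setT) (
    (\bigcup_(k in [set k | k != i]) [set z | 1 <= b ^+ n.+1 * bary b z k]) `|`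
    [set z | b ^+ n.+1 * (bT b - bary b z i) <= bT b]).
  apply/seteqP; split=> z /= [H1 H2]; split.
  - by move=> k _; exact: H1.
  - move=> i _ n _; apply: contrapT => /not_orP[h1 h2]; apply: (H2 i n); split.
      move=> k ki; rewrite ltNge; apply/negP => ck; apply: h1; by exists k.
    by rewrite ltNge; apply/negP.
  - by move=> k; exact: H1.
  - move=> i n [h1 h2]; case: (H2 i I n I) => /=.
      by move=> [k ki] /=; rewrite leNgt h1.
    by rewrite leNgt h2.
have cM (x : R) k : continuous (fun z : pt R => x * bary b z k).
  by move=> z; apply: cvgM; [exact: cvg_cst|exact: continuous_bary].
have clp (f : pt R -> R) : continuous f -> forall A, closed A -> closed (f @^-1` A).
  by move=> /continuous_closedP.
apply: closedI; apply: closed_bigI => i _.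
  exact: (clp _ (@continuous_bary i) _ (@closed_ge _ 0)).
apply: closed_bigI => n _; apply: closedU.
  apply: closed_bigcup; first exact: finite_finset.
  by move=> k _; exact: (clp _ (cM _ k) _ (@closed_ge _ 1)).
apply: (clp (fun z => b ^+ n.+1 * (bT b - bary b z i)) _ _ (@closed_le _ (bT b))).
move=> z; apply: cvgM; first exact: cvg_cst.
by apply: cvgB; [exact: cvg_cst|exact: continuous_bary].
Qed.

Lemma Sstar_bound z : Sstar b z -> 0 <= z.1 <= bT b /\ 0 <= z.2 <= bT b.
Proof.
case=> H _; move: (H o0) (H o1) (H o2); rewrite /bary /=; lra.
Qed.

Lemma compact_Sstar : compact (Sstar b).
Proof.
apply: (@subclosed_compact _ _ (`[0, bT b] `*` `[0, bT b])); first exact: closed_Sstar.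
  by apply: compact_setX; exact: segment_compact.
by move=> z /Sstar_bound[h1 h2]; split; rewrite /= in_itv.
Qed.

Lemma Sstar_fixed : Sstar b = \bigcup_(i in [set: 'I_3]) (fmap b i @` Sstar b).
Proof.
apply/seteqP; split=> z.
  by move=> /(Sstar_cover hb)[i Hi]; exists i => //; apply/(image_fmapE hb).
by move=> [i _ /(image_fmapE hb)/(Sstar_Tmap hb)].
Qed.

Lemma Sstar_neq0 : Sstar b !=set0.
Proof.
have [h1 h2] := bT_bounds hb; have b0 := base_gt0 hb.
exists (0, 0); split; first by apply: ord3P; rewrite /bary /=; lra.
move=> i n [H1 H2].
have t0 : 0 < b ^+ n.+1 by apply: exprn_gt0.
have t1 : b ^+ 1 <= b ^+ n.+1 by apply: (pow_ge hb).
have [/eqP i0|i0] := boolP (i == o0).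
  by move: H2; rewrite i0 /bary /=; lra.
have := H1 o0; rewrite eq_sym i0 => /(_ isT); rewrite /bary /= !subr0.
have : b ^+ 1 * bT b <= b ^+ n.+1 * bT b by rewrite ler_pM2r //; lra.
by have := bTE hb; rewrite expr1; lra.
Qed.

Lemma div_pow_small (C e : R) : 0 <= C -> 0 < e -> exists n, C / b ^+ n < e.
Proof.
move=> C0 e0; have b0 := base_gt0 hb; have b1 := base_gt1 hb.
have cv : (fun n => b ^- n) @ \oo --> (0 : R).
  apply: (cvg_trans _ (@cvg_expr _ b^-1 _)).
    by apply: near_eq_cvg; near=> n; rewrite exprVn.
  by rewrite ger0_norm ?invr_ge0 ?invf_lt1 //; lra.
have : (fun n => C * b ^- n) @ \oo --> C * 0 by apply: cvgM => //; exact: cvg_cst.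
rewrite mulr0 => /cvgrPdist_lt/(_ e e0)[N _ HN].
exists N; have := HN N (leqnn _); rewrite /= sub0r normrN ger0_norm //.
by rewrite divr_ge0 // exprn_ge0 // ltW.
Unshelve. all: by end_near.
Qed.

(** For the inclusion into an arbitrary [K], follow [n] digits of a point of [Sstar b], compare with
    a fixed point [y0] of [K], and contract back: the point is within [C / b ^+ n] of [K], which is
    closed. The constant [C] bounds the coordinate distances from [y0] to [Sstar b]. *)
Lemma S_betaE : S_beta b = Sstar b.
Proof.
have b0 := base_gt0 hb; have b1 := base_gt1 hb.
apply/seteqP; split=> z.
  by apply; [exact: Sstar_neq0|exact: compact_Sstar|exact: Sstar_fixed].
move=> Sz K [y0 Ky0] cK Kfix.
pose C := bT b + `|y0.1| + `|y0.2|.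
have approx n : forall z, Sstar b z -> exists2 y, K y &
    `|z.1 - y.1| <= C / b ^+ n /\ `|z.2 - y.2| <= C / b ^+ n.
  elim: n => [|n IH] {Sz}z Sz.
    exists y0 => //; rewrite expr0 divr1 /C; have := Sstar_bound Sz.
    have := ler_norm y0.1; have := ler_norm (- y0.1); rewrite normrN => ? ?.
    have := ler_norm y0.2; have := ler_norm (- y0.2); rewrite normrN => ? ? ?.
    have := normr_ge0 y0.1; have := normr_ge0 y0.2.
    by rewrite !ler_norml; lra.
  have [i Ti] := Sstar_cover hb Sz; have [y Ky [h1 h2]] := IH _ Ti.
  exists (fmap b i y); first by rewrite Kfix; exists i => //; exists y.
  have e x w u : x - (w + u) / b = (b * x - u - w) / b by field; lra.
  by rewrite /fmap /= !e !normrM !normfV (gtr0_norm b0) exprSr invfM mulrA;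
    split; rewrite ler_pM2r ?invr_gt0.
have clK : closed K by apply: compact_closed cK; exact: norm_hausdorff.
apply: clK => U /nbhs_ballP[e e0 HU].
have [n Hn] : exists n, C / b ^+ n < e.
  apply: div_pow_small => //; have := bT_bounds hb.
  by have := normr_ge0 y0.1; have := normr_ge0 y0.2; rewrite /C; lra.
have [y Ky [h1 h2]] := approx n z Sz.
exists y; split=> //; apply: HU; split; rewrite /ball /=; exact: le_lt_trans Hn.
Qed.

End AttractorEq.

(** * Possible first digits and the sets E_i, C_ij *)

Section Choices.
Variables (R : realType) (b : R).
Hypothesis hb : good_base b.
Implicit Types (z : pt R) (i j k : 'I_3) (n m : nat) (w : Omega).

(* [i] is a possible first digit of [z]. On [S_beta], [Eset b i] is the set where
   [i] is the only possibility, and [Cunion b] the set where there are two. *)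
Definition allowed z i := S_beta b (Tmap b i z).

Lemma allowed_S z i : allowed z i -> S_beta b z.
Proof. by rewrite /allowed S_betaE //; exact: Sstar_Tmap. Qed.

Lemma exists_allowed z : S_beta b z -> exists i, allowed z i.
Proof. by rewrite S_betaE // => /(Sstar_cover hb); rewrite /allowed S_betaE. Qed.

Lemma allowed_bary z i : allowed z i -> 1 <= b * bary b z i.
Proof. by rewrite /allowed S_betaE //; exact: Sstar_Tmap_bary. Qed.

Lemma not_three_allowed z i j k : i != j -> k != i -> k != j ->
  1 <= b * bary b z i -> 1 <= b * bary b z j -> 1 <= b * bary b z k -> False.
Proof.
move=> ij ki kj ci cj ck; apply: (@no_triple_overlap _ _ hb z) => l.
move: i j k l ij ki kj ci cj ck; do 4!apply: ord3P => //.
Qed.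

Lemma not_allowed_hole z i : S_beta b z -> 1 <= b * bary b z i ->
  ~ allowed z i -> exists k n, k != i /\ hole b k n.+1 (Tmap b i z).
Proof. by rewrite /allowed S_betaE //; exact: notSstar_Tmap. Qed.

Lemma hole_not_allowed z i k n : hole b k n (Tmap b i z) -> ~ allowed z i.
Proof. by rewrite /allowed S_betaE // => H [_ /(_ _ _ H)]. Qed.

(** The last hypothesis makes [Ct] the overlap of the triangles [i] and [j]. There a digit fails
    only through a hole of its copy, and this hole has to point to the other digit, since three
    triangles never meet; these are the sets that [Cset] removes. *)
Lemma Cset_allowed z i j Ct : S_beta b z -> i != j ->
  (Ct z <-> 1 <= b * bary b z i /\ 1 <= b * bary b z j) ->
  (Cset b i j Ct z <-> allowed z i /\ allowed z j).
Proof.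
move=> Sz ij HC; have ji : j != i by rewrite eq_sym.
split=> [[/HC[ci cj] nH]|[ai aj]]; last first.
  split; first by apply/HC; split; apply: allowed_bary.
  by move=> [[n _ /(fHE hb)/hole_not_allowed]|[n _ /(fHE hb)/hole_not_allowed]].
have main p r : p != r -> 1 <= b * bary b z p -> 1 <= b * bary b z r ->
    (forall n, ~ fH b p r n.+1 z) -> allowed z p.
  move=> pr cp cr H; apply: contrapT => /(not_allowed_hole Sz cp)[k [n [kp Hk]]].
  have [ck _] := hole_Tmap_bary hb kp Hk.
  have [e|kr] := eqVneq k r; first by apply: (H n); apply/(fHE hb); rewrite -e.
  exact: not_three_allowed pr kp kr cp cr ck.
split; [apply: (main i j)|apply: (main j i)] => // n Hn; apply: nH.
  by left; exists n.+1.
by right; exists n.+1.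
Qed.

Lemma bary_pos z k : S_beta b z -> 0 <= bary b z k.
Proof. by rewrite S_betaE // => -[]. Qed.

Let cmp (x : R) : (b^-1 <= x) = (1 <= b * x).
Proof. by rewrite -[b^-1]mul1r ler_pdivrMr ?(base_gt0 hb) // mulrC. Qed.

Let cmpT (x : R) : (x <= (b * (b - 1))^-1) = (b * x <= bT b).
Proof. by rewrite invfM mulrC -/(bT b) ler_pdivlMr ?(base_gt0 hb) // mulrC. Qed.

Lemma C01_allowed z : S_beta b z -> (C01 b z <-> allowed z o0 /\ allowed z o1).
Proof.
move=> Sz; apply: Cset_allowed => //; rewrite /C01t /= cmp cmpT.
have := bTE hb; have := bary_pos o2 Sz; rewrite /bary /=; split; lra.
Qed.

Lemma C02_allowed z : S_beta b z -> (C02 b z <-> allowed z o0 /\ allowed z o2).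
Proof.
move=> Sz; apply: Cset_allowed => //; rewrite /C02t /= cmp cmpT.
have := bTE hb; have := bary_pos o1 Sz; rewrite /bary /=; split; lra.
Qed.

Lemma C12_allowed z : S_beta b z -> (C12 b z <-> allowed z o1 /\ allowed z o2).
Proof.
move=> Sz; apply: Cset_allowed => //; rewrite /C12t /= !cmp -/(bT b).
have := bTE hb; have := bary_pos o0 Sz; rewrite /bary /=; split; lra.
Qed.

Lemma Et_bary z i : S_beta b z ->
  (Et b i z <-> forall j, j != i -> b * bary b z j < 1).
Proof.
move=> Sz; have nH : ~ Hset b z.
  by move: Sz; rewrite S_betaE // => -[_ H] /(Hset_bary hb)/(hole0 hb i)/H.
have := bTE hb; move: (bary_pos o0 Sz) (bary_pos o1 Sz) (bary_pos o2 Sz).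
move: i; apply: ord3P; rewrite /Et /bary /= => p0 p1 p2 eT; split.
- move=> [[/andP[_ h1] /andP[_ h2]] _]; move: h1 h2; rewrite !ltNge !cmp => h1 h2.
  by apply: ord3P => // _ /=; rewrite ltNge.
- move=> H; move: (H o1 isT) (H o2 isT) => /= h1 h2; split=> //.
  by split; apply/andP; split=> //; rewrite ltNge cmp -ltNge.
- move=> [[/andP[_ h1] /andP[+ _]] _]; move: h1; rewrite !ltNge cmp cmpT => h1 h2.
  apply: ord3P => // _ /=; last by rewrite ltNge.
  move: h2; rewrite -ltNge; lra.
- move=> H; move: (H o0 isT) (H o2 isT) => /= h1 h2; split=> //.
  split; apply/andP; split=> //; first by rewrite ltNge cmp -ltNge.
    by rewrite ltNge cmpT -ltNge; lra.
  by rewrite -/(bT b); lra.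
- move=> [[/andP[_ h1] /andP[+ _]] _]; move: h1; rewrite !ltNge cmp cmpT => h1 h2.
  apply: ord3P => // _ /=; last by rewrite ltNge.
  move: h2; rewrite -ltNge; lra.
- move=> H; move: (H o0 isT) (H o1 isT) => /= h1 h2; split=> //.
  split; apply/andP; split=> //; first by rewrite ltNge cmp -ltNge.
    by rewrite ltNge cmpT -ltNge; lra.
  by rewrite -/(bT b); lra.
Qed.

(** The pieces f_j f_i^n H added to [Et b i] are the places of the overlap of [i] and [j] where the
    digit [j] is lost to a hole; the holes that are taken away do not meet the attractor. *)
Lemma Eset_allowed z i : S_beta b z ->
  (Eset b i z <-> forall j, j != i -> ~ allowed z j).
Proof.
move=> Sz; split.
  move=> [[/(Et_bary _ Sz) H _ j ji /allowed_bary|]].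
    by have := H j ji; lra.
  move=> [j /= ji [n /= n1 /(fHE hb) Hn]] _ k ki ak.
  case: n n1 Hn => // n _ Hn.
  have ij : i != j by rewrite eq_sym.
  have [ci cj] := hole_Tmap_bary hb ij Hn.
  have [e|kj] := eqVneq k j; first by subst k; exact: hole_not_allowed Hn ak.
  exact: not_three_allowed ij ki kj ci cj (allowed_bary ak).
move=> H; split; last first.
  by move=> [n _ /(fnHE hb)]; move: Sz; rewrite S_betaE // => -[_ +] => /[apply].
have [l al] := exists_allowed Sz.
have li : l = i by apply: contrapT => /eqP /H.
rewrite {}li in al; have ci := allowed_bary al.
have [h|] := pselect (exists2 j, j != i & 1 <= b * bary b z j); last first.
  move=> h; left; apply/(Et_bary _ Sz) => j ji; rewrite ltNge; apply/negP => cj.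
  by apply: h; exists j.
case: h => j ji cj; have [k [n [kj Hk]]] := not_allowed_hole Sz cj (H j ji).
have [ck _] := hole_Tmap_bary hb kj Hk.
have [e|ki] := eqVneq k i; last by case: (not_three_allowed ji kj ki cj ci ck).
right; exists j => //; exists n.+1 => //; apply/(fHE hb); by rewrite -e.
Qed.

(* The value of the coin [omega_1] that selects the digit [i] at [z] in [Cunion b]. *)
Definition bit z i : bool := if z \in C01 b then i == o1 else i == o2.

Lemma two_allowed_exclusive z i j k : i != j -> k != i -> k != j ->
  allowed z i -> allowed z j -> ~ allowed z k.
Proof.
move=> ij ki kj /allowed_bary ci /allowed_bary cj /allowed_bary ck.
exact: not_three_allowed ij ki kj ci cj ck.
Qed.

Lemma CunionE z : S_beta b z ->
  (Cunion b z <-> exists i j, [/\ i != j, allowed z i & allowed z j]).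
Proof.
move=> Sz; rewrite /Cunion /=; split.
  move=> [[/(C01_allowed Sz)[]|/(C12_allowed Sz)[]]|/(C02_allowed Sz)[]] h1 h2.
  - by exists o0, o1.
  - by exists o1, o2.
  - by exists o0, o2.
move=> [i [j []]]; move: i j; do 2!apply: ord3P; move=> // _ a1 a2.
- by left; left; apply/(C01_allowed Sz).
- by right; apply/(C02_allowed Sz).
- by left; left; apply/(C01_allowed Sz).
- by left; right; apply/(C12_allowed Sz).
- by right; apply/(C02_allowed Sz).
- by left; right; apply/(C12_allowed Sz).
Qed.

Lemma Eset_notCunion z i : S_beta b z -> Eset b i z -> ~ Cunion b z.
Proof.
move=> Sz /(Eset_allowed i Sz) H /(CunionE Sz)[j [k [jk aj ak]]].
have [e|ji] := eqVneq j i; last exact: H ji aj.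
by apply: (H k) => //; rewrite -e eq_sym.
Qed.

Lemma digit_outside w z i : S_beta b z -> ~ Cunion b z -> allowed z i ->
  digit b (w, z) = i.
Proof.
move=> Sz nC ai.
have E0 : Eset b i z.
  apply/(Eset_allowed _ Sz) => j ji aj; apply: nC; apply/(CunionE Sz).
  by exists j, i.
have E1 j : (z \in Eset b j) = (j == i).
  apply/idP/eqP => [/set_mem/(Eset_allowed _ Sz) H|->]; last exact/mem_set.
  by apply/eqP; rewrite eq_sym; apply: contrapT => /negP /H.
rewrite /digit !E1; clear; move: i; exact: ord3P.
Qed.

Lemma notin_Eset z i : S_beta b z -> Cunion b z -> z \notin Eset b i.
Proof.
by move=> Sz cz; apply/negP => /set_mem /(Eset_notCunion Sz).
Qed.

Lemma digit_inside w z i : S_beta b z -> Cunion b z -> allowed z i ->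
  (digit b (w, z) = i <-> w 0%N = bit z i).
Proof.
move=> Sz cz ai; rewrite /digit !(negbTE (notin_Eset _ Sz cz)) /bit.
have e01 : (z \in C01 b) = `[<allowed z o0 /\ allowed z o1>].
  by apply/idP/asboolP => [/set_mem/(C01_allowed Sz)//|/(C01_allowed Sz)/mem_set//].
have e12 : (z \in C12 b) = `[<allowed z o1 /\ allowed z o2>].
  by apply/idP/asboolP => [/set_mem/(C12_allowed Sz)//|/(C12_allowed Sz)/mem_set//].
have e02 : (z \in C02 b) = `[<allowed z o0 /\ allowed z o2>].
  by apply/idP/asboolP => [/set_mem/(C02_allowed Sz)//|/(C02_allowed Sz)/mem_set//].
have [p [r [pr]]] := (CunionE Sz).1 cz.
have ex := @two_allowed_exclusive z.
rewrite e01 e12 e02 !asbool_and.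
have b0 k : reflect (allowed z k) `[<allowed z k>] by exact: asboolP.
move: (ex o0 o1 o2 isT isT isT) ai.
move: p r i pr; do 3!apply: ord3P => //; move=> _.

all: case: (b0 o0); case: (b0 o1); case: (b0 o2) => //=; case: (w 0%N) => //; by tauto.
Qed.

End Choices.

(** * Action of the map, and a relatively open set of switches *)

Section Switch.
Variables (R : realType) (b : R).
Hypothesis hb : good_base b.
Implicit Types (z : pt R) (i j k : 'I_3) (n m : nat) (w : Omega).

Lemma Kmap_fst w z : S_beta b z ->
  (Kmap b (w, z)).1 = if z \in Cunion b then shiftO w else w.
Proof.
move=> Sz; rewrite /Kmap /=; case: (boolP (z \in Cunion b)) => [/set_mem cz|].
  by rewrite !(notin_Eset hb).
by rewrite andbF.
Qed.

Lemma Kmap_snd x : (Kmap b x).2 = Tmap b (digit b x) x.2.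
Proof. by case: x. Qed.

Lemma digit_allowed w z : S_beta b z -> allowed b z (digit b (w, z)).
Proof.
move=> Sz; have [cz|cz] := pselect (Cunion b z); last first.
  by have [i ai] := exists_allowed hb Sz; rewrite (digit_outside hb w Sz cz ai).
have [i [j [ij ai aj]]] := (CunionE hb Sz).1 cz.
have di := digit_inside hb w Sz cz ai; have dj := digit_inside hb w Sz cz aj.
have [e|ne] := eqVneq (w 0%N) (bit b z i); first by rewrite (di.2 e).
have [e|ne'] := eqVneq (w 0%N) (bit b z j); first by rewrite (dj.2 e).
(* Were the coin different from both bits, these would be equal, and one and the same coin would
   select both [i] and [j]. *)
have e : bit b z i = bit b z j.
  by move: ne ne'; case: (w 0%N); case: (bit b z i); case: (bit b z j).
have := digit_inside hb (fun=> bit b z i) Sz cz ai.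
have := digit_inside hb (fun=> bit b z i) Sz cz aj.
move=> [_ /(_ e)] d1 [_ /(_ erefl)] d2; by move: ij; rewrite -(etrans (esym d1) d2) eqxx.
Qed.

(** The point is the midpoint of the side joining the vertices 0 and 1. Near it the coordinates 0
    and 1 are well above [1 / b], which bounds the scale [t] of a hole of copy 0 or 1 by
    [4 / (bT b - 1)]; but such a hole needs [bT b - 1 < t * (b * bary b z o2)], and the coordinate 2
    is too small for that. *)
Lemma switch_point : exists2 p, S_beta b p & exists2 d : R, 0 < d &
  forall z, S_beta b z -> `|z.1 - p.1| < d -> `|z.2 - p.2| < d -> Cunion b z.
Proof.
have hT := bTE hb; have [h3 h4] := bT_bounds hb; have b1 := base_gt1 hb.
have [_ b2] := base_bounds hb.
exists (bT b / 2, 0).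
  rewrite S_betaE //; split; first by apply: ord3P; rewrite /bary /=; lra.
  move=> i n [H1 _].
  have t1 : b ^+ 1 <= b ^+ n.+1 by apply: (pow_ge hb).
  have t2 : b ^+ 1 * bT b <= b ^+ n.+1 * bT b by rewrite ler_pM2r //; lra.
  rewrite expr1 in t2.
  have [j [/negbTE ji jk]] : exists j, j != i /\ bary b (bT b / 2, 0) j = bT b / 2.
    move: i H1; apply: ord3P => _; [exists o1|exists o0|exists o0]; split=> //;
    by rewrite /bary /=; lra.
  by have := H1 j; rewrite ji jk => /(_ isT); lra.
(* Chosen so that [t * ((bT b - 1) / 4) < 1] implies [t * e < bT b - 1]. The radius [e / 4] absorbs
   the factor [b < 2] and the errors of two coordinates. *)
pose e := (bT b - 1) ^+ 2 / 4.
have e0 : 0 < e by rewrite /e expr2; nra.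
exists (e / 4); first by lra.
move=> z Sz; rewrite /= subr0 !ltr_norml => /andP[l1 u1] /andP[l2 u2].
have eT : e <= (bT b - 1) / 4 by rewrite /e expr2; nra.
have c2 : b * bary b z o2 < e by rewrite /bary /=; nra.
have c1 : (bT b + 1) / 2 - e < b * bary b z o1 by rewrite /bary /=; nra.
have c0 : (bT b + 1) / 2 - e < b * bary b z o0 by rewrite /bary /=; nra.
have main i j : i != j -> o2 != i -> o2 != j ->
    (bT b + 1) / 2 - e < b * bary b z i -> (bT b + 1) / 2 - e < b * bary b z j ->
    allowed b z i.
  move=> ij ni nj ci cj; apply: contrapT.
  have ci1 : 1 <= b * bary b z i by lra.
  move=> /(not_allowed_hole hb Sz ci1)[k [n [ki Hk]]].
  have [ck _] := hole_Tmap_bary hb ki Hk.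
  have kj : k = j.
    move: k i j ij ni nj ki ck {ci cj Hk ci1}.
    by do 3!apply: ord3P => //; move=> _ _ _ _ ck; exfalso; lra.
  subst k; have [Hh1] := Hk; rewrite bary_Tmap_neq // => Hh2.
  have := Hh1 i; rewrite eq_sym ki => /(_ isT); rewrite bary_Tmap_eq // => Hi.
  have := Hh1 o2 nj; rewrite bary_Tmap_neq // => Hj2.
  have t0 : 0 < b ^+ n.+2 by apply: exprn_gt0; lra.
  move: t0 Hi Hj2 Hh2; set t := b ^+ n.+2 => t0 Hi Hj2.
  have sm := bary_sum b z ij ni nj.
  have -> : bT b - b * bary b z j = (b * bary b z i - 1) + b * bary b z o2.
    have : b * (bary b z i + bary b z j + bary b z o2) = b * bT b by rewrite sm.
    lra.
  rewrite mulrDr => Hh2.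
  have s1 : t * ((bT b - 1) / 4) < t * (b * bary b z i - 1) by rewrite ltr_pM2l //; lra.
  have s2 : t * (b * bary b z o2) < t * e by rewrite ltr_pM2l.
  have s3 : t * e = t * ((bT b - 1) / 4) * (bT b - 1) by rewrite /e; ring.
  have s4 : t * ((bT b - 1) / 4) * (bT b - 1) < 1 * (bT b - 1) by rewrite ltr_pM2r; lra.
  lra.
by left; left; apply/(C01_allowed hb Sz); split;
  [apply: (main o0 o1)|apply: (main o1 o0)].
Qed.

End Switch.

(** * Coding by digit sequences *)

Section Coding.
Variables (R : realType) (b : R).
Hypothesis hb : good_base b.
Implicit Types (z : pt R) (i j : 'I_3) (n m k : nat) (w : Omega) (u v : Upsilon).

Fixpoint along u n z : pt R := if n is m.+1 then Tmap b (u m) (along u m z) else z.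

Lemma alongSr u n z : along u n.+1 z = along (shiftU u) n (Tmap b (u 0%N) z).
Proof. by elim: n => //= n <-. Qed.

Lemma eq_along u v n z : (forall k, (k < n)%N -> u k = v k) ->
  along u n z = along v n z.
Proof.
elim: n => //= n IH H; rewrite (H n (ltnSn n)) IH // => k kn; apply: H; exact: ltnW.
Qed.

Lemma along_sub u n z z' :
  (along u n z).1 - (along u n z').1 = b ^+ n * (z.1 - z'.1) /\
  (along u n z).2 - (along u n z').2 = b ^+ n * (z.2 - z'.2).
Proof.
elim: n => [|n [IH1 IH2]]; first by rewrite expr0 !mul1r.
by rewrite /= exprS -!mulrA -IH1 -IH2; split; ring.
Qed.

Lemma continuous_along u n : continuous (along u n).
Proof.
elim: n => [|n IH] z /=; first exact: cvg_id.
by apply: continuous_comp; [exact: IH|exact: continuous_Tmap].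
Qed.

Lemma closed_S : closed (S_beta b).
Proof. by rewrite S_betaE //; exact: closed_Sstar. Qed.

Lemma along_surj u n z : exists y, along u n y = z.
Proof.
elim: n z => [|n IH] z; first by exists z.
have [y Hy] := IH (fmap b (u n) z); exists y => /=.
by rewrite Hy fmapK.
Qed.

Lemma along_S u n m z : (m <= n)%N -> S_beta b (along u n z) ->
  S_beta b (along u m z).
Proof.
elim: n => [|n IH]; first by rewrite leqn0 => /eqP ->.
by rewrite leq_eqVlt => /orP[/eqP->//|mn] /(allowed_S hb)/IH; apply.
Qed.

(** The points that can follow [u] for [n] steps form nonempty closed subsets of a compact set,
    decreasing in [n] by [along_S]. *)
Lemma exists_code u : exists z, forall n, S_beta b (along u n z).
Proof.
have cS : compact (S_beta b) by rewrite S_betaE //; exact: compact_Sstar.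
pose A n := [set z | S_beta b (along u n z)].
have PF : ProperFilter (filter_from setT A).
  apply: filter_from_proper.
    apply: filter_from_filter; first by exists 0%N.
    move=> n m _ _; exists (maxn n m) => // z Hz.
    by split; apply: along_S Hz; rewrite (leq_maxl, leq_maxr).
  move=> n _; have [s0 Ss0] : S_beta b !=set0 by rewrite S_betaE //; exact: Sstar_neq0.
  by have [y Hy] := along_surj u n s0; exists y; rewrite /A /= Hy.
have [|p [_ clp]] := cS _ PF; first by exists 0%N.
exists p => n; have clA : closed (A n).
  by have /continuous_closedP := @continuous_along u n; apply; exact: closed_S.
by apply: clA => B nB; apply: clp nB; exists n.
Qed.

(* The point with digit sequence [u], that is the sum of [q_{u_n} b^{-n-1}]. *)
Definition code u : pt R := xget (0, 0) [set z | forall n, S_beta b (along u n z)].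

Lemma code_along u n : S_beta b (along u n (code u)).
Proof.
rewrite /code; case: xgetP => [z _ Hz|H]; first exact: Hz.
by have [z Hz] := exists_code u; case: (H z).
Qed.

Lemma S_code u : S_beta b (code u).
Proof. exact: (code_along u 0). Qed.

Lemma S_dist z z' : S_beta b z -> S_beta b z' ->
  `|z.1 - z'.1| <= bT b /\ `|z.2 - z'.2| <= bT b.
Proof.
rewrite S_betaE // => /Sstar_bound[h1 h2] /Sstar_bound[h3 h4].
by rewrite !ler_norml; lra.
Qed.

(** Following a common word for [n] steps expands differences by [b ^+ n], while the attractor is
    bounded. Both the uniqueness and the continuity of [code] rest on this. *)
Lemma along_close u n z z' : S_beta b (along u n z) -> S_beta b (along u n z') ->
  `|z.1 - z'.1| <= bT b / b ^+ n /\ `|z.2 - z'.2| <= bT b / b ^+ n.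
Proof.
move=> h1 h2; have := S_dist h1 h2; have [-> ->] := along_sub u n z z'.
have t0 : 0 < b ^+ n by apply: exprn_gt0; exact: base_gt0.
by rewrite !normrM (gtr0_norm t0) !ler_pdivlMr // ![_ * b ^+ n]mulrC.
Qed.

Lemma code_unique u z : (forall n, S_beta b (along u n z)) -> z = code u.
Proof.
move=> H; have T0 : 0 <= bT b by have := bT_bounds hb; lra.
have e0 (x : R) : (forall n, `|x| <= bT b / b ^+ n) -> x = 0.
  move=> Hx; apply/eqP; rewrite -normr_eq0 eq_le normr_ge0 andbT leNgt.
  apply/negP => x0; have [n] := div_pow_small hb T0 x0; by rewrite ltNge Hx.
have c n := along_close (H n) (code_along u n).
case: z (code u) c {H} => [x y] [x' y'] c; congr pair;
  apply/eqP; rewrite -subr_eq0; apply/eqP; apply: e0 => n; by case: (c n).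
Qed.

Lemma code_shift u : code (shiftU u) = Tmap b (u 0%N) (code u).
Proof.
by apply/esym/code_unique => n; rewrite -alongSr; exact: code_along.
Qed.

Lemma code_cylinder u (e : R) : 0 < e -> exists n, forall v,
  (forall k, (k < n)%N -> v k = u k) ->
  `|(code v).1 - (code u).1| < e /\ `|(code v).2 - (code u).2| < e.
Proof.
move=> e0; have T0 : 0 <= bT b by have := bT_bounds hb; lra.
have [n Hn] := div_pow_small hb T0 e0; exists n => v Hv.
have := code_along v n; rewrite (eq_along _ Hv) => h.
have [h1 h2] := along_close h (code_along u n).
by split; exact: le_lt_trans Hn.
Qed.

End Coding.

(** * Digit sequences of states and their decoding *)

Section Itineraries.
Variables (R : realType) (b : R).
Hypothesis hb : good_base b.
Implicit Types (z : pt R) (i j : 'I_3) (n m k : nat) (w : Omega) (u v : Upsilon)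
  (x y : state R).

Lemma iter_shiftU n u k : iter n shiftU u k = u (n + k)%N.
Proof. by elim: n u k => [|n IH] u k //; rewrite iterS /shiftU IH addSn addnS. Qed.

Lemma code_iter n u : code b (iter n shiftU u) = along b u n (code b u).
Proof.
elim: n u => [//|n IH] u.
by rewrite iterSr IH alongSr code_shift.
Qed.

Lemma Dom_Kmap x : Dom b x -> Dom b (Kmap b x).
Proof. by case: x => w z; rewrite /Dom /= => /(digit_allowed hb w). Qed.

Lemma Dom_iter n x : Dom b x -> Dom b (iter n (Kmap b) x).
Proof. by move=> Dx; elim: n => //= n; exact: Dom_Kmap. Qed.

Lemma phi_Kmap x : phi b (Kmap b x) = shiftU (phi b x).
Proof. by apply/funext => n; rewrite /phi /shiftU -iterSr. Qed.

Lemma phi_iter n x : phi b (iter n (Kmap b) x) = iter n shiftU (phi b x).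
Proof. by elim: n => //= n <-; rewrite phi_Kmap. Qed.

Lemma along_phi n x : along b (phi b x) n x.2 = (iter n (Kmap b) x).2.
Proof. by elim: n => //= n ->; rewrite [RHS]Kmap_snd. Qed.

Lemma code_phi x : Dom b x -> code b (phi b x) = x.2.
Proof.
move=> Dx; apply/esym/(code_unique hb) => n; rewrite along_phi.
exact: (Dom_iter n Dx).
Qed.

Definition switch u : bool := code b u \in Cunion b.

(** The number of coins used before time [n], hence the index in the initial coin sequence of the
    coin in force at time [n]. *)
Fixpoint nswitch u n : nat :=
  if n is m.+1 then (nswitch u m + switch (iter m shiftU u))%N else 0%N.

Definition recurrent : set Upsilon :=
  [set u | forall m, exists n, (m <= n)%N /\ switch (iter n shiftU u)].

Lemma code_phi_iter n x : Dom b x ->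
  (iter n (Kmap b) x).2 = code b (iter n shiftU (phi b x)).
Proof. by move=> Dx; rewrite -phi_iter code_phi //; exact: Dom_iter. Qed.

Lemma Zset_recurrent x : Dom b x -> (Zset b x <-> recurrent (phi b x)).
Proof.
move=> Dx; split=> H m; have [n [mn Hn]] := H m; exists n; split=> //.
  by rewrite /switch -code_phi_iter //; exact: mem_set.
by rewrite code_phi_iter //; exact: set_mem.
Qed.

Lemma iter_Kmap_fst n x k : Dom b x ->
  (iter n (Kmap b) x).1 k = x.1 (k + nswitch (phi b x) n)%N.
Proof.
move=> Dx; elim: n k => [|n IH] k; first by rewrite addn0.
rewrite iterS; have Dn := Dom_iter n Dx; have e := code_phi_iter n Dx.
move: IH Dn e; case: (iter n _ x) => w z IH Dn e.
rewrite (Kmap_fst hb w (Dn : S_beta b z)); move: IH => /= IH; rewrite /switch -[code _ _]e /=.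
by case: (z \in _); rewrite /shiftO IH ?addn1 ?addn0 // addSnnS.
Qed.

Lemma phi_switch n x : Dom b x -> switch (iter n shiftU (phi b x)) ->
  x.1 (nswitch (phi b x) n) = bit b (code b (iter n shiftU (phi b x))) (phi b x n).
Proof.
move=> Dx; rewrite -[nswitch _ _]add0n -iter_Kmap_fst // /switch -code_phi_iter //.
have Dn := Dom_iter n Dx; move=> /set_mem; rewrite /phi.
move: Dn; case: (iter n _ x) => w z /= Dn cz.
exact/(digit_inside hb w Dn cz (digit_allowed hb w Dn)).
Qed.

Lemma nswitch_le u n m : (n <= m)%N -> (nswitch u n <= nswitch u m)%N.
Proof.
move=> /subnKC <-; elim: (m - n)%N => [|k IH]; rewrite ?addn0 // addnS /=.
by rewrite (leq_trans IH) // leq_addr.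
Qed.

Lemma nswitch_inj u n m : switch (iter n shiftU u) -> switch (iter m shiftU u) ->
  nswitch u n = nswitch u m -> n = m.
Proof.
wlog nm : n m / (n <= m)%N.
  by move=> W; case: (leqP n m) => [|/ltnW] h *; [|symmetry]; apply: W.
move=> sn sm; move: nm; rewrite leq_eqVlt => /orP[/eqP//|/(nswitch_le u)/=].
by rewrite sn => /[swap] ->; rewrite addn1 ltnn.
Qed.

(* A coin that is never used by the digit sequence [u] gets the junk value [false]. *)
Definition switch_bits u : Omega := fun k => `[< exists n,
  [/\ switch (iter n shiftU u), nswitch u n = k &
      bit b (code b (iter n shiftU u)) (u n)] >].

Definition decode u : state R := (switch_bits u, code b u).

Lemma switch_bitsE u n : switch (iter n shiftU u) ->
  switch_bits u (nswitch u n) = bit b (code b (iter n shiftU u)) (u n).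
Proof.
move=> sn; apply/asboolP/idP => [[m [sm e]]|h]; last by exists n.
by have -> := nswitch_inj sm sn e.
Qed.

Lemma Dom_decode u : Dom b (decode u).
Proof. exact: S_code. Qed.

(** Agreement of the digits and agreement of the coin counters are proved together. The point at
    time [n] depends only on the first [n] digits, so a switch happens exactly when [u] predicts it,
    and the coin then read is the one that [switch_bits] stored at that index. *)
Lemma phi_decode u : phi b (decode u) = u.
Proof.
set x := decode u; have Dx := Dom_decode u : Dom b x.
have main n : (forall k, (k < n)%N -> phi b x k = u k) /\
    nswitch (phi b x) n = nswitch u n.
  elim: n => [//|n [IH IH2]].
  have e : (iter n (Kmap b) x).2 = code b (iter n shiftU u).
    by rewrite -along_phi /= (eq_along b _ IH) code_iter.
  have Dn := Dom_iter n Dx.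
  have sE : switch (iter n shiftU (phi b x)) = switch (iter n shiftU u).
    by rewrite /switch -code_phi_iter // e.
  have a : allowed b (iter n (Kmap b) x).2 (u n).
    have un : u n = (iter n shiftU u) 0%N by rewrite iter_shiftU addn0.
    by rewrite e /allowed un -code_shift //; exact: S_code.
  have dE : phi b x n = u n.
    rewrite /phi; have w0 := iter_Kmap_fst n 0 Dx; rewrite IH2 add0n in w0.
    have := sE; rewrite {1}/switch -code_phi_iter //.
    move: Dn a w0 e; case: (iter n _ x) => w' z /= Dz a w0 e.
    case: (boolP (z \in _)) => [/set_mem cz|/negP cz] sn.
      by apply/(digit_inside hb w' Dz cz a); rewrite w0 switch_bitsE // e.
    by apply: digit_outside => // /mem_set.
  split; last by rewrite /= IH2 sE.
  by move=> k; rewrite ltnS leq_eqVlt => /orP[/eqP->|/IH].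
by apply/funext => n; apply: (main n.+1).1.
Qed.

(** Take the first switch from time [m] on: the counter does not move before it. Iterating, every
    coin of a recurrent sequence is used at some time. *)
Lemma next_switch u m : recurrent u ->
  exists n, switch (iter n shiftU u) /\ nswitch u n = nswitch u m.
Proof.
move=> /(_ m)[n0 [mn0 s0]].
have ex : exists d, switch (iter (m + d) shiftU u) by exists (n0 - m)%N; rewrite subnKC.
case: (ex_minnP ex) => d sd mind {ex}; exists (m + d)%N; split=> //.
elim: d sd mind => [|d IH] sd mind; first by rewrite addn0.
have lt d' : (d' <= d)%N -> switch (iter (m + d') shiftU u) = false.
  by move=> dd; apply/negbTE/negP => /mind; rewrite ltnNge dd.
have aux d' : (d' <= d.+1)%N -> nswitch u (m + d') = nswitch u m.
  elim: d' => [|d' IH'] dd; first by rewrite addn0.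
  by rewrite addnS /= IH' 1?ltnW // lt ?addn0.
exact: aux.
Qed.

Lemma switch_index u k : recurrent u ->
  exists n, switch (iter n shiftU u) /\ nswitch u n = k.
Proof.
move=> ru; elim: k => [|k [n [sn <-]]]; first exact: (next_switch 0 ru).
have [m [sm e]] := next_switch n.+1 ru; exists m; split=> //.
by rewrite e /= sn addn1.
Qed.

Lemma phi_inj x y : Dom b x -> Dom b y -> Zset b x -> phi b x = phi b y -> x = y.
Proof.
move=> Dx Dy /(Zset_recurrent Dx) rx e.
have e2 : x.2 = y.2 by rewrite -!code_phi // e.
have e1 : x.1 = y.1.
  apply/funext => k; have [n [sn <-]] := switch_index k rx.
  by rewrite phi_switch // e phi_switch // -e.
by case: x y e1 e2 {Dx Dy rx e} => [? ?] [? ?] /= -> ->.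
Qed.

Lemma decode_phi x : Dom b x -> Zset b x -> decode (phi b x) = x.
Proof.
move=> Dx Zx; apply/esym/phi_inj => //; first exact: Dom_decode.
by rewrite phi_decode.
Qed.

Lemma Zset_decode u : recurrent u -> Zset b (decode u).
Proof. by move=> ru; apply/(Zset_recurrent (Dom_decode u)); rewrite phi_decode. Qed.

End Itineraries.

(** * Measurability *)

Section SigmaAlgebraTools.
Context {T : Type} {N : set (set T)}.
Hypothesis hN : sigma_algebra setT N.

(** With closure under connectives and countable quantifiers, measurability is proved below by
    rewriting a set as a formula. *)
Lemma sa_not (P : T -> Prop) : N [set x | P x] -> N [set x | ~ P x].
Proof. by case: hN => _ + _ => /[apply]; rewrite setTD. Qed.

Lemma sa_existsn (P : nat -> T -> Prop) : (forall n, N [set x | P n x]) ->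
  N [set x | exists n, P n x].
Proof.
case: hN => _ _ H /H; congr N; apply/seteqP; split=> x /= [n].
  by move=> _ ?; exists n.
by move=> ?; exists n.
Qed.

Lemma sa_foralln (P : nat -> T -> Prop) : (forall n, N [set x | P n x]) ->
  N [set x | forall n, P n x].
Proof.
move=> H; have := sa_not (sa_existsn (fun n => sa_not (H n))).
congr N; apply/seteqP; split=> x /=.
  by move=> h n; apply: contrapT => ?; apply: h; exists n.
by move=> h [n].
Qed.

Lemma sa_or (P Q : T -> Prop) : N [set x | P x] -> N [set x | Q x] ->
  N [set x | P x \/ Q x].
Proof.
move=> HP HQ.
have := @sa_existsn (fun n => if n is 0%N then P else Q).
move=> /(_ (fun n => if n is 0%N then HP else HQ)).
congr N; apply/seteqP; split=> x /=.
  by move=> [[|n]]; [left|right].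
by move=> [?|?]; [exists 0%N|exists 1%N].
Qed.

Lemma sa_and (P Q : T -> Prop) : N [set x | P x] -> N [set x | Q x] ->
  N [set x | P x /\ Q x].
Proof.
move=> HP HQ; have := sa_not (sa_or (sa_not HP) (sa_not HQ)).
by congr N; apply/seteqP; split=> x /=; rewrite not_orE !notE.
Qed.

Lemma sa_const (P : Prop) : N [set x | P].
Proof.
have [h|h] := pselect P.
  have [N0 _ _] := hN; have := sa_not N0; congr N.
  by apply/seteqP; split=> x //= _ [].
by case: hN => + _ _; congr N; apply/seteqP; split=> x //= [].
Qed.

Lemma sa_existsi (I : countType) (P : I -> T -> Prop) : (forall i, N [set x | P i x]) ->
  N [set x | exists i, P i x].
Proof.
move=> H; have := @sa_existsn (fun n x => if unpickle n is Some i then P i x else False).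
have h n : N [set x | if unpickle n is Some i then P i x else False].
  by case: (unpickle n) => [i|]; [exact: H|exact: sa_const].
move=> /(_ h); congr N; apply/seteqP; split=> x /=.
  by move=> [n]; case: unpickle => // i Pi; exists i.
by move=> [i Pi]; exists (pickle i); rewrite pickleK.
Qed.

Lemma sa_foralli (I : countType) (P : I -> T -> Prop) : (forall i, N [set x | P i x]) ->
  N [set x | forall i, P i x].
Proof.
move=> H; have := sa_not (sa_existsi (fun n => sa_not (H n))).
congr N; apply/seteqP; split=> x /=.
  by move=> h n; apply: contrapT => ?; apply: h; exists n.
by move=> h [n].
Qed.

Lemma sa_preimage {U : Type} (f : T -> U) (G : set (set U)) :
  (forall B, G B -> N [set x | B (f x)]) ->
  forall B, <<s G >> B -> N [set x | B (f x)].
Proof.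
move=> H B; apply: (@smallest_sub _ _ _ [set B | N [set x | B (f x)]]) => //.
split=> /= [|A NA|F NF].
- exact: (sa_const False).
- have := sa_not NA; congr N; apply/seteqP; split=> x //= [].
  by [].
- have := sa_existsn NF; congr N; apply/seteqP; split=> x /= [n].
    by exists n.
  by move=> _ ?; exists n.
Qed.

End SigmaAlgebraTools.

(** * Measurability of the map and of its digit sequence *)

Section Measurability.
Variables (R : realType) (b : R).
Hypothesis hb : good_base b.
Implicit Types (z : pt R) (i j : 'I_3) (n m k : nat) (w : Omega) (u v : Upsilon)
  (x y : state R).

Lemma salg_sigU : sigma_algebra setT sigU. Proof. exact: smallest_sigma_algebra. Qed.
Lemma salg_borel2 : sigma_algebra setT (@borel2 R). Proof. exact: smallest_sigma_algebra. Qed.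
Lemma salg_prodsig : sigma_algebra (Dom b) (prodsig b). Proof. exact: smallest_sigma_algebra. Qed.
#[local] Hint Resolve salg_sigU salg_borel2 salg_prodsig : core.

Lemma prodsig_sub A : prodsig b A -> A `<=` Dom b.
Proof.
apply: (@smallest_sub _ _ _ [set A | A `<=` Dom b]).
  split=> /= [x //|B _ x []//|F HF x [n _]]; exact: HF.
by move=> _ [C _ [B _ <-]] x /= [_ []].
Qed.

(** Allowing arbitrary sets of states, measured by their trace on the domain, gives a sigma-algebra
    on the whole type, to which the lemmas on formulas apply. *)
Definition psig : set (set (state R)) := [set A | prodsig b (Dom b `&` A)].

Lemma salg_psig : sigma_algebra setT psig.
Proof.
have [h0 hD hU] := salg_prodsig; split; rewrite /psig /=.
- by rewrite setI0.
- move=> A /hD; congr (prodsig b); apply/seteqP; split=> x /=.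
    by move=> [Dx h]; split=> //; split=> // Ax; apply: h.
  by move=> [Dx [_ h]]; split=> // -[].
- by move=> F /hU; rewrite setI_bigcupr.
Qed.
#[local] Hint Resolve salg_psig : core.

Lemma psig_eq (A B : set (state R)) : (forall x, Dom b x -> (A x <-> B x)) ->
  psig A -> psig B.
Proof.
move=> H; rewrite /psig /=; congr (prodsig b).
by apply/seteqP; split=> x [Dx /H]; split=> //; tauto.
Qed.

Lemma prodsig_psig A : prodsig b A -> psig A.
Proof. by move=> MA; rewrite /psig /= setIidr //; exact: prodsig_sub. Qed.

Lemma psig_rect C B : sigO C -> borel2 B -> psig (C `*` B).
Proof.
move=> HC HB; rewrite /psig /=.
have : prodsig b (C `*` (B `&` S_beta b)).
  by apply: sub_sigma_algebra; exists C => //; exists B.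
by congr (prodsig b); apply/seteqP; split=> x /=; [move=> [? []]|move=> [? []]].
Qed.

Lemma sigO_T : sigO setT.
Proof. by have := sa_const (smallest_sigma_algebra _ _) True; apply. Qed.

Lemma psig_fst C : sigO C -> psig [set x | C x.1].
Proof.
move=> HC; have := psig_rect HC (sa_const salg_borel2 True).
by apply: psig_eq => x _; split=> [[]|].
Qed.

Lemma psig_snd B : borel2 B -> psig [set x | B x.2].
Proof.
move=> HB; have := psig_rect sigO_T HB.
by apply: psig_eq => x _; split=> [[]|].
Qed.

Lemma borel_closed (A : set (pt R)) : closed A -> borel2 A.
Proof.
move=> clA; have : borel2 (~` A) by apply: sub_sigma_algebra; exact: closed_openC.
by move=> /(sa_not salg_borel2); congr borel2; apply/seteqP; split=> x /=; rewrite notE.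
Qed.

Lemma borel_Tmap i B : borel2 B -> @borel2 R [set z | B (Tmap b i z)].
Proof.
apply: (sa_preimage salg_borel2) => U oU; apply: sub_sigma_algebra.
by have /continuousP := @continuous_Tmap R b i; apply.
Qed.

Lemma borel_allowed i : borel2 [set z | allowed b z i].
Proof. by apply: borel_Tmap; apply: borel_closed; exact: closed_S. Qed.

Lemma borel_S : borel2 (S_beta b).
Proof. by apply: borel_closed; exact: closed_S. Qed.

(** Through [CunionE] the infinite unions of holes disappear: only the sets [allowed] are left,
    preimages of the closed attractor. *)
Lemma borel_switch : borel2 [set z | S_beta b z /\ Cunion b z].
Proof.
have : borel2 [set z | S_beta b z /\
    exists i, exists j, i != j /\ (allowed b z i /\ allowed b z j)].
  apply: (sa_and salg_borel2); first exact: borel_S.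
  do 2!apply: (sa_existsi salg_borel2) => ?.
  apply: (sa_and salg_borel2); first exact: (sa_const salg_borel2).
  by apply: (sa_and salg_borel2); exact: borel_allowed.
congr borel2; apply/seteqP; split=> z /= [Sz].
  by move=> [i [j [? []]]]; split=> //; apply/(CunionE hb Sz); exists i, j.
by move=> /(CunionE hb Sz)[i [j []]]; split=> //; exists i, j.
Qed.

Lemma borel_bit i (c : bool) : borel2 [set z | S_beta b z /\ bit b z i = c].
Proof.
have : borel2 [set z | S_beta b z /\
   (((allowed b z o0 /\ allowed b z o1) /\ (i == o1) = c) \/
    (~ (allowed b z o0 /\ allowed b z o1) /\ (i == o2) = c))].
  have h01 := sa_and salg_borel2 (borel_allowed o0) (borel_allowed o1).
  apply: (sa_and salg_borel2); first exact: borel_S.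
  apply: (sa_or salg_borel2); apply: (sa_and salg_borel2) => //;
    [exact: (sa_const salg_borel2)|exact: (sa_not salg_borel2)|exact: (sa_const salg_borel2)].
congr borel2; apply/seteqP; split=> z /= [Sz]; rewrite /bit.
  move=> [[/(C01_allowed hb Sz) h e]|[h e]]; split=> //; first by rewrite mem_set.
  by rewrite memNset // => /(C01_allowed hb Sz).
have [/set_mem/(C01_allowed hb Sz) h e|/negP h e] := boolP (z \in C01 b); split=> //.
  by left.
by right; split=> // /(C01_allowed hb Sz)/mem_set.
Qed.

Lemma psig_switch : psig [set x | Cunion b x.2].
Proof. by apply: psig_eq (psig_snd borel_switch) => x Dx; split=> [[]|]. Qed.

Lemma sigO_coord n c : sigO [set w | w n = c].
Proof. by apply: sub_sigma_algebra; exists n => //; exists c. Qed.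

Lemma psig_digit i : psig [set x | digit b x = i].
Proof.
have : psig [set x | allowed b x.2 i /\ (~ Cunion b x.2 \/
    exists c : bool, x.1 0%N = c /\ (S_beta b x.2 /\ bit b x.2 i = c))].
  apply: (sa_and salg_psig); first exact: psig_snd (borel_allowed i).
  apply: (sa_or salg_psig); first exact: (sa_not salg_psig) psig_switch.
  apply: (sa_existsi salg_psig) => c; apply: (sa_and salg_psig).
    exact: psig_fst (sigO_coord 0 c).
  exact: psig_snd (borel_bit i c).
apply: psig_eq => -[w z] Dx /=; split.
  move=> [ai [nC|[c [e1 [_ e2]]]]]; first exact: digit_outside.
  have [cz|nC] := pselect (Cunion b z); last exact: digit_outside.
  by apply/(digit_inside hb w Dx cz ai); rewrite e1 e2.
move=> e; have ai : allowed b z i by rewrite -e; exact: digit_allowed.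
split=> //; have [cz|nC] := pselect (Cunion b z); last by left.
right; exists (w 0%N); split=> //; split=> //.
exact/esym/(digit_inside hb w Dx cz ai).
Qed.

Lemma sigO_shift C : sigO C -> sigO [set w | C (shiftO w)].
Proof.
apply: (sa_preimage (smallest_sigma_algebra _ _)) => _ [n _ [c _ <-]].
exact: (sigO_coord n.+1 c).
Qed.

Lemma psig_Kmap A : prodsig b A -> psig [set x | A (Kmap b x)].
Proof.
apply: (@smallest_sub _ _ _ [set A | psig [set x | A (Kmap b x)]]) => /=.
  split=> /= [|B HB|F HF].
  - exact: (sa_const salg_psig False).
  - apply: psig_eq (sa_not salg_psig HB) => x Dx; split=> [h|[]//].
    by split=> //; exact: Dom_Kmap.
  - have := sa_existsn salg_psig HF; apply: psig_eq => x Dx /=.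
    by split=> [[n ?]|[n _ ?]]; exists n.
move=> _ [C HC [B HB <-]].
have : psig [set x | (exists i, digit b x = i /\ B (Tmap b i x.2)) /\
   ((Cunion b x.2 /\ C (shiftO x.1)) \/ (~ Cunion b x.2 /\ C x.1))].
  apply: (sa_and salg_psig).
    apply: (sa_existsi salg_psig) => i; apply: (sa_and salg_psig); first exact: psig_digit.
    exact: psig_snd (borel_Tmap i HB).
  have h := psig_switch.
  apply: (sa_or salg_psig); apply: (sa_and salg_psig) => //.
  - exact: psig_fst (sigO_shift HC).
  - exact: (sa_not salg_psig).
  - exact: psig_fst.
apply: psig_eq => x Dx; have DK := Dom_Kmap hb Dx.
rewrite [X in _ <-> X](_ : _ = (C (Kmap b x).1 /\ B (Kmap b x).2)); last first.
  by apply/propext; split=> [[? []]|[]] //; split.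
rewrite Kmap_snd; case: x Dx {DK} => w z Dx; rewrite (Kmap_fst hb w (Dx : S_beta b z)) /=.
case: (boolP (z \in Cunion b)) => [/set_mem cz|/negP cz]; split.
- by move=> [[i [<- ?]] [[]|[]]].
- by move=> [? ?]; split; [exists (digit b (w, z))|left].
- move=> [[i [<- ?]] [[h]|[]]] //; by case: cz; exact: mem_set.
- move=> [? ?]; split; [by exists (digit b (w, z))|right; split=> //].
  by move=> h; apply: cz; exact: mem_set.
Qed.

Lemma psig_iter n A : psig A -> psig [set x | A (iter n (Kmap b) x)].
Proof.
elim: n => // n IH HA; have := psig_Kmap (IH HA).
by apply: psig_eq => x Dx; rewrite /= -iterS iterSr; split=> [[]//|h]; split=> //; exact: Dom_Kmap.
Qed.

Lemma psig_phi B : sigU B -> psig [set x | B (phi b x)].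
Proof.
apply: (sa_preimage salg_psig) => _ [n _ [i _ <-]].
exact: (psig_iter n (psig_digit i)).
Qed.

Lemma sigU_coord n i : sigU [set u | u n = i].
Proof. by apply: sub_sigma_algebra; exists n => //; exists i. Qed.

Lemma sigU_shift B : sigU B -> sigU [set u | B (shiftU u)].
Proof.
apply: (sa_preimage salg_sigU) => _ [n _ [i _ <-]]; exact: (sigU_coord n.+1 i).
Qed.

Lemma sigU_iter n B : sigU B -> sigU [set u | B (iter n shiftU u)].
Proof.
elim: n B => // n IH B HB; have := sigU_shift (IH _ HB); congr sigU.
by apply/funext => u; rewrite /= -iterSr.
Qed.

End Measurability.

(** * Measurability of decoding *)

Section SequenceSide.
Variables (R : realType) (b : R).
Hypothesis hb : good_base b.
Implicit Types (z : pt R) (i j : 'I_3) (n m k : nat) (w : Omega) (u v : Upsilon)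
  (x y : state R).

Lemma sigU_prefix n (A : set Upsilon) :
  (forall u v, (forall k, (k < n)%N -> u k = v k) -> A u -> A v) -> sigU A.
Proof.
move=> HA; have : sigU [set u | exists t : {ffun 'I_n -> 'I_3},
    (forall k : 'I_n, u k = t k) /\ exists v, A v /\ forall k : 'I_n, v k = t k].
  apply: (sa_existsi salg_sigU) => t; apply: (sa_and salg_sigU).
    by apply: (sa_foralli salg_sigU) => k; exact: sigU_coord.
  exact: (sa_const salg_sigU).
congr sigU; apply/seteqP; split=> u /=.
  move=> [t [ut [v [Av vt]]]]; apply: HA Av => k kn.
  by rewrite (ut (Ordinal kn)) (vt (Ordinal kn)).
move=> Au; exists [ffun k : 'I_n => u k]; split; first by move=> k; rewrite ffunE.
by exists u; split=> // k; rewrite ffunE.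
Qed.

(** The map [code b] is continuous: a sequence sent into an open set has a whole cylinder around it
    sent there. *)
Lemma sigU_code B : borel2 B -> sigU [set u | B (code b u)].
Proof.
apply: (sa_preimage salg_sigU) => U oU.
have : sigU [set u | exists n, forall v, (forall k, (k < n)%N -> u k = v k) -> U (code b v)].
  apply: (sa_existsn salg_sigU) => n; apply: (sigU_prefix (n := n)) => u v uv H v' vv'.
  by apply: H => k kn; rewrite uv // vv'.
congr sigU; apply/seteqP; split=> u /=; first by move=> [n]; apply.
move=> Uu; have /nbhs_ballP[e /= e0 He] : nbhs (code b u) U by exact: open_nbhs_nbhs.
have [n Hn] := code_cylinder hb u e0; exists n => v uv.
have [h1 h2] := Hn v (fun k kn => esym (uv k kn)).
by apply: He; split; rewrite /ball /= distrC.
Qed.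

Lemma sigU_switch : sigU [set u | switch b u].
Proof.
have := sigU_code (borel_switch hb); congr sigU; apply/seteqP; split=> u /=.
  by move=> [_ ?]; exact: mem_set.
by move=> /set_mem; split=> //; exact: S_code.
Qed.

Lemma sigU_nswitch n k : sigU [set u | nswitch b u n = k].
Proof.
elim: n k => [|n IH] k; first exact: (sa_const salg_sigU (0%N = k)).
have : sigU [set u | exists j : nat, nswitch b u n = j /\
   ((switch b (iter n shiftU u) /\ j.+1 = k) \/ (~ switch b (iter n shiftU u) /\ j = k))].
  apply: (sa_existsn salg_sigU) => j; apply: (sa_and salg_sigU) => //.
  have h := sigU_iter n sigU_switch.
  apply: (sa_or salg_sigU); apply: (sa_and salg_sigU).
  - exact: h.
  - exact: (sa_const salg_sigU).
  - exact: (sa_not salg_sigU h).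
  - exact: (sa_const salg_sigU).
congr sigU; apply/seteqP; split=> u /=.
  by move=> [j [-> [[-> <-]|[/negP/negbTE-> <-]]]]; rewrite (addn1, addn0).
move=> <-; exists (nswitch b u n); split=> //.
by case: (switch b _); [left; rewrite addn1|right; rewrite addn0].
Qed.

Lemma sigU_recurrent : sigU (recurrent b).
Proof.
apply: (sa_foralln salg_sigU) => m; apply: (sa_existsn salg_sigU) => n.
by apply: (sa_and salg_sigU); [exact: (sa_const salg_sigU)|exact: sigU_iter sigU_switch].
Qed.

Lemma sigU_switch_bits k c : sigU [set u | switch_bits b u k = c].
Proof.
have h : sigU [set u | exists n, switch b (iter n shiftU u) /\ (nswitch b u n = k /\
    exists i, u n = i /\ (S_beta b (code b (iter n shiftU u)) /\
      bit b (code b (iter n shiftU u)) i = true))].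
  apply: (sa_existsn salg_sigU) => n.
  apply: (sa_and salg_sigU); first exact: sigU_iter sigU_switch.
  apply: (sa_and salg_sigU); first exact: sigU_nswitch.
  apply: (sa_existsi salg_sigU) => i; apply: (sa_and salg_sigU); first exact: sigU_coord.
  exact: sigU_iter (sigU_code (borel_bit hb i true)).
case: c; [move: h|move: (sa_not salg_sigU h)];
  congr sigU; apply/seteqP; split=> u /=; rewrite /switch_bits.
- by move=> [n [s1 [s2 [i [<- [_ ?]]]]]]; apply/asboolP; exists n.
- move=> /asboolP[n [? ? ?]]; exists n; split=> //; split=> //.
  by exists (u n); split=> //; split=> //; exact: S_code.
- move=> h'; apply/asboolPn => -[n [? ? ?]]; apply: h'.
  exists n; split=> //; split=> //.
  by exists (u n); split=> //; split=> //; exact: S_code.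
- move=> /asboolPn h' [n [s1 [s2 [i [e [_ ?]]]]]]; apply: h'; exists n.
  by rewrite e.
Qed.

Lemma sigU_decode A : prodsig b A -> sigU [set u | A (decode b u)].
Proof.
apply: (@smallest_sub _ _ _ [set A | sigU [set u | A (decode b u)]]) => /=.
  split=> /= [|B HB|F HF].
  - exact: (sa_const salg_sigU False).
  - have := sa_not salg_sigU HB; congr sigU; apply/seteqP; split=> u /=.
      by move=> ?; split=> //; exact: Dom_decode.
    by case.
  - have := sa_existsn salg_sigU HF; congr sigU; apply/seteqP; split=> u /=.
      by move=> [n ?]; exists n.
    by move=> [n _ ?]; exists n.
move=> _ [C HC [B HB <-]].
have : sigU [set u | C (switch_bits b u) /\ B (code b u)].
  apply: (sa_and salg_sigU); last exact: sigU_code.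
  move: C HC; apply: (sa_preimage salg_sigU) => _ [n _ [c _ <-]].
  exact: sigU_switch_bits.
congr sigU; apply/seteqP; split=> u /=; last by move=> [? []].
by move=> [? ?]; split=> //; split=> //; exact: S_code.
Qed.

(** Forward images of measurable sets need not be measurable in general; the inverse [decode] turns
    them into preimages under a measurable map. *)
Lemma phi_imageE A : A `<=` Dom b ->
  phi b @` (Zset b `&` A) = [set u | recurrent b u /\ A (decode b u)].
Proof.
move=> AD; apply/seteqP; split=> u /=.
  move=> [x [Zx Ax] <-]; have Dx := AD _ Ax; rewrite decode_phi //.
  by split=> //; apply/(Zset_recurrent hb Dx).
move=> [ru Au]; exists (decode b u); last exact: phi_decode.
by split=> //; exact: Zset_decode.
Qed.

Lemma sigU_phi_image A : prodsig b A -> sigU (phi b @` (Zset b `&` A)).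
Proof.
move=> MA; rewrite phi_imageE; last exact: prodsig_sub.
exact: (sa_and salg_sigU sigU_recurrent (sigU_decode MA)).
Qed.

Lemma psig_Zset : psig b (Zset b).
Proof.
have := psig_phi hb sigU_recurrent; apply: psig_eq => x Dx.
exact: iff_sym (Zset_recurrent hb Dx).
Qed.

End SequenceSide.

(** * Entropy of finite-valued functions *)

Section LogInequalities.
Context {R : realType}.
Implicit Types s t x y : R.

Lemma etaE t : eta t = - (t * ln t).
Proof. by rewrite /eta; case: eqP => // ->; rewrite mul0r oppr0. Qed.

Lemma ln_le_subr1 x : 0 < x -> ln x <= x - 1.
Proof. by move=> x0; have := @le_ln1Dx _ (x - 1); rewrite subrKC; apply; lra. Qed.

Lemma ln_eq_subr1 x : 0 < x -> ln x = x - 1 -> x = 1.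
Proof.
move=> x0 e; apply/eqP; rewrite -subr_eq0; apply/negP => /negP.
by move=> /expR_gt1Dx; rewrite -e lnK ?posrE // e subrKC ltxx.
Qed.

Lemma eta_ge0 t : 0 <= t -> t <= 1 -> 0 <= eta t.
Proof. by move=> t0 t1; rewrite etaE -mulrN mulr_ge0 // oppr_ge0 ln_le0. Qed.

Lemma eta_mono_ln s t : 0 <= s -> s <= t -> s * - ln t <= eta s.
Proof.
rewrite etaE -mulrN le_eqVlt => /orP[/eqP<-|s0] st; first by rewrite !mul0r.
rewrite ler_pM2l // lerN2 ler_ln //; rewrite posrE; lra.
Qed.

Lemma eta_sub_le s t : 0 <= s -> s <= t -> t <= 1 -> eta s - eta t <= t - s.
Proof.
move=> s0 st t1; rewrite !etaE; case: (ltgtP s 0) (s0) => // [s1 _|-> _]; last first.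
  have := @mulr_ge0_le0 _ t (ln t); rewrite ln_le0 // mul0r; lra.
have t0 : 0 < t by lra.
have : ln (t / s) <= t / s - 1 by apply: ln_le_subr1; rewrite divr_gt0.
rewrite lnM ?posrE ?invr_gt0 // lnV ?posrE // => h.
have h1 : s * (ln t - ln s) <= s * (t / s - 1) by rewrite ler_pM2l.
have e : s * (t / s - 1) = t - s by field; lra.
have h2 : (t - s) * ln t <= 0 by rewrite mulr_ge0_le0 ?ln_le0 // subr_ge0.
lra.
Qed.

(** An explicit modulus of continuity of [eta] at 0, used in [fano]; it comes from
    [ln r^-1 <= r^-1 - 1] at the square root [r] of [t]. *)
Lemma eta_le_sqrt s t : 0 <= t -> 0 <= s -> t <= s ^+ 2 -> eta t <= 2 * s.
Proof.
move=> t0 s0 ts; have [->|tn0] := eqVneq t 0; first by rewrite etaE mul0r oppr0; lra.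
set r := Num.sqrt t; have r0 : 0 < r by rewrite sqrtr_gt0; lra.
have rt : t = r ^+ 2 by rewrite sqr_sqrtr.
have rs : r <= s by rewrite -ler_sqr ?nnegrE ?sqrtr_ge0 // -rt.
have : ln r^-1 <= r^-1 - 1 by apply: ln_le_subr1; rewrite invr_gt0.
rewrite lnV ?posrE // => h.
have h1 : r * - ln r <= r * (r^-1 - 1) by rewrite ler_pM2l.
have h2 : r * (r^-1 - 1) = 1 - r by field; lra.
have h3 : 2 * r * (r * - ln r) <= 2 * r * (1 - r) by rewrite ler_pM2l; lra.
rewrite etaE rt {2}expr2 lnM ?posrE // expr2; nra.
Qed.

(** With [x] running over the masses of a probability on [y] points, the left sides sum to 0. This
    gives the bound of an entropy by [ln y], and [gibbs_term_eq] its equality case. *)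
Lemma gibbs_term (x y : R) : 0 <= x -> 0 < y -> x - y^-1 <= x * ln (y * x).
Proof.
move=> x0 y0; have yi : 0 < y^-1 by rewrite invr_gt0.
case: (ltgtP x 0) (x0) => // [x1 _|-> _]; last by rewrite mul0r; lra.
have yx : 0 < y * x by rewrite mulr_gt0.
have : ln (y * x)^-1 <= (y * x)^-1 - 1 by apply: ln_le_subr1; rewrite invr_gt0.
rewrite lnV ?posrE // => h.
have h1 : x * - ln (y * x) <= x * ((y * x)^-1 - 1) by rewrite ler_pM2l.
have h2 : x * ((y * x)^-1 - 1) = y^-1 - x by field; apply/andP; split; lra.
lra.
Qed.

Lemma gibbs_term_eq (x y : R) : 0 <= x -> 0 < y -> x * ln (y * x) = x - y^-1 -> x = y^-1.
Proof.
move=> x0 y0 e; have yi : 0 < y^-1 by rewrite invr_gt0.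
case: (ltgtP x 0) (x0) => // [x1 _|x1 _]; last by move: e; rewrite x1 mul0r; lra.
have yx : 0 < y * x by rewrite mulr_gt0.
suff : (y * x)^-1 = 1.
  move=> /(congr1 (@GRing.inv _)); rewrite invrK invr1 => h.
  by rewrite -[x](mulKf (x := y)) ?h ?mulr1 //; lra.
apply: ln_eq_subr1; first by rewrite invr_gt0.
rewrite lnV ?posrE //; apply: (@mulfI _ x); first by lra.
have -> : x * ((y * x)^-1 - 1) = y^-1 - x by field; apply/andP; split; lra.
lra.
Qed.

(* The conditional independence of [X] and [Y] given [Z] is the extremal case:
   [w], [u], [v], [z] stand for the masses of (x,y,z), (x,z), (y,z), z. *)
Lemma submod_term (w u v z : R) : 0 <= w -> w <= u -> w <= v -> u <= z -> v <= z ->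
  w - u * v / z <= w * (ln w + ln z - ln u - ln v).
Proof.
move=> w0 wu wv uz vz.
case: (ltgtP w 0) (w0) => // [w1 _|-> _]; last first.
  by rewrite mul0r sub0r oppr_le0 divr_ge0 ?mulr_ge0 //; lra.
have [u0 v0 z0] : [/\ 0 < u, 0 < v & 0 < z] by split; lra.
have : ln (u * v / (w * z)) <= u * v / (w * z) - 1.
  by apply: ln_le_subr1; rewrite divr_gt0 // mulr_gt0.
rewrite lnM ?posrE ?mulr_gt0 ?invr_gt0 ?mulr_gt0 // lnM ?posrE //.
rewrite lnV ?posrE ?mulr_gt0 // lnM ?posrE // => h.
have h1 : w * (ln u + ln v + - (ln w + ln z)) <= w * (u * v / (w * z) - 1) by rewrite ler_pM2l.
have h2 : w * (u * v / (w * z) - 1) = u * v / z - w by field; apply/andP; split; lra.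
lra.
Qed.

End LogInequalities.

(** * Shannon entropy of finite-valued functions *)

Section FiniteVariables.
Context {R : realType} {T : Type}.

(* [p] is a probability carried by [D]: sets are compared on [D] only. *)
Record prob_on (D : set T) (N : set (set T)) (p : set T -> R) : Prop := ProbOn {
  po_sigma : sigma_algebra setT N;
  po_ge0 : forall A, N A -> 0 <= p A;
  po_T : p setT = 1;
  po_U : forall A B, N A -> N B -> (forall x, A x -> B x -> False) ->
    p (A `|` B) = p A + p B;
  po_cvg : forall F : nat -> set T, (forall n, N (F n)) -> trivIset setT F ->
    (fun n => \sum_(i < n) p (F i)) @ \oo --> p (\bigcup_n F n);
  po_eqN : forall A B, (forall x, D x -> (A x <-> B x)) -> N A -> N B;
  po_eq : forall A B, (forall x, D x -> (A x <-> B x)) -> p A = p B }.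

Variables (D : set T) (N : set (set T)) (p : set T -> R).
Hypothesis hp : prob_on D N p.
Implicit Types (A B : set T) (I J L : finType).

Let hN := po_sigma hp.

Lemma po_0 : p set0 = 0.
Proof.
have N0 : N set0 by case: hN.
by have := po_U hp N0 N0 (fun x h => fun=> h); rewrite setU0; lra.
Qed.

Lemma po_split A B : N A -> N B ->
  p A = p (A `&` B) + p (A `&` ~` B).
Proof.
move=> NA NB; rewrite -(po_U hp) -?setIUr ?setUv ?setIT //.
- exact: (sa_and hN).
- exact: (sa_and hN NA (sa_not hN NB)).
- by move=> x [_ ?] [_].
Qed.

Lemma po_le A B : N A -> N B -> (forall x, D x -> A x -> B x) -> p A <= p B.
Proof.
move=> NA NB AB; rewrite (po_split NB NA).
rewrite (@po_eq _ _ _ hp A (B `&` A)); last by move=> x Dx; split=> [h|[]//]; split=> //; exact: AB.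
by rewrite lerDl (po_ge0 hp) //; exact: (sa_and hN NB (sa_not hN NA)).
Qed.

Lemma po_le1 A : N A -> p A <= 1.
Proof. by move=> NA; rewrite -(po_T hp) po_le //; exact: (sa_const hN True). Qed.

Lemma po_subU A B : N A -> N B -> p (A `|` B) <= p A + p B.
Proof.
move=> NA NB; have NC := sa_and hN NB (sa_not hN NA).
have -> : A `|` B = A `|` (B `&` ~` A).
  apply/seteqP; split=> x /=; first by have [?|?] := pselect (A x); tauto.
  by tauto.
rewrite (po_U hp) //; last by move=> x ? [].
by rewrite lerD2l po_le // => x _ [].
Qed.

Definition rv {J} (X : T -> J) := forall j, N [set x | X x = j].
Definition pmf {J} (X : T -> J) (j : J) := p [set x | X x = j].
Definition ent {J} (X : T -> J) : R := \sum_j eta (pmf X j).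
(** Functional dependence on [D], phrased through equal values so that no factor map has to be
    chosen. *)
Definition det {I J} (X : T -> I) (Y : T -> J) :=
  forall x y, D x -> D y -> X x = X y -> Y x = Y y.
Definition pair_rv {I J} (X : T -> I) (Y : T -> J) (x : T) := (X x, Y x).

Lemma rv_pred {J} (X : T -> J) (Q : J -> Prop) : rv X -> N [set x | Q (X x)].
Proof.
move=> hX; have : N [set x | exists j, X x = j /\ Q j].
  by apply: (sa_existsi hN) => j; apply: (sa_and hN); [exact: hX|exact: (sa_const hN)].
congr N; apply/seteqP; split=> x /=; first by move=> [j [->]].
by move=> ?; exists (X x).
Qed.

Lemma rv_pair {I J} (X : T -> I) (Y : T -> J) : rv X -> rv Y -> rv (pair_rv X Y).
Proof.
move=> hX hY [i j]; have := sa_and hN (hX i) (hY j); congr N.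
by apply/seteqP; split=> x /= => [[<- <-]|[<- <-]].
Qed.

Lemma pmf_ge0 {J} (X : T -> J) j : rv X -> 0 <= pmf X j.
Proof. by move=> hX; exact: (po_ge0 hp (hX j)). Qed.

Lemma pmf_le1 {J} (X : T -> J) j : rv X -> pmf X j <= 1.
Proof. by move=> hX; exact: (po_le1 (hX j)). Qed.

Lemma total_probability {J} (X : T -> J) A : rv X -> N A ->
  p A = \sum_j p (A `&` [set x | X x = j]).
Proof.
move=> hX NA.
have main (s : seq J) : uniq s ->
    p (A `&` [set x | X x \in s]) = \sum_(j <- s) p (A `&` [set x | X x = j]).
  elim: s => [_|j s IH /= /andP[js us]].
    by rewrite big_nil -po_0; congr p; apply/seteqP; split=> x // [].
  rewrite big_cons -IH // -(po_U hp).
  - congr p; apply/seteqP; split=> x /=; rewrite inE.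
      by move=> [Ax /orP[/eqP|]]; [left|right].
    by move=> [[Ax ->]|[Ax ->]]; rewrite ?eqxx ?orbT.
  - exact: (sa_and hN NA (hX j)).
  - exact: (sa_and hN NA (rv_pred (fun j => j \in s) hX)).
  - by move=> x [_ /= ->] [_ /=]; rewrite (negbTE js).
have := main (index_enum J) (index_enum_uniq J) => <-.
by congr p; apply/seteqP; split=> x /= => [|[]]//; split=> //; rewrite mem_index_enum.
Qed.

Lemma pmf_sum {J} (X : T -> J) : rv X -> \sum_j pmf X j = 1.
Proof.
move=> hX; rewrite -(po_T hp) (total_probability hX (sa_const hN True)).
by apply: eq_bigr => j _; congr p; apply/seteqP; split=> x //= [].
Qed.

Lemma pmf_marginal {I J} (X : T -> I) (Y : T -> J) i : rv X -> rv Y ->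
  pmf X i = \sum_j pmf (pair_rv X Y) (i, j).
Proof.
move=> hX hY; rewrite /pmf (total_probability hY) //; apply: eq_bigr => j _.
by congr p; apply/seteqP; split=> x /= => [[<- <-]|[<- <-]].
Qed.

Lemma pmf_pairC {I J} (X : T -> I) (Y : T -> J) i j :
  pmf (pair_rv X Y) (i, j) = pmf (pair_rv Y X) (j, i).
Proof. by congr p; apply/seteqP; split=> x /= [<- <-]. Qed.

Lemma pmf_marginalr {I J} (X : T -> I) (Y : T -> J) j : rv X -> rv Y ->
  pmf Y j = \sum_i pmf (pair_rv X Y) (i, j).
Proof.
by move=> hX hY; rewrite (pmf_marginal j hY hX); apply: eq_bigr => i _; rewrite pmf_pairC.
Qed.

Lemma pmf_pair_le {I J} (X : T -> I) (Y : T -> J) i j : rv X -> rv Y ->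
  pmf (pair_rv X Y) (i, j) <= pmf X i /\ pmf (pair_rv X Y) (i, j) <= pmf Y j.
Proof.
move=> hX hY; have hXY := rv_pair hX hY.
by split; [apply: (po_le (hXY (i, j)) (hX i))|apply: (po_le (hXY (i, j)) (hY j))];
  move=> x _ [].
Qed.

Lemma ent_pairE {I J} (X : T -> I) (Y : T -> J) :
  ent (pair_rv X Y) = \sum_i \sum_j eta (pmf (pair_rv X Y) (i, j)).
Proof. by rewrite pair_big; apply: eq_bigr => -[]. Qed.

Lemma ent_ge0 {J} (X : T -> J) : rv X -> 0 <= ent X.
Proof. by move=> hX; apply: sumr_ge0 => j _; rewrite eta_ge0 ?pmf_ge0 ?pmf_le1. Qed.

Lemma ent_pair_ge {I J} (X : T -> I) (Y : T -> J) : rv X -> rv Y ->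
  ent Y <= ent (pair_rv X Y).
Proof.
move=> hX hY; have hXY := rv_pair hX hY.
rewrite ent_pairE exchange_big; apply: ler_sum => j _ /=.
rewrite {1}etaE (pmf_marginalr j hX hY) -mulrN mulr_suml.
apply: ler_sum => i _; rewrite -(pmf_marginalr j hX hY).
by apply: eta_mono_ln; [exact: pmf_ge0|have [] := pmf_pair_le i j hX hY].
Qed.

Lemma ent_pair_det {I J} (X : T -> I) (Y : T -> J) : rv X -> rv Y -> det X Y ->
  ent (pair_rv X Y) = ent X.
Proof.
move=> hX hY XY; have hXY := rv_pair hX hY; rewrite ent_pairE; apply: eq_bigr => i _.
have pz k : (forall x, D x -> X x = i -> Y x = k -> False) ->
    pmf (pair_rv X Y) (i, k) = 0.
  move=> h; rewrite -po_0; apply: (po_eq hp) => x Dx; split=> //= -[h1 h2].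
  exact: h h1 h2.
have [[x [Dx Xx]]|nx] := pselect (exists x, D x /\ X x = i); last first.
  rewrite big1; last first.
    by move=> j _; rewrite pz ?etaE ?mul0r ?oppr0 // => x Dx Xx _; apply: nx; exists x.
  rewrite (pmf_marginal i hX hY) big1 ?etaE ?mul0r ?oppr0 // => j _.
  by rewrite pz // => x Dx Xx _; apply: nx; exists x.
have other j : j != Y x -> pmf (pair_rv X Y) (i, j) = 0.
  move=> jn; apply: pz => y Dy Xy Yy; move: jn; rewrite -Yy (XY x y) ?eqxx //.
  by rewrite Xx Xy.
rewrite (bigD1 (Y x)) //= big1 ?addr0; last first.
  by move=> j jn; rewrite other // etaE mul0r oppr0.
rewrite (pmf_marginal i hX hY) (bigD1 (Y x)) //= [X in _ = eta (_ + X)]big1 ?addr0 //.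
Qed.

Lemma ent_pairC {I J} (X : T -> I) (Y : T -> J) : ent (pair_rv X Y) = ent (pair_rv Y X).
Proof.
rewrite !ent_pairE exchange_big; apply: eq_bigr => j _; apply: eq_bigr => i _.
by rewrite pmf_pairC.
Qed.

Lemma ent_det_le {I J} (X : T -> I) (Y : T -> J) : rv X -> rv Y -> det X Y ->
  ent Y <= ent X.
Proof. by move=> hX hY XY; rewrite -(ent_pair_det hX hY XY) ent_pair_ge. Qed.

Lemma ent_equiv {I J} (X : T -> I) (Y : T -> J) : rv X -> rv Y -> det X Y -> det Y X ->
  ent X = ent Y.
Proof. by move=> hX hY XY YX; apply/eqP; rewrite eq_le !ent_det_le. Qed.

(** Strong subadditivity of entropy. All four entropies are rewritten as sums over the triples,
    weighted by the joint mass [w], so that [submod_term] applies to each triple. *)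
Lemma ent_submod {I J L} (X : T -> I) (Y : T -> J) (Z : T -> L) :
  rv X -> rv Y -> rv Z ->
  ent (pair_rv X (pair_rv Y Z)) + ent Z <= ent (pair_rv X Z) + ent (pair_rv Y Z).
Proof.
move=> hX hY hZ; have hYZ := rv_pair hY hZ; have hXZ := rv_pair hX hZ.
have hXYZ := rv_pair hX hYZ.
pose w i j l := pmf (pair_rv X (pair_rv Y Z)) (i, (j, l)).
pose u i l := pmf (pair_rv X Z) (i, l); pose v j l := pmf (pair_rv Y Z) (j, l).
pose z l := pmf Z l.
have wu i l : u i l = \sum_j w i j l.
  rewrite /u (pmf_marginal (i, l) hXZ hY); apply: eq_bigr => j _.
  by congr p; apply/seteqP; split=> x /= [<- <- <-].
have wv j l : v j l = \sum_i w i j l by rewrite /v (pmf_marginalr (j, l) hX hYZ).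
have uz l : z l = \sum_i u i l by rewrite /z (pmf_marginalr l hX hZ).
have vz l : z l = \sum_j v j l by rewrite /z (pmf_marginalr l hY hZ).
have E1 : ent (pair_rv X (pair_rv Y Z)) = \sum_l \sum_i \sum_j - (w i j l * ln (w i j l)).
  rewrite ent_pairE.
  transitivity (\sum_i \sum_j \sum_l eta (w i j l)).
    by apply: eq_bigr => i _; rewrite pair_bigA; apply: eq_bigr => -[].
  under eq_bigr do rewrite exchange_big.
  by rewrite exchange_big; do 3!apply: eq_bigr => ? _; rewrite etaE.
have E2 : ent Z = \sum_l \sum_i \sum_j - (w i j l * ln (z l)).
  apply: eq_bigr => l _; rewrite etaE -/(z l) {1}uz mulr_suml -sumrN.
  apply: eq_bigr => i _; by rewrite wu mulr_suml -sumrN.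
have E3 : ent (pair_rv X Z) = \sum_l \sum_i \sum_j - (w i j l * ln (u i l)).
  rewrite ent_pairE exchange_big; do 2!apply: eq_bigr => ? _; rewrite etaE -/(u _ _).
  by rewrite {1}wu mulr_suml -sumrN.
have E4 : ent (pair_rv Y Z) = \sum_l \sum_i \sum_j - (w i j l * ln (v j l)).
  rewrite ent_pairE exchange_big; apply: eq_bigr => l _; rewrite exchange_big /=.
  by apply: eq_bigr => j _; rewrite etaE -/(v _ _) {1}wv mulr_suml -sumrN.
have w0 i j l : 0 <= w i j l by exact: pmf_ge0.
have wlu i j l : w i j l <= u i l.
  by rewrite wu (bigD1 j) //= lerDl sumr_ge0.
have wlv i j l : w i j l <= v j l.
  by rewrite wv (bigD1 i) //= lerDl sumr_ge0.
have ulz i l : u i l <= z l.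
  by rewrite uz (bigD1 i) //= lerDl sumr_ge0 // => k _; exact: pmf_ge0.
have vlz j l : v j l <= z l.
  by rewrite vz (bigD1 j) //= lerDl sumr_ge0 // => k _; exact: pmf_ge0.
rewrite -subr_ge0 E1 E2 E3 E4 -!big_split /= -sumrB; apply: sumr_ge0 => l _.
rewrite -!big_split /= -sumrB.
(* For fixed [l] these lower bounds add up to [z l - z l * z l / z l = 0]. *)
apply: (@le_trans _ _ (\sum_i \sum_j (w i j l - u i l * v j l / z l))).
  under eq_bigr do rewrite sumrB -mulr_suml -mulr_sumr -vz -wu.
  rewrite sumrB -uz -mulr_suml -mulr_suml -uz.
  have [->|zn] := eqVneq (z l) 0; first by rewrite !mul0r subr0.
  by rewrite mulfK // subrr.
apply: ler_sum => i _; rewrite -!big_split /= -sumrB; apply: ler_sum => j _.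
have := submod_term (w0 i j l) (wlu i j l) (wlv i j l) (ulz i l) (vlz j l); lra.
Qed.

Lemma sum_inv_card J : 0 < #|J|%:R :> R -> \sum_(j : J) (#|J|%:R^-1 : R) = 1.
Proof.
by move=> n0; rewrite sumr_const -[LHS]mulr_natl divff // gt_eqF.
Qed.

Lemma ent_card_gap {J} (X : T -> J) : rv X -> 0 < #|J|%:R :> R ->
  ln #|J|%:R - ent X = \sum_j pmf X j * ln (#|J|%:R * pmf X j).
Proof.
move=> hX n0; have {1}-> : ln #|J|%:R = \sum_j pmf X j * ln (#|J|%:R : R).
  by rewrite -mulr_suml pmf_sum // mul1r.
rewrite /ent -sumrB; apply: eq_bigr => j _; rewrite etaE opprK -mulrDr.
have [->|pn] := eqVneq (pmf X j) 0; first by rewrite !mul0r.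
by rewrite lnM ?posrE // lt0r pn pmf_ge0.
Qed.

Lemma ent_card_le {J} (X : T -> J) : rv X -> ent X <= ln #|J|%:R.
Proof.
move=> hX; have n0 : (0 < #|J|%:R :> R).
  rewrite ltr0n lt0n; apply/negP => /eqP c0.
  have := pmf_sum hX; rewrite big1 => [/eqP|j _]; first by rewrite eq_sym oner_eq0.
  by have := max_card (pred1 j); rewrite c0 card1.
rewrite -subr_ge0 ent_card_gap //.
apply: (@le_trans _ _ (\sum_j (pmf X j - #|J|%:R^-1))).
  by rewrite sumrB pmf_sum // sum_inv_card ?subrr.
by apply: ler_sum => j _; apply: gibbs_term => //; exact: pmf_ge0.
Qed.

Lemma ent_card_eq {J} (X : T -> J) j : rv X -> ent X = ln #|J|%:R ->
  pmf X j = #|J|%:R^-1.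
Proof.
move=> hX e; have n0 : (0 < #|J|%:R :> R) by rewrite ltr0n; apply/card_gt0P; exists j.
apply: gibbs_term_eq => //; first exact: pmf_ge0.
have S0 : \sum_j (pmf X j * ln (#|J|%:R * pmf X j) - (pmf X j - #|J|%:R^-1)) = 0.
  by rewrite sumrB [X in _ - X]sumrB pmf_sum // sum_inv_card // subrr subr0
    -ent_card_gap // e subrr.
apply/eqP; rewrite -subr_eq0; move/eqP: S0; rewrite psumr_eq0 => [/allP/(_ j)|k _].
  by rewrite mem_index_enum; apply.
by rewrite subr_ge0; apply: gibbs_term => //; exact: pmf_ge0.
Qed.

End FiniteVariables.

(** * Conditional entropy and Fano's inequality *)

Section ConditionalEntropy.
Context {R : realType} {T : Type}.
Variables (D : set T) (N : set (set T)) (p : set T -> R).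
Hypothesis hp : prob_on D N p.
Implicit Types (I J L : finType).

Let hN := po_sigma hp.

Lemma det_refl {J} (X : T -> J) : det D X X. Proof. by []. Qed.

Lemma det_comp {I J} (X : T -> I) (g : I -> J) : det D X (g \o X).
Proof. by move=> x y _ _ /= ->. Qed.

Lemma rv_comp {I J} (X : T -> I) (g : I -> J) : rv N X -> rv N (g \o X).
Proof. by move=> hX j; exact: (rv_pred hp (fun i => g i = j) hX). Qed.

(** The differences are the conditional entropies of [X] given [Y] and given [Z], which get no
    notation of their own. *)
Lemma ent_cond_le {I J L} (X : T -> I) (Y : T -> J) (Z : T -> L) :
  rv N X -> rv N Y -> rv N Z -> det D Y Z ->
  ent p (pair_rv X Y) - ent p Y <= ent p (pair_rv X Z) - ent p Z.
Proof.
move=> hX hY hZ YZ; have hYZ := rv_pair hp hY hZ.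
have := ent_submod hp hX hY hZ; rewrite (ent_pair_det hp hY hZ YZ).
rewrite (ent_equiv hp (rv_pair hp hX hYZ) (rv_pair hp hX hY)); first by lra.
  by move=> x y Dx Dy [e1 e2 _]; rewrite /pair_rv e1 e2.
by move=> x y Dx Dy [e1 e]; rewrite /pair_rv e1 e (YZ x y).
Qed.

Lemma ent_pair_le {I J} (X : T -> I) (Y : T -> J) : rv N X -> rv N Y ->
  ent p (pair_rv X Y) <= ent p X + ent p Y.
Proof.
move=> hX hY; have hc : rv N (fun _ : T => tt) by move=> ?; exact: (sa_const hN).
have := ent_cond_le hX hY hc (fun x y _ _ _ => erefl).
rewrite (ent_pair_det hp hX hc (fun x y _ _ _ => erefl)).
have := ent_ge0 hp hc; lra.
Qed.

(** The threshold [d] depends on the number of values only, so it can be fixed before the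
    approximating function is built in [approximate_rv]. *)
Lemma fano (J : finType) (e : R) : 0 < e -> exists2 d : R, 0 < d &
  forall X Y : T -> J, rv N X -> rv N Y -> p [set x | X x <> Y x] <= d ->
  ent p (pair_rv X Y) <= ent p Y + e.
Proof.
move=> e0; pose m : R := (#|J| * #|J|)%N%:R; have m0 : 0 <= m by exact: ler0n.
(* With [d = s ^+ 2], each of the at most [m] off-diagonal masses has [eta] at most [2 * s], and the
   diagonal loses at most [d <= s] in total; the sum is at most [s * (2 * m + 1) <= e]. *)
pose s := Num.min 1 (e / (2 * m + 1)).
have c0 : 0 < 2 * m + 1 by lra.
have s0 : 0 < s by rewrite lt_min ltr01 divr_gt0.
have s1 : s <= 1 by rewrite ge_min lexx.
have se : s * (2 * m + 1) <= e by rewrite -ler_pdivlMr // ge_min lexx orbT.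
exists (s ^+ 2); first exact: exprn_gt0.
move=> X Y hX hY hd; have hXY := rv_pair hp hX hY.
pose w i j := pmf p (pair_rv X Y) (i, j).
have ND : N [set x | X x <> Y x].
  by have := rv_pred hp (fun q : J * J => q.1 <> q.2) hXY.
have wd i j : i != j -> w i j <= s ^+ 2.
  move=> ij; apply: le_trans hd; apply: (po_le hp (hXY (i, j)) ND).
  by move=> x _ /= [-> ->]; apply/eqP.
have w0 i j : 0 <= w i j by exact: (pmf_ge0 hp).
have off : \sum_j \sum_(i | i != j) w i j = p [set x | X x <> Y x].
  rewrite (total_probability hp hXY ND).
  rewrite [RHS](eq_bigr (fun q : J * J => if q.1 != q.2 then w q.1 q.2 else 0)).
    rewrite -(pair_bigA _ (fun i j => if i != j then w i j else 0)) exchange_big.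
    by apply: eq_bigr => j _; rewrite big_mkcond.
  move=> [i j] _ /=; case: (eqVneq i j) => [->|ij].
    rewrite -(po_0 hp); congr p; apply/seteqP; split=> x //= [h [h1 h2]].
    by case: h; rewrite h1 h2.
  congr p; apply/seteqP; split=> x /=; first by case.
  by move=> e'; split=> //; case: e' => -> ->; exact/eqP.
rewrite -lerBlDl (ent_pairE) exchange_big /ent -sumrB.
apply: (@le_trans _ _ (\sum_j \sum_(i | i != j) (w i j + 2 * s))).
  apply: ler_sum => j _; rewrite (bigD1 j) //=.
  have hYj : pmf p Y j = w j j + \sum_(i | i != j) w i j.
    by rewrite (pmf_marginalr hp j hX hY) (bigD1 j).
  have h1 : eta (w j j) - eta (pmf p Y j) <= \sum_(i | i != j) w i j.
    apply: le_trans (_ : pmf p Y j - w j j <= _); last by rewrite hYj; lra.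
    apply: eta_sub_le => //; last exact: (pmf_le1 hp).
    by rewrite hYj lerDl sumr_ge0.
  have h2 : \sum_(i | i != j) eta (w i j) <= \sum_(i | i != j) (2 * s).
    by apply: ler_sum => i ij; apply: eta_le_sqrt => //; [exact: ltW|exact: wd].
  rewrite big_split /=; rewrite -/(w j j); move: h1 h2; rewrite /w; lra.
under eq_bigr do rewrite big_split /=.
rewrite big_split /= off.
have : \sum_(j : J) \sum_(i | i != j) (2 * s) <= m * (2 * s).
  apply: (@le_trans _ _ (\sum_(j : J) \sum_(i : J) (2 * s))).
    by apply: ler_sum => j _; rewrite [leRHS](bigD1 j) //= lerDr; lra.
  by rewrite !sumr_const -mulrnA -[leLHS]mulr_natl lexx.
have : s ^+ 2 <= s by rewrite expr2 ger_pMl //.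
lra.
Qed.

End ConditionalEntropy.

(** * Itineraries under an invariant probability *)

Section Itinerary.
Context {R : realType} {T : Type}.

(** Nested pairs, so that an itinerary of length [n.+1] is by computation a [pair_rv] and the
    entropy lemmas for pairs apply. *)
Fixpoint itin_type (I : finType) n : finType :=
  if n is m.+1 then (itin_type I m * I)%type else unit.

Lemma card_itin_type I n : #|itin_type I n| = (#|I| ^ n)%N.
Proof. by elim: n => [|n IH]; rewrite ?card_unit // card_prod IH expnSr. Qed.

Fixpoint itin {I : finType} (Tm : T -> T) (f : T -> I) n : T -> itin_type I n :=
  if n is m.+1 then pair_rv (itin Tm f m) (f \o iter m Tm) else fun=> tt.

Lemma itin_eqP {I : finType} Tm (f : T -> I) n x y : itin Tm f n x = itin Tm f n y <->
  forall k, (k < n)%N -> f (iter k Tm x) = f (iter k Tm y).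
Proof.
elim: n => [//|n IH]; split=> /= [[/IH h1 h2] k|H].
  by rewrite ltnS leq_eqVlt => /orP[/eqP->|/h1].
rewrite /pair_rv /= (H n (ltnSn n)) (IH.2 _) // => k kn; apply: H; exact: ltnW.
Qed.

Variables (D : set T) (N : set (set T)) (p : set T -> R).
Hypothesis hp : prob_on D N p.
Variable Tm : T -> T.
Hypothesis hD : forall x, D x -> D (Tm x).
Hypothesis hT : forall A, N A -> N [set x | A (Tm x)].
Hypothesis inv : forall A, N A -> p [set x | A (Tm x)] = p A.
Implicit Types (I J L : finType).

Let hN := po_sigma hp.

Lemma D_iter n x : D x -> D (iter n Tm x).
Proof. by move=> Dx; elim: n => //= n; exact: hD. Qed.

Lemma rv_iter {I} (f : T -> I) n : rv N f -> rv N (f \o iter n Tm).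
Proof.
move=> hf; elim: n => [//|n IH] i; have := hT (IH i); congr N.
by apply/seteqP; split=> x /=; rewrite -iterS iterSr.
Qed.

Lemma ent_iter {I} (f : T -> I) n : rv N f -> ent p (f \o iter n Tm) = ent p f.
Proof.
move=> hf; apply: eq_bigr => i _; congr (eta _); rewrite /pmf.
elim: n => [//|n IH]; rewrite -IH -(inv (rv_iter n hf i)).
by congr p; apply/seteqP; split=> x /=; rewrite -iterS iterSr.
Qed.

Lemma rv_itin {I} (f : T -> I) n : rv N f -> rv N (itin Tm f n).
Proof.
move=> hf; elim: n => [|n IH] /=; first by move=> ?; exact: (sa_const hN).
by apply: (rv_pair hp) => //; exact: rv_iter.
Qed.

Arguments rv_itin {I f} n hf.

(** Given [X] and the past, the symbol at time [k] costs at most its conditional entropy given [Q]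
    at time [k], because [X] determines the latter; by invariance this cost is the same at all
    times. *)
Lemma ent_itin_cond {I J L} (a : T -> I) (Q : T -> J) (X : T -> L) n :
  rv N a -> rv N Q -> rv N X ->
  (forall k, (k < n)%N -> det D X (Q \o iter k Tm)) ->
  ent p (pair_rv (itin Tm a n) X) <=
  ent p X + n%:R * (ent p (pair_rv a Q) - ent p Q).
Proof.
move=> ha hQ hX; elim: n => [|n IH] HX.
  rewrite mul0r addr0 (ent_pairC p) (ent_pair_det hp hX (rv_itin 0 ha)) //.
have {}IH := IH (fun k kn => HX k (ltnW kn)).
have hAn := rv_itin n ha; have han := rv_iter n ha; have hQn := rv_iter n hQ.
have s := ent_submod hp han hAn hX.
have c := ent_cond_le hp han hX hQn (HX n (ltnSn n)).
have e1 : ent p (pair_rv (a \o iter n Tm) (Q \o iter n Tm)) = ent p (pair_rv a Q).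
  by rewrite -(ent_iter n (rv_pair hp ha hQ)).
have e2 : ent p (Q \o iter n Tm) = ent p Q by exact: ent_iter.
have e3 : ent p (pair_rv (itin Tm a n.+1) X) =
    ent p (pair_rv (a \o iter n Tm) (pair_rv (itin Tm a n) X)).
  apply: (ent_equiv hp).
  - by apply: (rv_pair hp) => //; exact: (rv_itin n.+1 ha).
  - by apply: (rv_pair hp) => //; exact: (rv_pair hp).
  - by move=> x y _ _ [h1 h2 h3]; rewrite /pair_rv /= h1 h2 h3.
  - by move=> x y _ _ [h1 h2 h3]; rewrite /pair_rv /= /pair_rv /= h1 h2 h3.
rewrite e3 mulrSr mulrDl mul1r; lra.
Qed.

Lemma ent_itinD {I} (f : T -> I) m k : rv N f ->
  ent p (itin Tm f (m + k)) <= ent p (itin Tm f m) + ent p (itin Tm f k).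
Proof.
move=> hf; have hm := rv_itin m hf; have hk := rv_itin k hf.
have hkm := rv_iter m hk.
rewrite -[ent p (itin Tm f k)](ent_iter m hk).
apply: le_trans (ent_pair_le hp hm hkm).
apply: (ent_det_le hp); [exact: (rv_pair hp)|exact: rv_itin|].
move=> x y _ _ [/itin_eqP h1 /itin_eqP h2]; apply/itin_eqP => i.
case: (ltnP i m) => [im _|mi imk]; first exact: h1.
have := h2 (i - m)%N; rewrite ltn_subLR // => /(_ imk).
by rewrite -!iterD subnK.
Qed.

Lemma ent_itinM {I} (f : T -> I) q k : rv N f ->
  ent p (itin Tm f (q * k)) <= q%:R * ent p (itin Tm f k).
Proof.
move=> hf; elim: q => [|q IH].
  rewrite mul0r mul0n; apply: le_trans (ent_card_le hp (rv_itin 0 hf)) _.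
  by rewrite card_unit ln1.
rewrite mulSn mulrS mulrDl mul1r; apply: le_trans (ent_itinD k (q * k) hf) _.
by rewrite lerD2l.
Qed.

Lemma ent_itin_le {I} (f : T -> I) m n : (m <= n)%N -> rv N f ->
  ent p (itin Tm f m) <= ent p (itin Tm f n).
Proof.
move=> mn hf; apply: (ent_det_le hp); try exact: rv_itin.
move=> x y _ _ /itin_eqP h; apply/itin_eqP => k km; apply: h.
exact: leq_trans km mn.
Qed.

End Itinerary.

(** * Approximation by finer and finer finite-valued functions *)

Section Approximation.
Context {R : realType} {T : Type}.
Variables (D : set T) (N : set (set T)) (p : set T -> R).
Hypothesis hp : prob_on D N p.
Variables (J : nat -> finType) (Q : forall n, T -> J n).
Hypothesis hQ : forall n, rv N (Q n).
Hypothesis mono : forall m n, (m <= n)%N -> det D (Q n) (Q m).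

Let hN := po_sigma hp.

Definition symdiff (A B : set T) := [set x | ~ (A x <-> B x)].

Lemma sa_symdiff A B : N A -> N B -> N (symdiff A B).
Proof.
move=> NA NB.
have := sa_or hN (sa_and hN NA (sa_not hN NB)) (sa_and hN NB (sa_not hN NA)).
congr N; apply/seteqP; split=> x; rewrite /symdiff /=; first by tauto.
by have [?|?] := pselect (A x); have [?|?] := pselect (B x); tauto.
Qed.

Definition approximable (A : set T) := N A /\
  forall e : R, 0 < e -> exists n (s : J n -> bool),
    p (symdiff A [set x | s (Q n x)]) <= e.

Lemma refine_level m n (s : J m -> bool) : (m <= n)%N ->
  exists s' : J n -> bool, forall x, D x -> s' (Q n x) = s (Q m x).
Proof.
move=> mn; exists (fun j => `[< exists x, [/\ D x, Q n x = j & s (Q m x)] >]) => x Dx.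
apply/asboolP/idP => [[y [Dy e sy]]|sx]; last by exists x.
by rewrite -(mono mn Dy Dx e).
Qed.

Lemma approximable_determined n (s : J n -> bool) A : N A ->
  (forall x, D x -> (A x <-> s (Q n x))) -> approximable A.
Proof.
move=> NA H; split=> // e e0; exists n, s.
rewrite (po_eq hp (B := set0)) ?(po_0 hp) ?ltW // => x Dx; split=> //= h.
by case: h; exact: H.
Qed.

Lemma rv_level n (s : J n -> bool) : N [set x | s (Q n x)].
Proof. exact: (rv_pred hp (fun j => s j) (@hQ n)). Qed.

Lemma approximable_not A : approximable A -> approximable (~` A).
Proof.
move=> [NA H]; split=> [|e e0]; first exact: (sa_not hN NA).
have [n [s Hs]] := H e e0; exists n, (fun j => ~~ s j).
apply: le_trans Hs; rewrite (po_eq hp (B := symdiff A [set x | s (Q n x)])) // => x _.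
rewrite /symdiff /=.
have /propext-> : is_true (~~ s (Q n x)) <-> ~ is_true (s (Q n x)) by split=> /negP.
have [?|?] := pselect (is_true (s (Q n x))); have [?|?] := pselect (A x); tauto.
Qed.

Lemma approximable_or A B : approximable A -> approximable B -> approximable (A `|` B).
Proof.
move=> [NA HA] [NB HB]; have NAB := sa_or hN NA NB; split=> // e e0.
have e2 : 0 < e / 2 by lra.
have [n [s Hs]] := HA _ e2; have [m [t Ht]] := HB _ e2.
have [s' Hs'] := refine_level s (leq_maxl n m).
have [t' Ht'] := refine_level t (leq_maxr n m).
exists (maxn n m), (fun j => s' j || t' j).
apply: (@le_trans _ _ (p (symdiff A [set x | s (Q n x)] `|` symdiff B [set x | t (Q m x)]))).
  apply: (po_le hp).
  - exact: (sa_symdiff NAB (rv_level (fun j => s' j || t' j))).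
  - exact: (sa_or hN (sa_symdiff NA (rv_level s)) (sa_symdiff NB (rv_level t))).
  - move=> x Dx; rewrite /symdiff /= Hs' // Ht' //.
    have /propext-> : is_true (s (Q n x) || t (Q m x)) <->
      is_true (s (Q n x)) \/ is_true (t (Q m x)) by split=> /orP.
    have [?|?] := pselect (is_true (s (Q n x))); have [?|?] := pselect (is_true (t (Q m x)));
      have [?|?] := pselect (A x); have [?|?] := pselect (B x); tauto.
apply: le_trans (po_subU hp _ _) _.
- exact: (sa_symdiff NA (rv_level s)).
- exact: (sa_symdiff NB (rv_level t)).
- lra.
Qed.

Lemma approximable_eq A B : (forall x, D x -> (A x <-> B x)) ->
  approximable A -> approximable B.
Proof.
move=> AB [NA H]; split=> [|e /H[n [s Hs]]]; first exact: (po_eqN hp AB).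
exists n, s; apply: le_trans Hs; rewrite (po_eq hp (B := symdiff A [set x | s (Q n x)])) //.
by move=> x Dx; have := AB x Dx; rewrite /symdiff /=; tauto.
Qed.

Lemma approximable0 : approximable set0.
Proof.
apply: (@approximable_determined 0 (fun=> false)); first by case: hN.
by move=> x _; split.
Qed.

Lemma po_union_tail (F : nat -> set T) (e : R) : (forall n, N (F n)) -> 0 < e ->
  exists n, p (\bigcup_k F k `&` ~` [set x | exists2 k, (k < n)%N & F k x]) <= e.
Proof.
move=> NF e0; have NU n : N [set x | exists2 k, (k < n)%N & F k x].
  have : N [set x | exists k, (k < n)%N /\ F k x].
    by apply: (sa_existsn hN) => k; exact: (sa_and hN (sa_const hN (k < n)%N) (NF k)).
  by congr N; apply/seteqP; split=> x /= [k []]; [exists k|exists k].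
have NUU : N (\bigcup_k F k) by case: hN => _ _; exact.
pose G := seqDU F.
have GE n x : G n x <-> F n x /\ ~ exists2 k, (k < n)%N & F k x.
  rewrite /G /seqDU -bigcup_mkord /=; split=> -[Fx h]; split=> // -[k]; 
  by move=> kn Fk; apply: h; exists k.
have NG n : N (G n).
  have := sa_and hN (NF n) (sa_not hN (NU n)); congr N.
  by apply/seteqP; split=> x /GE.
have sumG n : \sum_(i < n) p (G i) = p [set x | exists2 k, (k < n)%N & F k x].
  elim: n => [|n IH].
    by rewrite big_ord0 -(po_0 hp); congr p; apply/seteqP; split=> x //= [].
  rewrite big_ord_recr /= IH -(po_U hp) //; last by move=> x h /GE[].
  congr p; apply/seteqP; split=> x /=.
    by move=> [[k kn Fk]|/GE[]]; [exists k => //; exact: ltnW|exists n].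
  move=> [k]; rewrite ltnS leq_eqVlt => /orP[/eqP->|kn] Fk; last by left; exists k.
  have [h|h] := pselect (exists2 k, (k < n)%N & F k x); first by left.
  by right; apply/GE.
have := po_cvg hp NG (trivIset_seqDU F); rewrite -seqDU_bigcup_eq.
move=> /cvgrPdist_le/(_ e e0)[n _ /(_ n (leqnn n))] /=; rewrite sumG => h.
exists n; have := po_split hp NUU (NU n).
rewrite (po_eq hp (A := \bigcup_k F k `&` [set x | exists2 k, (k < n)%N & F k x])
  (B := [set x | exists2 k, (k < n)%N & F k x])); last first.
  by move=> x _; split=> [[]//|[k kn Fk]]; split; exists k.
by move: h; have := ler_norm (p (\bigcup_k F k) - p [set x | exists2 k, (k < n)%N & F k x]); lra.
Qed.

Lemma approximable_bigcup (F : nat -> set T) : (forall n, approximable (F n)) ->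
  approximable (\bigcup_n F n).
Proof.
move=> HF; have NF n : N (F n) by case: (HF n).
have NUU : N (\bigcup_k F k) by case: hN => _ _; exact.
split=> // e e0; have e2 : 0 < e / 2 by lra.
have [n Hn] := po_union_tail NF e2.
have : approximable [set x | exists2 k, (k < n)%N & F k x].
  elim: n {Hn} => [|n IH].
    by apply: approximable_eq approximable0 => x _; split=> //= -[].
  apply: approximable_eq (approximable_or IH (HF n)) => x _; split=> /=.
    by move=> [[k kn Fk]|Fn]; [exists k => //; exact: ltnW|exists n].
  by move=> [k]; rewrite ltnS leq_eqVlt => /orP[/eqP->|kn] Fk; [right|left; exists k].
set B := [set x | _] in Hn *; move=> [NB /(_ _ e2)[m [s Hs]]].
exists m, s.
apply: (@le_trans _ _ (p ((\bigcup_k F k `&` ~` B) `|` symdiff B [set x | s (Q m x)]))).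
  have NC := sa_and hN NUU (sa_not hN NB); have NS := sa_symdiff NB (rv_level s).
  apply: (po_le hp) (sa_symdiff NUU (rv_level s)) (sa_or hN NC NS) _ => x _.
  have BU : B x -> (\bigcup_k F k) x by move=> [k _ Fk]; exists k.
  move: BU; rewrite /symdiff /setU /setI /setC /mkset.
  by have [?|?] := pselect (B x); have [?|?] := pselect ((\bigcup_k F k) x); tauto.
apply: le_trans (po_subU hp _ _) _; last by lra.
  exact: (sa_and hN NUU (sa_not hN NB)).
exact: (sa_symdiff NB (rv_level s)).
Qed.

Lemma salg_approximable : sigma_algebra setT approximable.
Proof.
split; [exact: approximable0|move=> A|exact: approximable_bigcup].
by rewrite setTD; exact: approximable_not.
Qed.

(** The level sets of [a] are approximated at one common level [n] and glued into a function [g] of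
    [Q n]. Fano's inequality bounds the entropy of [a] given [g \o Q n], and conditioning on the
    finer [Q n] only lowers it. *)
Lemma approximate_rv (I : finType) (a : T -> I) (e : R) : 0 < e ->
  (forall i, approximable [set x | a x = i]) ->
  exists n, ent p (pair_rv a (Q n)) <= ent p (Q n) + e.
Proof.
move=> e0 Ha; have ra : rv N a by move=> i; case: (Ha i).
have [[x0 _]|nD] := pselect (exists x, D x); last first.
  have := po_T hp; rewrite (po_eq hp (B := set0)) ?(po_0 hp); first by lra.
  by move=> x Dx; case: nD; exists x.
have [d d0 Hd] := fano hp I e0.
have c0 : 0 < (#|I|%:R : R) by rewrite ltr0n; apply/card_gt0P; exists (a x0).
have dc : 0 < d / #|I|%:R by rewrite divr_gt0.
pose P i (ns : {n : nat & J n -> bool}) :=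
  p (symdiff [set x | a x = i] [set x | projT2 ns (Q (projT1 ns) x)]) <= d / #|I|%:R.
have exP i : exists ns, P i ns.
  by have [n [s Hs]] := (Ha i).2 _ dc; exists (existT _ n s).
have [f Hf] := choice exP.
pose n := (\max_i projT1 (f i))%N.
have ex i : exists s : J n -> bool, forall x, D x ->
    s (Q n x) = projT2 (f i) (Q (projT1 (f i)) x).
  by apply: refine_level; exact: leq_bigmax.
have [s Hs] := choice ex.
(* The default and the choice made by [pick] are harmless: if the sets [s i] do not single out
   [a x], then [x] lies in one of the symmetric differences. *)
pose g (j : J n) : I := odflt (a x0) [pick i | s i j].
exists n.
have key : p [set x | a x <> g (Q n x)] <= d.
  have NE i : N (symdiff [set x | a x = i] [set x | s i (Q n x)]).
    exact: (sa_symdiff (ra i) (rv_level (s i))).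
  have sub : p [set x | a x <> g (Q n x)] <=
      p [set x | exists i, symdiff [set x | a x = i] [set x | s i (Q n x)] x].
    apply: (po_le hp).
    - exact: (rv_pred hp (fun q => q.1 <> g q.2) (rv_pair hp ra (@hQ n))).
    - exact: (sa_existsi hN NE).
    - move=> x Dx /= ne; apply: contrapT => h; apply: ne.
      have h' i : (a x = i <-> s i (Q n x)).
        by apply: contrapT => h2; apply: h; exists i.
      rewrite /g; case: pickP => [i /h'//|/(_ (a x))]; by rewrite (h' _).1.
  apply: (le_trans sub).
  have un (r : seq I) : p [set x | exists i, i \in r /\
      symdiff [set x | a x = i] [set x | s i (Q n x)] x] <= (size r)%:R * (d / #|I|%:R).
    elim: r => [|i r IH].
      by rewrite mul0r -(po_0 hp) (po_eq hp (B := set0)) // => x _; split=> // -[i []].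
    rewrite (po_eq hp (B := symdiff [set x | a x = i] [set x | s i (Q n x)] `|`
       [set x | exists i, i \in r /\ symdiff [set x | a x = i] [set x | s i (Q n x)] x])).
      apply: le_trans (po_subU hp (NE i) _) _.
        by apply: (sa_existsi hN) => k; exact: (sa_and hN (sa_const hN (k \in r)) (NE k)).
      rewrite /= mulrSr mulrDl mul1r addrC lerD //.
      apply: le_trans (Hf i); rewrite (po_eq hp (B := symdiff [set x | a x = i]
         [set x | projT2 (f i) (Q (projT1 (f i)) x)])) // => x Dx.
      by rewrite /symdiff /= Hs.
    move=> x _; split.
      by move=> [k [+ h]]; rewrite inE => /orP[/eqP<-|kr]; [left|right; exists k].
    by move=> [h|[k [kr h]]]; [exists i|exists k]; rewrite inE ?eqxx // kr orbT.
  have := un (enum I); rewrite -cardE mulrC divfK ?gt_eqF //; apply: le_trans.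
  rewrite le_eqVlt; apply/orP; left; apply/eqP; apply: (po_eq hp) => x _.
  by split=> [[i h]|[i [_ h]]]; exists i => //; rewrite mem_enum.
have hg : rv N (g \o Q n) by exact: (rv_comp hp).
have h1 := Hd a (g \o Q n) ra hg key.
have h2 := ent_cond_le hp ra (@hQ n) hg (@det_comp _ D _ _ (Q n) g).
lra.
Qed.

End Approximation.

(** * From measures and partitions to finite-valued functions *)

Section FromMeasures.
Context {R : realType} {T : Type}.
Variables (D : set T) (M : set (set T)) (mu : set T -> \bar R).
Hypothesis hM : sigma_algebra D M.
Hypothesis hmu : prob_measure D M mu.

Definition trace_sets : set (set T) := [set A | M (D `&` A)].
(** Real-valued, since entropies are, and defined on all sets through their trace on [D], so that
    the preceding sections apply to predicates on the whole type. *)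
Definition trace_prob (A : set T) : R := fine (mu (D `&` A)).

Lemma salg_trace : sigma_algebra setT trace_sets.
Proof.
have [h0 hD hU] := hM; split; rewrite /trace_sets /=.
- by rewrite setI0.
- move=> A /hD; congr M; apply/seteqP; split=> x /=.
    by move=> [Dx h]; split=> //; split=> // Ax; apply: h.
  by move=> [Dx [_ h]]; split=> // -[].
- by move=> F /hU; rewrite setI_bigcupr.
Qed.

Lemma mu_add A B : M A -> M B -> A `&` B = set0 -> (mu (A `|` B) = mu A + mu B)%E.
Proof.
move=> MA MB AB; have [mu0 mu_ge0 muU _] := hmu; have [M0 _ _] := hM.
have MF n : M (bigcup2 A B n) by case: n => [|[|n]].
rewrite -bigcup2E muU //; last first.
  move=> [|[|i]] [|[|j]] _ _ //= [x []] //=.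
    by move=> Ax Bx; have : (A `&` B) x by []; rewrite AB.
  by move=> Bx Ax; have : (A `&` B) x by []; rewrite AB.
apply: lim_near_cst => //; exists 2%N => // n /= n2.
rewrite -(subnKC n2) big_mkord big_split_ord /= big_ord_recr big_ord1 /=.
by rewrite big1 ?adde0 // => i _; rewrite /bigcup2.
Qed.

Lemma mu_fin A : M A -> A `<=` D -> mu A \is a fin_num.
Proof.
move=> MA AD; have [_ hD _] := hM; have [mu0 mu_ge0 _ mu1] := hmu.
have := mu_add MA (hD _ MA) (setDIK _ _); rewrite setDUK // mu1.
have := mu_ge0 _ MA; have := mu_ge0 _ (hD _ MA).
by case: (mu A) => [r| |] //; case: (mu _) => [r'| |].
Qed.

Lemma trace_probE A : trace_sets A -> (trace_prob A)%:E = mu (D `&` A).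
Proof. by move=> MA; rewrite fineK // mu_fin // => x []. Qed.

Lemma prob_on_trace : prob_on D trace_sets trace_prob.
Proof.
have [mu0 mu_ge0 muU mu1] := hmu; split.
- exact: salg_trace.
- by move=> A MA; apply: fine_ge0; exact: mu_ge0.
- by rewrite /trace_prob setIT mu1.
- move=> A B MA MB AB; apply: EFin_inj; rewrite EFinD !trace_probE //.
    rewrite setIUr mu_add //; apply/seteqP; split=> x // [[_ Ax] [_ Bx]].
    exact: AB Ax Bx.
  exact: (sa_or salg_trace).
- move=> F MF tF; have MU : trace_sets (\bigcup_n F n).
    by case: salg_trace => _ _; exact.
  have tF' : trivIset setT (fun n => D `&` F n).
    by move=> i j _ _ [x [[_ Fi] [_ Fj]]]; apply: tF => //; exists x.
  have E : (fun n => (\sum_(i < n) trace_prob (F i))%:E) =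
      (fun n => \sum_(0 <= i < n) mu (D `&` F i))%E.
    apply/funext => n; rewrite big_mkord -sumEFin; apply: eq_bigr => i _.
    exact: trace_probE.
  have c : ((fun n => (\sum_(i < n) trace_prob (F i))%:E) @ \oo -->
      (trace_prob (\bigcup_n F n))%:E)%E.
    rewrite trace_probE // setI_bigcupr muU // E; apply: is_cvg_nneseries => n _ _.
    exact: (mu_ge0 _ (MF n)).
  by have /fine_cvgP[_] := c.
- move=> A B AB; rewrite /trace_sets /=; congr M; apply/seteqP.
  by split=> x [Dx h]; split=> //; exact/(AB x Dx).
- move=> A B AB; rewrite /trace_prob; congr (fine (mu _)); apply/seteqP.
  by split=> x [Dx h]; split=> //; exact/(AB x Dx).
Qed.

(** The extra value [size s] is taken outside [D], where no cell is found; it matches the default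
    [set0] of [nth]. Cells are numbered by position, so empty cells do no harm. *)
Lemma partition_rv (s : seq (set T)) : fin_partition D M s ->
  exists a : T -> 'I_(size s).+1, rv trace_sets a /\
    forall i : 'I_(size s).+1, D `&` [set x | a x = i] = nth set0 s i.
Proof.
move=> [sM sdis scov]; pose ix x := find (fun A : set T => `[< A x >]) s.
have ixP x : D x -> (ix x < size s)%N /\ nth set0 s (ix x) x.
  rewrite -scov -bigcup_seq => -[A /= As Ax].
  have hs : has (fun A : set T => `[< A x >]) s by apply/hasP; exists A => //; exact/asboolP.
  by split; [rewrite -has_find|exact/asboolP/(nth_find set0 hs)].
have sD i : (i < size s)%N -> nth set0 s i `<=` D.
  by move=> si x sx; rewrite -scov -bigcup_seq; exists (nth set0 s i) => //=; exact: mem_nth.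
pose a x : 'I_(size s).+1 := inord (ix x); exists a.
have aE (i : 'I_(size s).+1) : D `&` [set x | a x = i] = nth set0 s i.
  apply/seteqP; split=> x /=.
    move=> [/ixP[lt_ix six] <-]; rewrite inordK //; exact: ltnW.
  have [si six|si] := ltnP i (size s); last by rewrite nth_default.
  have Dx := sD _ si _ six; split=> //; have [lt_ix sx] := ixP _ Dx.
  apply: val_inj; rewrite /= inordK; last exact: ltnW.
  apply: contrapT => ne; have : (nth set0 s (ix x) `&` nth set0 s i) x by [].
  by rewrite sdis.
split=> // i; rewrite /trace_sets /= aE.
have [si|si] := ltnP i (size s); first exact: sM.
by rewrite nth_default //; case: hM.
Qed.

Section Refinement.
Variables (Tm : T -> T) (hD : forall x, D x -> D (Tm x)) (s : seq (set T)).
Variables (m : nat) (a : T -> 'I_m.+1).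
Hypothesis sm : size s = m.
Hypothesis aE : forall i : 'I_m.+1, D `&` [set x | a x = i] = nth set0 s i.

(** An arbitrary [F] is needed for the induction: removing the last partition from the join replaces
    [F] by a sum over the cells of that partition. *)
Lemma sum_refine (F : set T -> R) n : F set0 = 0 ->
  \sum_(A <- refine D Tm s n) F A =
  \sum_j F (D `&` [set x | itin Tm a n x = j]).
Proof.
elim: n F => [|n IH] F F0 /=.
  rewrite big_seq1 (big_pred1 tt) => [|[]//]; congr F.
  by apply/seteqP; split=> x //= [].
rewrite /part_join big_allpairs_dep /part_pre.
under eq_bigr do rewrite big_map.
rewrite (IH (fun A => \sum_(B <- s) F (A `&` (D `&` iter n Tm @^-1` B)))); last first.
  by rewrite big1 // => B _; rewrite set0I.
transitivity (\sum_j \sum_i F (D `&` [set x |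
    pair_rv (itin Tm a n) (a \o iter n Tm) x = (j, i)])); last first.
  by rewrite pair_bigA; apply: eq_bigr => -[].
have Dn k x : D x -> D (iter k Tm x) by move=> Dx; elim: k => //= k; exact: hD.
apply: eq_bigr => j _; rewrite (big_nth set0) sm big_mkord big_ord_recr /=.
rewrite [X in _ = _ + X](_ : _ = 0) ?addr0; last first.
  rewrite -[RHS]F0; congr F; apply/seteqP; split=> x //= [Dx [_ ax]].
  have : (D `&` [set x | a x = ord_max]) (iter n Tm x) by split=> //; exact: Dn.
  by rewrite aE nth_default // sm.
apply: eq_bigr => i _; congr F.
have -> : nth set0 s i = D `&` [set x | a x = widen_ord (leqnSn m) i] by rewrite aE.
apply/seteqP; split=> x /=; first by move=> [[Dx <-] [_ [_ <-]]].
by move=> [Dx [<- <-]]; split=> //; split=> //; split=> //; exact: Dn.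
Qed.

Lemma part_entropy_refine n : mu set0 = 0%E ->
  part_entropy mu (refine D Tm s n) = ent trace_prob (itin Tm a n).
Proof.
move=> mu0; rewrite /part_entropy (sum_refine (F := fun A => eta (fine (mu A)))) //.
by rewrite mu0 etaE mul0r oppr0.
Qed.

End Refinement.

End FromMeasures.

(** * Entropy rate of a linearly bounded sequence *)

Section EntropyLimit.
Context {R : realType}.

(* No convergence is assumed: [limn] of a divergent sequence is 0. *)
Lemma limn_le_of_linear_bound (f : nat -> R) (c : R) : 0 <= c ->
  (forall e : R, 0 < e -> exists C, forall n, f n <= n%:R * (c + e) + C) ->
  limn ((fun n : nat => f n.+1 / n.+1%:R) : R^o ^nat) <= c.
Proof.
move=> c0 H; set u := (X in limn X).
have [cu|ncu] := pselect (cvgn u); last by rewrite (dvgP ncu).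
apply/ler_addgt0Pr => e e0; have e2 : 0 < e / 2 by lra.
have [C HC] := H _ e2.
apply: limr_le => //; near=> n.
have n0 : (0 : R) < n.+1%:R by [].
rewrite /u ler_pdivrMr //; apply: le_trans (HC n.+1) _.
have : C <= e / 2 * n.+1%:R.
  rewrite -ler_pdivrMl // mulrC; apply: le_trans (ler_norm _) _.
  near: n; exists (Num.bound (`|C / (e / 2)|)) => // n /= hn.
  apply: le_trans (ltW (archi_boundP _)) _; first exact: normr_ge0.
  by rewrite ler_nat (leq_trans hn).
lra.
Unshelve. all: by end_near.
Qed.

End EntropyLimit.

(** * Entropy of the invariant measures *)

Section SystemEntropy.
Variables (R : realType) (b : R).
Hypothesis hb : good_base b.
Variable mu : set (state R) -> \bar R.
Hypothesis hmu : invariant_prob (Dom b) (prodsig b) mu (Kmap b).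
Implicit Types (x y : state R).

Let K := Kmap b.
Let D := Dom b.
Let N := psig b.
Let p := trace_prob D mu.

Lemma prodsig_Dom : prodsig b (Dom b).
Proof.
have := @psig_rect R b _ _ sigO_T (sa_const (@salg_borel2 R) True); rewrite /psig /=.
by congr (prodsig b); apply/seteqP; split=> x //= [].
Qed.

Lemma prob_on_mu : prob_on D N p.
Proof. exact: prob_on_trace (salg_prodsig b) (proj1 hmu). Qed.

Lemma Dom_K x : D x -> D (K x). Proof. exact: Dom_Kmap. Qed.

Lemma psig_K A : N A -> N [set x | A (K x)].
Proof. by move=> NA; exact: (psig_iter hb 1 NA). Qed.

Lemma mu_K A : N A -> p [set x | A (K x)] = p A.
Proof.
move=> NA; rewrite /p /trace_prob -(proj2 hmu _ NA); congr (fine (mu _)).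
by apply/seteqP; split=> x /= [Dx h]; split=> //; [split=> //; exact: Dom_K|case: h].
Qed.

Lemma rv_digit : rv N (digit b). Proof. exact: psig_digit. Qed.

Definition window n x : {ffun 'I_n -> bool} := [ffun k : 'I_n => x.1 k].

Lemma rv_window n : rv N (window n).
Proof.
move=> t; have : N [set x : state R | forall k : 'I_n, x.1 (k : nat) = t k].
  by apply: (sa_foralli (salg_psig b)) => k; exact: (@psig_fst R b _ (sigO_coord k (t k))).
congr N; apply/seteqP; split=> x /=.
  by move=> h; apply/ffunP => k; rewrite ffunE.
by move=> <- k; rewrite ffunE.
Qed.

(* On a switch, [revealed] is the coin [omega_1] about to be used; it is a
   function of the digit sequence. *)
Definition revealed x : option bool := if x.2 \in Cunion b then Some (x.1 0%N) else None.

Lemma revealed_phi x c : D x -> (revealed x = Some c <->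
  switch b (phi b x) /\ bit b (code b (phi b x)) (phi b x 0%N) = c).
Proof.
move=> Dx; have h := phi_switch hb (n := 0) Dx.
have e : (x.2 \in Cunion b) = switch b (phi b x) by rewrite /switch code_phi.
rewrite /revealed e; move: h => /=; case: (switch b (phi b x)) => h; last by split=> // -[].
by rewrite h //; split=> [[<-]|[_ <-]].
Qed.

Definition revealed_set (o : option bool) : set Upsilon := [set u |
  if o is Some c then switch b u /\ bit b (code b u) (u 0%N) = c else ~ switch b u].

Lemma sigU_revealed o : sigU (revealed_set o).
Proof.
case: o => [c|]; last exact: (sa_not salg_sigU (sigU_switch hb)).
have : sigU [set u | switch b u /\ exists i, u 0%N = i /\
    (S_beta b (code b u) /\ bit b (code b u) i = c)].
  apply: (sa_and salg_sigU); first exact: sigU_switch.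
  apply: (sa_existsi salg_sigU) => i; apply: (sa_and salg_sigU); first exact: sigU_coord.
  exact: sigU_code (borel_bit hb i c).
congr sigU; apply/seteqP; split=> u /=; first by move=> [su [i [<- []]]].
by move=> [? ?]; split=> //; exists (u 0%N); split=> //; split=> //; exact: S_code.
Qed.

Lemma revealed_setE x o : D x -> (revealed_set o (phi b x) <-> revealed x = o).
Proof.
move=> Dx; case: o => [c|]; first exact: iff_sym (revealed_phi c Dx).
rewrite /revealed_set /= /revealed /switch (code_phi hb Dx).
by case: (x.2 \in Cunion b); split.
Qed.

Lemma rv_revealed : rv N revealed.
Proof.
move=> o; have := psig_phi hb (sigU_revealed o).
by apply: psig_eq => x Dx; exact: revealed_setE.
Qed.

Let digits n := itin K (digit b) n.

Lemma digits_eqP n x y : digits n x = digits n y <->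
  forall k, (k < n)%N -> phi b x k = phi b y k.
Proof. exact: itin_eqP. Qed.

Lemma rv_digits n : rv N (digits n).
Proof. exact: (rv_itin prob_on_mu psig_K rv_digit). Qed.

Lemma det_digits m n : (m <= n)%N -> det D (digits n) (digits m).
Proof.
move=> mn x y _ _ /digits_eqP h; apply/digits_eqP => k km; apply: h.
exact: leq_trans km mn.
Qed.

Section PhiApproximable.
Variables (J : nat -> finType) (Q : forall n, state R -> J n).
Hypothesis hQ : forall n, rv N (Q n).
Hypothesis mono : forall m n, (m <= n)%N -> det D (Q n) (Q m).
Hypothesis Qdigits : forall n, det D (Q n) (digits n).

Lemma approximable_det n (A : set (state R)) : N A ->
  (forall x y, D x -> D y -> Q n x = Q n y -> A x -> A y) ->
  approximable N p Q A.
Proof.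
move=> NA H; apply: (approximable_determined prob_on_mu (n := n)
  (s := fun j => `[< exists x, [/\ D x, Q n x = j & A x] >])) => // x Dx; split.
  by move=> Ax; apply/asboolP; exists x.
by move=> /asboolP[y [Dy e Ay]]; exact: H e Ay.
Qed.

(** Stated for every [Q] finer than the digits because it serves twice: with the digits alone, for
    the revealed coins, and with digits and coins, for the whole sigma-algebra. *)
Lemma approximable_phi B : sigU B -> approximable N p Q [set x | B (phi b x)].
Proof.
apply: (sa_preimage (salg_approximable prob_on_mu hQ mono)) => _ [n _ [i _ <-]].
apply: (approximable_det (n := n.+1)); first exact: (psig_phi hb (sigU_coord n i)).
by move=> x y Dx Dy /(Qdigits Dx Dy)/digits_eqP/(_ n (ltnSn n)) /= <-.
Qed.

End PhiApproximable.

Let Q n := pair_rv (digits n) (window n).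

Lemma rv_Q n : rv N (Q n).
Proof. exact: (rv_pair prob_on_mu (@rv_digits n) (@rv_window n)). Qed.

Lemma det_Q m n : (m <= n)%N -> det D (Q n) (Q m).
Proof.
move=> mn x y Dx Dy [h1 /ffunP h2]; rewrite /Q /pair_rv (det_digits mn Dx Dy h1).
congr pair; apply/ffunP => k; rewrite !ffunE.
by have := h2 (widen_ord mn k); rewrite !ffunE.
Qed.

Lemma det_Q_digits n : det D (Q n) (digits n).
Proof. by move=> x y _ _ []. Qed.

Lemma approximable_prodsig A : prodsig b A -> approximable N p Q A.
Proof.
have sQ := salg_approximable prob_on_mu rv_Q det_Q.
apply: (@smallest_sub _ _ _ (approximable N p Q)).
  split=> [|B HB|F HF]; [by case: sQ| |by case: sQ => _ _; exact].
  have := sa_not sQ HB; apply: (approximable_eq prob_on_mu) => x Dx /=.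
  by split=> [h|[]//]; split.
move=> _ [C HC [B HB <-]].
have hC : approximable N p Q [set x | C x.1].
  move: C HC; apply: (sa_preimage sQ) => _ [n _ [c _ <-]].
  apply: (approximable_det (n := n.+1)); first exact: (@psig_fst R b _ (sigO_coord n c)).
  move=> x y _ _ e /= <-; have /ffunP h : window n.+1 x = window n.+1 y := congr1 snd e.
  by have := h ord_max; rewrite !ffunE.
have hB : approximable N p Q [set x | B x.2].
  have := approximable_phi rv_Q det_Q det_Q_digits (sigU_code hb HB).
  by apply: (approximable_eq prob_on_mu) => x Dx; rewrite /= code_phi.
have := sa_and sQ hC hB; apply: (approximable_eq prob_on_mu) => x Dx /=.
by split=> [[]|[? []]].
Qed.

Lemma approximable_psig A : N A -> approximable N p Q A.
Proof.
move=> NA; have := approximable_prodsig NA; apply: (approximable_eq prob_on_mu) => x Dx.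
by split=> [[]|].
Qed.

(* Each switch shifts the coins by one, and the coin it consumes is revealed. *)
Lemma window_backwards L n k x y : D x -> D y ->
  (forall j, (j < n)%N -> revealed (iter j K x) = revealed (iter j K y)) ->
  (forall i, (i < L)%N -> (iter n K x).1 i = (iter n K y).1 i) ->
  (k <= n)%N -> forall i, (i < L)%N -> (iter k K x).1 i = (iter k K y).1 i.
Proof.
move=> Dx Dy hr hn kn; rewrite -(subKn kn); have : (n - k <= n)%N by exact: leq_subr.
elim: (n - k)%N => [|d IH] dn i iL; first by rewrite subn0 hn.
have {}IH := IH (ltnW dn).
have jn : (n - d.+1 < n)%N by rewrite ltn_subrL /=; exact: leq_ltn_trans dn.
have e : (n - d = (n - d.+1).+1)%N by rewrite subnSK.
move: IH (hr _ jn); rewrite e; move: (n - d.+1)%N jn => j jn IH.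
have Dxj := D_iter Dom_K j Dx; have Dyj := D_iter Dom_K j Dy.
move: IH Dxj Dyj; rewrite !iterS; case: (iter j K x) => w z; case: (iter j K y) => w' z'.
move=> IH Dz Dz'; rewrite /revealed.
have F := Kmap_fst hb w (Dz : S_beta b z); have F' := Kmap_fst hb w' (Dz' : S_beta b z').
move: IH; rewrite {}F {}F' /=.
case: (z \in _); case: (z' \in _) => // IH; last by move=> _; exact: IH.
by move=> [e0]; case: i iL => // i iL; exact: (IH i (ltnW iL)).
Qed.

(** The variable [X] below collects the coins revealed before time [n], [n + M] digits, and the [L]
    coins in hand at time [n]. By [window_backwards] it determines [Q L] at each time before [n],
    hence the itinerary of [a] up to [e] per step. Its entropy exceeds that of the digits by at most
    another [e] per step, for the revealed coins, plus the constant cost of one window. *)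
Lemma ent_itin_digits (I : finType) (a : state R -> I) (e : R) : rv N a -> 0 < e ->
  exists M C, forall n,
    ent p (itin K a n) <= ent p (digits (n + M)) + 2 * n%:R * e + C.
Proof.
move=> ha e0.
have [L hL] := approximate_rv prob_on_mu rv_Q det_Q e0 (fun i => approximable_psig (ha i)).
have [L' hL'] : exists n, ent p (pair_rv revealed (digits n)) <= ent p (digits n) + e.
  apply: (approximate_rv prob_on_mu rv_digits det_digits e0) => o.
  have := approximable_phi rv_digits det_digits
    (fun n => @det_refl _ D _ (digits n)) (sigU_revealed o).
  by apply: (approximable_eq prob_on_mu) => x Dx; exact: revealed_setE.
(* With [M] more digits, [L] and [L'] digits are still available from every time [k < n]. *)
pose M := maxn L L'; exists M, (ln #|{ffun 'I_L -> bool}|%:R) => n.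
have hW := rv_iter psig_K n (@rv_window L).
have hDM := @rv_digits (n + M); have hz := rv_itin prob_on_mu psig_K (n := n) rv_revealed.
have hZ := rv_pair prob_on_mu hz hDM; have hX := rv_pair prob_on_mu hZ hW.
have digits_iter j k : (j + k <= n + M)%N -> det D (digits (n + M)) (digits k \o iter j K).
  move=> jk x y Dx Dy /digits_eqP h; apply/digits_eqP => i ik.
  rewrite /= !phi_iter !iter_shiftU; apply: h.
  by apply: leq_trans jk; rewrite ltn_add2l.
have step1 := ent_itin_cond prob_on_mu psig_K mu_K (n := n) ha (@rv_Q L) hX.
have step2 := ent_itin_cond prob_on_mu psig_K mu_K (n := n) rv_revealed (@rv_digits L') hDM.
have {}step2 : ent p (pair_rv (itin K revealed n) (digits (n + M))) <=
    ent p (digits (n + M)) + n%:R * e.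
  apply: (le_trans (step2 _)) => [k kn|].
    by apply: digits_iter; rewrite leq_add ?leq_maxr // ltnW.
  by rewrite lerD2l ler_wpM2l //; lra.
pose X := pair_rv (pair_rv (itin K revealed n) (digits (n + M))) (window L \o iter n K).
have {}step1 : ent p (pair_rv (itin K a n) X) <= ent p X + n%:R * e.
  apply: (le_trans (step1 _)) => [k kn|]; last by rewrite lerD2l ler_wpM2l //; lra.
  move=> x y Dx Dy [/itin_eqP h1 h2 /ffunP h3].
  have h4 : digits L (iter k K x) = digits L (iter k K y).
    by apply: (digits_iter k L) => //; rewrite leq_add ?leq_maxl // ltnW.
  rewrite /Q /pair_rv /= h4.
  congr pair; apply/ffunP => i; rewrite !ffunE.
  apply: (window_backwards (L := L) (n := n)) => //; last exact: ltnW.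
  by move=> j jL; have := h3 (Ordinal jL); rewrite !ffunE.
have g1 := ent_pair_le prob_on_mu hZ hW.
have g2 := ent_card_le prob_on_mu hW.
have g3 := ent_pair_ge prob_on_mu hX (rv_itin prob_on_mu psig_K (n := n) ha).
rewrite ent_pairC in g3.
rewrite -/X in g1 g3; rewrite mulrAC; lra.
Qed.

(** The [n + M] digits are covered by blocks of length [k.+1], each of entropy [h] by invariance;
    the incomplete block goes into the constant. *)
Lemma ent_itin_linear (I : finType) (a : state R -> I) k (e : R) : rv N a -> 0 < e ->
  exists C, forall n,
    ent p (itin K a n) <= n%:R * (ent p (digits k.+1) / k.+1%:R + e) + C.
Proof.
move=> ha e0; have e2 : 0 < e / 2 by lra.
have [M [C HC]] := ent_itin_digits ha e2; set h := ent p (digits k.+1).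
have h0 : 0 <= h by apply: (ent_ge0 prob_on_mu); exact: rv_digits.
have k0 : 0 < k.+1%:R :> R by [].
exists (M%:R * (h / k.+1%:R) + h + C) => n; apply: le_trans (HC n) _.
pose q := ((n + M) %/ k.+1)%N.
have hq : ent p (digits (n + M)) <= q.+1%:R * h.
  apply: le_trans (ent_itinM prob_on_mu psig_K mu_K q.+1 k.+1 rv_digit).
  apply: (ent_itin_le prob_on_mu psig_K _ rv_digit); apply: ltnW.
  by rewrite -ltn_divLR.
have q1 : q%:R * h <= (n%:R + M%:R) * (h / k.+1%:R).
  have -> : q%:R * h = (q%:R * k.+1%:R) * (h / k.+1%:R) by field; lra.
  by apply: ler_wpM2r; [exact: divr_ge0|rewrite -natrM -natrD ler_nat leq_divM].
rewrite mulrS mulrDl mul1r in hq.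
move: hq q1; move: (ent p (digits (n + M))) (q%:R * h) (h / _) (n%:R : R) (M%:R : R).
move=> *; lra.
Qed.

Lemma entropy_part_le (s : seq (set (state R))) k :
  fin_partition (Dom b) (prodsig b) s ->
  entropy_part (Dom b) mu (Kmap b) s <= ent p (digits k.+1) / k.+1%:R.
Proof.
move=> hs; have [a [ha aE]] := partition_rv (salg_prodsig b) hs.
have mu0 : mu set0 = 0%E by have [[]] := hmu.
rewrite /entropy_part.
under eq_fun do rewrite (part_entropy_refine Dom_K erefl aE _ mu0).
apply: (limn_le_of_linear_bound (f := fun n => ent p (itin K a n))).
  by rewrite divr_ge0 // (ent_ge0 prob_on_mu (@rv_digits k.+1)).
by move=> e e0; exact: ent_itin_linear.
Qed.

End SystemEntropy.

(** * The Bernoulli measure *)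

Section Cylinders.
Context {R : realType}.
Implicit Types (u v w : Upsilon) (f g : set Upsilon -> R).

Definition cyl n w : set Upsilon := [set u | forall k, (k < n)%N -> u k = w k].

Lemma sigU_cyl n w : sigU (cyl n w).
Proof.
apply: (sigU_prefix (n := n)) => u v uv H k kn; rewrite -uv //; exact: H.
Qed.

Lemma cylI n m w v : (n <= m)%N ->
  cyl n w `&` cyl m v = set0 \/ cyl n w `&` cyl m v = cyl m v.
Proof.
move=> nm; have [h|h] := pselect (cyl n w v); [right|left]; apply/seteqP; split=> u //=.
- by case.
- move=> hu; split=> // k kn; rewrite hu ?h //; exact: leq_trans kn nm.
- move=> [h1 h2]; case: h => k kn; rewrite -h1 // h2 //; exact: leq_trans kn nm.
Qed.

Definition cyls : set (set Upsilon) := [set A | A = set0 \/ exists n w, A = cyl n w].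

Lemma cyls_setI : setI_closed cyls.
Proof.
move=> A B [->|[n [w ->]]] [->|[m [v ->]]]; rewrite ?set0I ?setI0; try by left.
have [nm|/ltnW mn] := leqP n m.
  by have [->|->] := cylI w v nm; [left|right; exists m, v].
by rewrite setIC; have [->|->] := cylI v w mn; [left|right; exists n, w].
Qed.

Lemma sigU_cyls : sigU `<=` <<s cyls >>.
Proof.
have sc : sigma_algebra setT <<s cyls >> by exact: smallest_sigma_algebra.
apply: (smallest_sub sc) => _ [n _ [i _ <-]].
have : <<s cyls >> [set u | exists t : {ffun 'I_n.+1 -> 'I_3},
    t ord_max = i /\ cyl n.+1 (fun k => t (inord k)) u].
  apply: (sa_existsi sc) => t; apply: (sa_and sc); first exact: (sa_const sc).
  by apply: sub_sigma_algebra; right; exists n.+1, (fun k => t (inord k)).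
congr (<<s cyls >>); apply/seteqP; split=> u /=.
  move=> [t [<- /(_ n (ltnSn n)) ->]]; congr (t _); apply: val_inj.
  by rewrite /= inordK.
move=> un; exists [ffun k : 'I_n.+1 => u k]; split; first by rewrite ffunE.
by move=> k kn; rewrite ffunE inordK.
Qed.

(** What Dynkin's argument requires of a set function. The mass of [setT] is left free, so that
    rescaled restrictions of a probability qualify. *)
Definition cadd f := (forall A, sigU A -> f (~` A) = f setT - f A) /\
  forall F : nat -> set Upsilon, (forall n, sigU (F n)) -> trivIset setT F ->
    (fun n => \sum_(i < n) f (F i)) @ \oo --> f (\bigcup_n F n).

(** Two cylinders are nested or disjoint, so together with [set0] they are stable under intersection
    and Dynkin's theorem applies. *)
Lemma cadd_unique f g : cadd f -> cadd g -> (forall n w, f (cyl n w) = g (cyl n w)) ->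
  forall B, sigU B -> f B = g B.
Proof.
move=> [fC fU] [gC gU] H; have [s0 sC sU] := salg_sigU.
have eT : f setT = g setT.
  have <- : cyl 0 (fun=> o0) = setT by apply/seteqP; split.
  exact: H.
have e0 : f set0 = g set0.
  have sT : sigU setT by rewrite -[setT]setD0; exact: sC.
  by rewrite -setCT fC // gC // eT.
suff : sigU `<=` [set B | sigU B /\ f B = g B] by move=> h B /h[].
apply: subset_trans sigU_cyls _.
rewrite -(setI_closed_g_dynkin_g_sigma_algebra cyls_setI).
apply: smallest_sub; last first.
  move=> _ [->|[n [w ->]]]; split=> //; exact: sigU_cyl.
split=> /=.
- by split=> //; rewrite -[setT]setD0; exact: sC.
- move=> A [sA e]; split; first by rewrite -setTD; exact: sC.
  by rewrite fC // gC // eT e.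
- move=> F tF hF; have sF n : sigU (F n) by case: (hF n).
  split; first exact: sU.
  have := fU F sF tF; have := gU F sF tF.
  have -> : (fun n => \sum_(i < n) g (F i)) = (fun n => \sum_(i < n) f (F i)).
    by apply/funext => n; apply: eq_bigr => i _; case: (hF i).
  move=> hg hf; exact: etrans (esym (cvg_lim (@Rhausdorff R) hf)) (cvg_lim (@Rhausdorff R) hg).
Qed.

(** Restriction to [E], image under [h] and scaling by [c] are combined to cover both uses: the
    first-digit restriction in [P_cons], with [c = 3], and the image of an invariant measure under
    [phi]. *)
Lemma cadd_image {T : Type} (D : set T) N (p : set T -> R) (h : T -> Upsilon) (E : set T) (c : R) :
  prob_on D N p -> (forall B, sigU B -> N [set x | B (h x)]) -> N E ->
  cadd (fun B => c * p [set x | E x /\ B (h x)]).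
Proof.
move=> hp hh NE; have hN := po_sigma hp; split.
  move=> A sA; rewrite -mulrBr; congr (_ * _).
  have := po_split hp NE (hh _ sA).
  have -> : p E = p [set x | E x /\ [set: Upsilon] (h x)].
    by congr p; apply/seteqP; split=> x //= [].
  have -> : E `&` [set x | A (h x)] = [set x | E x /\ A (h x)] by [].
  have -> : E `&` ~` [set x | A (h x)] = [set x | E x /\ (~` A) (h x)] by [].
  lra.
move=> F sF tF.
have -> : (fun n => \sum_(i < n) c * p [set x | E x /\ F i (h x)]) =
    (fun n => c * \sum_(i < n) p [set x | E x /\ F i (h x)]).
  by apply/funext => n; rewrite mulr_sumr.
have -> : [set x | E x /\ (\bigcup_n F n) (h x)] = \bigcup_n [set x | E x /\ F n (h x)].
  by apply/seteqP; split=> x /=; [move=> [Ex [n _ Fn]]|move=> [n _ [Ex Fn]]; split=> //]; exists n.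
apply: cvgM; first exact: cvg_cst.
apply: (po_cvg hp) => [n|]; first exact: (sa_and hN NE (hh _ (sF n))).
by move=> i j _ _ [x [[_ Fi] [_ Fj]]]; apply: tF => //; exists (h x).
Qed.

End Cylinders.

(** * Shift invariance, independence and recurrence for the uniform product *)

Section Bernoulli.
Variables (R : realType) (P : set Upsilon -> \bar R).
Hypothesis hP : uniform_product P.
Implicit Types (u v w : Upsilon).

Let pP (A : set Upsilon) : R := fine (P A).

Lemma prob_on_P : prob_on setT sigU pP.
Proof.
have := prob_on_trace salg_sigU (proj1 hP).
have -> : trace_sets setT sigU = sigU by apply/funext => A; rewrite /trace_sets /= setTI.
by have -> : trace_prob setT P = pP by apply/funext => A; rewrite /trace_prob setTI.
Qed.

Lemma PE A : sigU A -> P A = (pP A)%:E.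
Proof. by move=> sA; rewrite /pP fineK // (mu_fin salg_sigU (proj1 hP)). Qed.

Lemma P_cyl n w : pP (cyl n w) = 3^-1 ^+ n.
Proof. by rewrite /pP /cyl (proj2 hP) exprVn. Qed.

(** Multiplied by 3, the left side is a measure in [B] with the same values as [P] on cylinders. *)
Lemma P_cons i B : sigU B -> pP [set u | u 0%N = i /\ B (shiftU u)] = 3^-1 * pP B.
Proof.
move=> sB.
have c1 := cadd_image 3 prob_on_P (h := shiftU) (E := [set u | u 0%N = i])
  sigU_shift (sigU_coord 0 i).
have c2 := cadd_image 1 prob_on_P (h := id) (fun B (h : sigU B) => h) (sa_const salg_sigU True).
have key n w : 3 * pP [set u | u 0%N = i /\ cyl n w (shiftU u)] =
    1 * pP [set u | True /\ cyl n w u].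
  have -> : [set u | u 0%N = i /\ cyl n w (shiftU u)] =
      cyl n.+1 (fun k => if k is m.+1 then w m else i).
    apply/seteqP; split=> u /=; first by move=> [u0 h] [|k] // kn; exact: h.
    by move=> h; split=> [|k kn]; [exact: h 0%N _|exact: h k.+1 _].
  have -> : [set u | True /\ cyl n w u] = cyl n w by apply/seteqP; split=> u // [].
  by rewrite !P_cyl exprS; lra.
have := cadd_unique c1 c2 key sB => /=.
have -> : [set u | [set _ | True] u /\ B u] = B by apply/seteqP; split=> u // [].
have -> : [set u | [set u0 | u0 0%N = i] u /\ B (shiftU u)] =
  [set u | u 0%N = i /\ B (shiftU u)] by [].
lra.
Qed.

Lemma P_shift B : sigU B -> pP [set u | B (shiftU u)] = pP B.
Proof.
move=> sB; have h : rv sigU (fun u : Upsilon => u 0%N) by move=> i; exact: sigU_coord.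
rewrite (total_probability prob_on_P h (sigU_shift sB)).
rewrite (eq_bigr (fun=> 3^-1 * pP B)) ?sumr_const ?card_ord; first by lra.
move=> i _; rewrite -(P_cons i sB); congr pP.
by apply/seteqP; split=> u /= [].
Qed.

Lemma P_iter n B : sigU B -> pP [set u | B (iter n shiftU u)] = pP B.
Proof.
move=> sB; elim: n => // n <-; rewrite -(P_shift (sigU_iter n sB)).
by congr pP; apply/funext => u; rewrite /= -iterS iterSr.
Qed.

Lemma P_prefix n w B : sigU B ->
  pP [set u | cyl n w u /\ B (iter n shiftU u)] = 3^-1 ^+ n * pP B.
Proof.
elim: n w => [|n IH] w sB.
  by rewrite mul1r; congr pP; apply/seteqP; split=> u //= [].
rewrite exprS -mulrA -(IH (shiftU w) sB) -(P_cons (w 0%N)).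
  congr pP; apply/seteqP; split=> u /=.
    by rewrite -iterS iterSr => -[h1 h2]; split; [exact: h1|split=> // k kn; exact: h1].
  rewrite -iterS iterSr => -[h1 [h2 h3]]; split=> // -[|k] // kn; exact: h2.
exact: (sa_and salg_sigU (sigU_cyl n _) (sigU_iter n sB)).
Qed.

Lemma po_null_bigcup (F : nat -> set Upsilon) : (forall n, sigU (F n)) ->
  (forall n, pP (F n) = 0) -> pP (\bigcup_n F n) = 0.
Proof.
move=> sF F0; have hp := prob_on_P.
have sU : sigU (\bigcup_n F n) by case: salg_sigU => _ _; exact.
apply/eqP; rewrite eq_le (po_ge0 hp) // andbT; apply/ler_addgt0Pr => e e0; rewrite add0r.
have [n Hn] := po_union_tail hp sF e0; apply: le_trans Hn.
have B0 : sigU [set x | exists2 k, (k < n)%N & F k x] /\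
    pP [set x | exists2 k, (k < n)%N & F k x] <= 0.
  elim: n => [|n [sB IH]].
    have -> : [set x | exists2 k, (k < 0)%N & F k x] = set0.
      by apply/seteqP; split=> x //= [].
    by rewrite (po_0 hp); split=> //; case: salg_sigU.
  have -> : [set x | exists2 k, (k < n.+1)%N & F k x] =
      [set x | exists2 k, (k < n)%N & F k x] `|` F n.
    apply/seteqP; split=> x /=.
      move=> [k]; rewrite ltnS leq_eqVlt => /orP[/eqP->|kn] Fk; [by right|by left; exists k].
    by move=> [[k kn Fk]|Fn]; [exists k => //; exact: ltnW|exists n].
  split; first exact: (sa_or salg_sigU sB (sF n)).
  by apply: le_trans (po_subU hp sB (sF n)) _; rewrite F0 addr0.
have := po_split hp sU B0.1.
have := po_le hp (sa_and salg_sigU sU B0.1) B0.1 (fun x _ h => proj2 h).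
by have := B0.2; rewrite /setI /setC /mkset; lra.
Qed.

(* If [v] is a word forcing a switch, the sequences without any switch form a set
   [N0] contained in the preimage of [N0] by the [L]-th shift, minus the cylinder
   of [v], so that [P N0 <= (1 - 3^-L) P N0]. *)
Lemma P_not_recurrent (b : R) : good_base b -> pP (~` recurrent b) = 0.
Proof.
move=> hb; have hp := prob_on_P; have hN := salg_sigU.
have [q Sq [d d0 Hd]] := switch_point hb.
(* Any coins would do: they give a digit sequence of [q], and its first [L] digits force a point so
   close to [q] that it lies in [Cunion b]. *)
pose v := phi b ((fun=> false), q).
have vq : code b v = q by exact: (code_phi hb (x := ((fun=> false), q))).
have [L HL] := code_cylinder hb v d0.
have sw u : cyl L v u -> switch b u.
  by move=> /HL; rewrite vq => -[h1 h2]; apply/mem_set/Hd => //; exact: S_code.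
pose N0 := [set u | forall n, ~ switch b (iter n shiftU u)].
have sN0 : sigU N0.
  by apply: (sa_foralln hN) => n; apply: (sa_not hN); exact: (sigU_iter n (sigU_switch hb)).
have pN0 : pP N0 = 0.
  have sI := sigU_iter L sN0.
  have := po_split hp sI (sigU_cyl L v); rewrite P_iter //.
  have -> : [set u | N0 (iter L shiftU u)] `&` cyl L v =
      [set u | cyl L v u /\ N0 (iter L shiftU u)].
    by rewrite setIC.
  rewrite P_prefix //.
  have : pP N0 <= pP ([set u | N0 (iter L shiftU u)] `&` ~` cyl L v).
    apply: (po_le hp sN0 (sa_and hN sI (sa_not hN (sigU_cyl L v)))) => u _ Nu; split.
      by move=> n /=; rewrite -iterD; exact: Nu.
    by move=> /sw; exact: (Nu 0%N).
  have t0 : 0 < (3^-1 : R) ^+ L by apply: exprn_gt0; lra.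
  have x0 := po_ge0 hp sN0; move=> yx e.
  have h1 : (3^-1 : R) ^+ L * pP N0 <= 0 by lra.
  by apply/eqP; rewrite eq_le x0 andbT -(pmulr_rle0 _ t0).
have sR := sigU_recurrent hb.
have -> : ~` recurrent b = \bigcup_m [set u | N0 (iter m shiftU u)].
  apply/seteqP; split=> u /=.
    move=> /existsNP[m /forallNP h]; exists m => // n /= s; apply: (h (n + m)%N).
    by split; [exact: leq_addl|rewrite iterD].
  move=> [m _ h] /(_ m)[n [mn s]]; apply: (h (n - m)%N).
  by rewrite -iterD subnK.
by apply: po_null_bigcup => m; [exact: sigU_iter|rewrite P_iter].
Qed.

Lemma P_recurrent (b : R) : good_base b -> pP (recurrent b) = 1.
Proof.
move=> hb; have hp := prob_on_P; have sR := sigU_recurrent hb.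
have := po_split hp (sa_const salg_sigU True) sR.
have -> : [set _ | True] `&` recurrent b = recurrent b by rewrite setTI.
have -> : [set _ | True] `&` ~` recurrent b = ~` recurrent b by rewrite setTI.
rewrite P_not_recurrent // addr0 => <-; exact: (po_T hp).
Qed.

End Bernoulli.

(** * The measure of maximal entropy *)

Lemma good_base_le (R : realType) (c b : R) :
  c ^+ 3 - 2 * c ^+ 2 + 2 * c = 2 -> 3 / 2 < b -> b <= c -> good_base b.
Proof.
move=> hc h1 h2; split=> //.
(* This is the difference of the cubic at [c] and at [b]. The second factor equals (c - b)^2 / 4 + 3
   (c + b - 4/3)^2 / 4 + 2/3. *)
have h3 : 0 <= (c - b) * (c ^+ 2 + c * b + b ^+ 2 - 2 * (c + b) + 2).
  apply: mulr_ge0; first by lra.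
  have : 0 <= (c - b) ^+ 2 by exact: sqr_ge0.
  have : 0 <= (c + b - 4 / 3) ^+ 2 by exact: sqr_ge0.
  lra.
lra.
Qed.

Section MaximalEntropy.
Variables (R : realType) (b : R) (P : set Upsilon -> \bar R).
Hypothesis hb : good_base b.
Hypothesis hP : uniform_product P.
Implicit Types (x y : state R) (u v w : Upsilon).

Let pP (A : set Upsilon) : R := fine (P A).
Let D := Dom b.
Let K := Kmap b.
Let M := prodsig b.

Lemma recurrent_shift u : recurrent b (shiftU u) <-> recurrent b u.
Proof.
split=> h m.
  have [n [mn s]] := h m; exists n.+1; rewrite iterSr; split=> //; exact: ltnW.
have [[|n] [mn s]] := h m.+1; first by [].
by exists n; rewrite -iterSr.
Qed.

Lemma Zset_Kmap x : D x -> Zset b x -> Zset b (K x).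
Proof.
move=> Dx /(Zset_recurrent hb Dx) h; apply/(Zset_recurrent hb (Dom_Kmap hb Dx)).
by rewrite phi_Kmap; apply/recurrent_shift.
Qed.

Lemma Kmap_decode u : recurrent b u -> K (decode b u) = decode b (shiftU u).
Proof.
move=> ru; have Du := Dom_decode hb u; have DKu := Dom_Kmap hb Du.
rewrite /K -(decode_phi hb DKu); last exact: (Zset_Kmap Du (Zset_decode hb ru)).
by rewrite phi_Kmap phi_decode.
Qed.

(** All computations with [nu] use this form, the image of [P] under [decode]. *)
Lemma nuE A : M A -> nu b P A = (pP [set u | recurrent b u /\ A (decode b u)])%:E.
Proof.
move=> MA; rewrite /nu (PE hP); last exact: sigU_phi_image.
by rewrite (phi_imageE hb) //; exact: prodsig_sub.
Qed.

Let hpP : prob_on setT sigU pP := prob_on_P hP.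

Lemma P_recurrent_and (B : set Upsilon) : sigU B ->
  pP [set u | recurrent b u /\ B u] = pP B.
Proof.
move=> sB; have sR := sigU_recurrent hb; have sI := sa_and salg_sigU sR sB.
have sC := sa_not salg_sigU sR; have sBC := sa_and salg_sigU sB sC.
have le0 : pP (B `&` ~` recurrent b) <= pP (~` recurrent b).
  exact: (po_le hpP sBC sC (fun u _ h => proj2 h)).
have ge0 : 0 <= pP (B `&` ~` recurrent b) := po_ge0 hpP sBC.
rewrite (po_split hpP sB sR) [B `&` recurrent b]setIC.
have /eqP -> : pP (B `&` ~` recurrent b) == 0.
  by rewrite eq_le ge0 andbT -(P_not_recurrent hP hb).
by rewrite addr0.
Qed.

Lemma prob_measure_nu : prob_measure D M (nu b P).
Proof.
have [P0 P_ge0 PU P1] := proj1 hP; split.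
- by rewrite /nu setI0 image_set0.
- by move=> A MA; apply: P_ge0; exact: sigU_phi_image.
- move=> F MF tF; rewrite -PU.
  + by rewrite /nu setI_bigcupr image_bigcup.
  + by move=> n; exact: (sigU_phi_image hb (MF n)).
  (* The images are disjoint because a recurrent [u] comes from the single state [decode b u] of
     [Zset b]. *)
  + move=> i j _ _ [u []].
    rewrite (phi_imageE hb (prodsig_sub (MF i))) (phi_imageE hb (prodsig_sub (MF j))).
    by move=> [_ Fi] [_ Fj]; apply: tF => //; exists (decode b u).
- rewrite nuE; last exact: prodsig_Dom.
  have -> : [set u | recurrent b u /\ D (decode b u)] = recurrent b.
    by apply/seteqP; split=> u /= => [[]//|h]; split=> //; exact: Dom_decode.
  by rewrite /pP (P_recurrent hP hb).
Qed.

Lemma M_Kmap B : M B -> M (D `&` K @^-1` B).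
Proof. exact: psig_Kmap. Qed.

Lemma nu_invariant B : M B -> nu b P (D `&` K @^-1` B) = nu b P B.
Proof.
move=> MB; rewrite !nuE //; last exact: M_Kmap.
have sB : sigU [set u | recurrent b u /\ B (decode b u)].
  exact: (sa_and salg_sigU (sigU_recurrent hb) (sigU_decode hb MB)).
congr _%:E; apply: etrans (P_shift hP sB); congr (fine (P _)); apply/seteqP; split=> u.
  move=> [ru [_ h]]; have {}h : B (K (decode b u)) := h.
  by split; [apply/recurrent_shift|rewrite -Kmap_decode].
move=> [/recurrent_shift ru h]; split=> //; split; first exact: Dom_decode.
by have : B (K (decode b u)) by rewrite Kmap_decode.
Qed.

Lemma invariant_prob_nu : invariant_prob D M (nu b P) K.
Proof. by split; [exact: prob_measure_nu|exact: nu_invariant]. Qed.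

Lemma isomorphic_nu : isomorphic D M (nu b P) K setT sigU P shiftU.
Proof.
have sR := sigU_recurrent hb.
have MX : M (D `&` Zset b) by exact: psig_Zset.
have MXB B : sigU B -> M ((D `&` Zset b) `&` phi b @^-1` B).
  move=> sB; have := sa_and (salg_psig b) (psig_Zset hb) (psig_phi hb sB).
  by rewrite /psig /=; congr M; rewrite setIA.
split; first by split; [split; [exact: Dom_Kmap|exact: M_Kmap]|exact: invariant_prob_nu].
split.
  split; first by split=> // B sB; rewrite setTI; exact: sigU_shift.
  split; first exact: (proj1 hP).
  move=> B sB; rewrite setTI; have sB' := sigU_shift sB.
  by apply: etrans (PE hP sB') _; rewrite (P_shift hP sB) -(PE hP sB).
exists (D `&` Zset b), (recurrent b), (phi b), (decode b); split.
- split=> //; split; first by move=> x [].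
  split; last by move=> x [Dx Zx]; split; [exact: Dom_Kmap|exact: Zset_Kmap].
  rewrite nuE //.
  have -> : [set u | recurrent b u /\ (D `&` Zset b) (decode b u)] = recurrent b.
    apply/seteqP; split=> u /= => [[]//|h]; split=> //; split; first exact: Dom_decode.
    exact: Zset_decode.
  by rewrite /pP (P_recurrent hP hb).
- split=> //; split=> //; split; last by move=> u ru; apply/recurrent_shift.
  by rewrite (PE hP) // (P_recurrent hP hb).
- split.
    by move=> x [Dx Zx]; split; [apply/(Zset_recurrent hb Dx)|exact: decode_phi].
  move=> u ru; split; last exact: phi_decode.
  by split; [exact: Dom_decode|exact: Zset_decode].
- split=> // A MA; exact: (sa_and salg_sigU sR (sigU_decode hb MA)).
- split; last by move=> x _; exact: phi_Kmap.
  move=> B sB; rewrite nuE; last exact: MXB.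
  apply: etrans (esym (PE hP sB)); congr _%:E.
  apply: etrans (P_recurrent_and sB); congr pP.
  apply/seteqP; split=> u /= [ru]; first by move=> [_ /=]; rewrite phi_decode.
  move=> Bu; split=> //; split; last by rewrite /= phi_decode.
  by split; [exact: Dom_decode|exact: Zset_decode].
Qed.

Let digits n := itin K (digit b) n.

Lemma digits_word n (j : itin_type 'I_3 n) : exists w, forall x,
  digits n x = j <-> forall k, (k < n)%N -> phi b x k = w k.
Proof.
elim: n j => [|n IH]; first by case; exists (fun=> o0).
move=> [j i]; have [w Hw] := IH j; exists (fun k => if (k < n)%N then w k else i) => x.
split.
  move=> [/Hw h1 h2] k; rewrite ltnS leq_eqVlt => /orP[/eqP->|kn].
    by rewrite ltnn.
  by rewrite kn h1.
move=> h; rewrite /digits /= /pair_rv; congr pair.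
  by apply/Hw => k kn; rewrite h ?kn // ltnW.
by have := h n (ltnSn n); rewrite ltnn.
Qed.

Lemma card_words n : #|itin_type 'I_3 n|%:R = (3 : R) ^+ n.
Proof. by rewrite card_itin_type card_ord natrX. Qed.

Lemma rv_digits_psig n : rv (psig b) (digits n).
Proof.
move=> j; have [w Hw] := digits_word j.
have := psig_phi hb (sigU_cyl n w); apply: psig_eq => x _.
by split=> [h|/Hw h]; [apply/Hw|].
Qed.

Lemma ent_digits_nu n : ent (trace_prob D (nu b P)) (digits n) = n%:R * ln 3.
Proof.
have pmfE j : pmf (trace_prob D (nu b P)) (digits n) j = 3^-1 ^+ n.
  have [w Hw] := digits_word j; rewrite /pmf /trace_prob nuE; last exact: (rv_digits_psig j).
  apply: etrans (P_cyl hP n w); apply: etrans (P_recurrent_and (sigU_cyl n w)).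
  congr pP.
  apply/seteqP; split=> u /= [ru].
    by move=> [_ /Hw]; rewrite phi_decode.
  by move=> cu; split=> //; split; [exact: Dom_decode|apply/Hw; rewrite phi_decode].
rewrite /ent (eq_bigr (fun=> eta (3^-1 ^+ n))); last by move=> j _; rewrite pmfE.
rewrite sumr_const etaE exprVn lnV ?posrE ?exprn_gt0 // lnXn // mulrN opprK.
by rewrite -[LHS]mulr_natl card_words mulVKf // mulr_natl.
Qed.

Definition digit_partition : seq (set (state R)) :=
  [seq D `&` [set x | digit b x = i] | i <- enum 'I_3].

Lemma nth_digit_partition (i : 'I_3) :
  nth set0 digit_partition i = D `&` [set x | digit b x = i].
Proof. by rewrite (nth_map o0) ?size_enum_ord // nth_ord_enum. Qed.

Lemma fin_partition_digit : fin_partition D M digit_partition.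
Proof.
have sz : size digit_partition = 3%N by rewrite size_map size_enum_ord.
rewrite /fin_partition sz; split.
- by move=> i i3; rewrite (nth_digit_partition (Ordinal i3)); exact: psig_digit.
- move=> i j i3 j3 ij.
  rewrite (nth_digit_partition (Ordinal i3)) (nth_digit_partition (Ordinal j3)).
  apply/seteqP; split=> x //= [[_ e1] [_ e2]]; apply: ij.
  by have := congr1 val (etrans (esym e1) e2).
- rewrite big_map -bigcup_seq; apply/seteqP; split=> x; first by move=> [i _ []].
  by move=> Dx; exists (digit b x) => //=; rewrite mem_enum.
Qed.

(** The refinements have entropy exactly [n * ln 3], so the sequence defining the entropy is
    constant. *)
Lemma entropy_digit_partition_nu : entropy_part D (nu b P) K digit_partition = ln 3.
Proof.
have sM := salg_prodsig b.
have [a [ha aE]] := partition_rv sM fin_partition_digit.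
have sz : size digit_partition = 3%N by rewrite size_map size_enum_ord.
have hp := prob_on_trace sM prob_measure_nu.
have nu0 : nu b P set0 = 0%E by case: prob_measure_nu.
have aD x y : D x -> D y -> (a x = a y <-> digit b x = digit b y).
  have a_digit z : D z -> (a z : nat) = digit b z.
    move=> Dz; have h : (digit b z < (size digit_partition).+1)%N.
      by rewrite sz; exact: leq_trans (ltn_ord _) _.
    have : (D `&` [set x | digit b x = digit b z]) z by [].
    by rewrite -nth_digit_partition -(aE (Ordinal h)) => -[_ /= ->].
  move=> Dx Dy; split=> e; apply: val_inj; [|rewrite /=];
    by rewrite /= -?(a_digit x Dx) -?(a_digit y Dy) ?e // a_digit // a_digit // e.
have hNK A : psig b A -> psig b [set x | A (K x)] by exact: (psig_iter hb 1).
have entE n : ent (trace_prob D (nu b P)) (itin K a n) = n%:R * ln 3.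
  rewrite -ent_digits_nu; apply: (ent_equiv hp).
  - exact: (rv_itin hp hNK ha).
  - exact: (rv_digits_psig (n := n)).
  - move=> x y Dx Dy /itin_eqP h; apply/itin_eqP => k kn.
    by apply/(aD _ _ (Dom_iter hb k Dx) (Dom_iter hb k Dy)); exact: h.
  - move=> x y Dx Dy /itin_eqP h; apply/itin_eqP => k kn.
    by apply/(aD _ _ (Dom_iter hb k Dx) (Dom_iter hb k Dy)); exact: h.
rewrite /entropy_part.
under eq_fun do rewrite (part_entropy_refine (Dom_Kmap hb) erefl aE _ nu0) entE
  mulrAC divff // mul1r.
exact: lim_cst.
Qed.

Lemma ks_entropy_nu : ((ln 3)%:E <= ks_entropy D M (nu b P) K)%E.
Proof.
apply: ereal_sup_ubound; exists digit_partition; first exact: fin_partition_digit.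
by rewrite entropy_digit_partition_nu.
Qed.

Section InvariantMeasure.
Variable mu : set (state R) -> \bar R.
Hypothesis hmu : invariant_prob D M mu K.

Lemma ks_entropy_le k :
  (ks_entropy D M mu K <= (ent (trace_prob D mu) (digits k.+1) / k.+1%:R)%:E)%E.
Proof.
apply: ub_ereal_sup => _ [s hs <-]; rewrite lee_fin.
exact: (entropy_part_le hb hmu).
Qed.

Lemma ent_digits_le n : ent (trace_prob D mu) (digits n) <= n%:R * ln 3.
Proof.
apply: le_trans (ent_card_le (prob_on_mu hmu) (rv_digits_psig (n := n))) _.
by rewrite card_words lnXn // mulr_natl.
Qed.

Lemma ks_entropy_le_ln3 : (ks_entropy D M mu K <= (ln 3)%:E)%E.
Proof.
apply: le_trans (ks_entropy_le 0) _; rewrite lee_fin divr1.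
by apply: le_trans (ent_digits_le 1) _; rewrite mul1r.
Qed.

Lemma max_entropy_unique : ((ln 3)%:E <= ks_entropy D M mu K)%E ->
  forall A, M A -> mu A = nu b P A.
Proof.
move=> h3 A MA; have hpm := prob_on_mu hmu : prob_on D (psig b) (trace_prob D mu).
(* Each bound [ks_entropy_le] taken alone already forces maximal entropy on the words of the
   corresponding length. *)
have entE n : ent (trace_prob D mu) (digits n) = n%:R * ln 3.
  apply/eqP; rewrite eq_le ent_digits_le /=; case: n => [|n].
    by rewrite mul0r; exact: (ent_ge0 hpm (rv_digits_psig (n := 0))).
  have := le_trans h3 (ks_entropy_le n).
  by rewrite lee_fin ler_pdivlMr // mulrC.
have cylE n w : 1 * trace_prob D mu [set x | [set _ | True] x /\ cyl n w (phi b x)] =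
    1 * pP [set u | [set _ | True] u /\ cyl n w u].
  have -> : [set u | [set _ | True] u /\ cyl n w u] = cyl n w by apply/seteqP; split=> u // [].
  rewrite !mul1r; apply: etrans (esym (P_cyl hP n w)).
  have e : ent (trace_prob D mu) (digits n) = ln #|itin_type 'I_3 n|%:R.
    by rewrite card_words lnXn // entE mulr_natl.
  (* Every word occurs as the digits of a state: for [w] take [decode b w]. *)
  have := ent_card_eq hpm (digits n (decode b w)) (rv_digits_psig (n := n)) e.
  rewrite card_words -exprVn => <-.
  apply: (po_eq hpm) => x Dx; rewrite /= itin_eqP; split.
    by move=> [_ h] k kn; have := h k kn; rewrite -{1}(phi_decode hb w).
  by move=> h; split=> // k kn; rewrite -(phi_decode hb w); exact: h.
have c1 := cadd_image 1 hpm (fun B => @psig_phi _ _ hb B) (sa_const (salg_psig b) True).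
have c2 := cadd_image 1 hpP (h := id) (fun B (h : sigU B) => h) (sa_const salg_sigU True).
have push B : sigU B -> trace_prob D mu [set x | B (phi b x)] = pP B.
  move=> sB; have := cadd_unique c1 c2 cylE sB; rewrite /= !mul1r.
  have -> : [set x | [set _ | True] x /\ B (phi b x)] = [set x | B (phi b x)].
    by apply/seteqP; split=> x // [].
  by have -> : [set u | [set _ | True] u /\ B u] = B by apply/seteqP; split=> x // [].
have sR := sigU_recurrent hb.
have NA := prodsig_psig MA.
have NR := psig_phi hb sR.
(* Since [phi] sends [mu] to [P], the non-recurrent states are null for [mu]; on the others [decode]
   recovers the state, so the mass of [A] can be computed from digit sequences. *)
have nR : trace_prob D mu (~` [set x | recurrent b (phi b x)]) = 0.
  exact: (etrans (push _ (sa_not salg_sigU sR)) (P_not_recurrent hP hb)).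
have split_A := po_split hpm NA NR.
have NAR := sa_and (salg_psig b) NA (sa_not (salg_psig b) NR).
have le0 := po_le hpm NAR (sa_not (salg_psig b) NR) (fun x _ h => proj2 h).
have ge0 := po_ge0 hpm NAR.
have AR : trace_prob D mu (A `&` [set x | recurrent b (phi b x)]) =
    pP [set u | recurrent b u /\ A (decode b u)].
  rewrite -(push _ (sa_and salg_sigU sR (sigU_decode hb MA))).
  apply: (po_eq hpm) => x Dx /=; split=> [[Ax rx]|[rx]].
    by split=> //; rewrite decode_phi //; apply/(Zset_recurrent hb Dx).
  by rewrite decode_phi //; apply/(Zset_recurrent hb Dx).
rewrite nuE // -AR; have AD := prodsig_sub MA.
have -> : mu A = (trace_prob D mu A)%:E.
  rewrite (trace_probE (salg_prodsig b) (proj1 hmu)) //; first by rewrite setIidr.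
congr _%:E; move: le0 ge0 nR split_A; rewrite /setI /setC /mkset; lra.
Qed.

End InvariantMeasure.

Lemma unique_max_entropy_nu : unique_max_entropy D M (nu b P) K.
Proof.
split; first exact: invariant_prob_nu.
  by move=> mu hmu; exact: le_trans (ks_entropy_le_ln3 hmu) ks_entropy_nu.
by move=> mu hmu e; apply: max_entropy_unique => //; rewrite e; exact: ks_entropy_nu.
Qed.

End MaximalEntropy.

Theorem theorem6p9 (R : realType) (bstar beta : R)
    (P : set Upsilon -> \bar R) :
  bstar ^+ 3 - 2 * bstar ^+ 2 + 2 * bstar = 2 ->
  3 / 2 < beta -> beta <= bstar ->
  uniform_product P ->
  isomorphic (Dom beta) (prodsig beta) (nu beta P) (Kmap beta)
             setT sigU P shiftU /\
  unique_max_entropy (Dom beta) (prodsig beta) (nu beta P) (Kmap beta).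
Proof.
move=> hbs h1 h2 hP; have hb := good_base_le hbs h1 h2.
by split; [exact: isomorphic_nu|exact: unique_max_entropy_nu].
Qed.
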